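(* Let $k\in\mathbb{N}$, $k\geq 2$, and let $T^k=S^1\times\cdots\times S^1$ be the $k$-torus, whose points $\lambda=(\lambda_1,\ldots,\lambda_k)$ are written as $\lambda_j=e^{i\Theta_j}$ with $\Theta_j\in[-\pi,\pi]$, $1\leq j\leq k$. Let $$A(\lambda,t)=\begin{cases}(\arctan t)\,JS_{\Theta_1+\ldots+\Theta_k},& t\geq 0,\\ (\arctan t)\,JS_0,& t<0,\end{cases}\qquad S_\Theta=\begin{pmatrix}\cos\Theta&\sin\Theta\\ \sin\Theta&-\cos\Theta\end{pmatrix},\qquad J=\begin{pmatrix}0&-1\\1&0\end{pmatrix}.$$ Let $G:T^k\times\mathbb{R}\times\mathbb{R}^2\rightarrow\mathbb{R}$ be any continuous map such that each $G(\lambda,\cdot,\cdot)$ is $C^2$ with derivatives depending continuously on $\lambda\in T^k$, such that $G(\lambda,t,u)$ vanishes up to second order at $u=0$, and such that there are $p>0$, $C\geq 0$ and $g\in H^1(\mathbb{R},\mathbb{R})$ with $|D^2_uG(\lambda,t,u)|\leq g(t)+C|u|^p$ for all $\lambda\in T^k$, $t\in\mathbb{R}$, $u\in\mathbb{R}^2$. Set $\mathcal{H}_\lambda(t,u)=\frac12\langle A(\lambda,t)u,u\rangle+G(\lambda,t,u)$ and let $B\subset T^k$ be the set of all bifurcation points for homoclinic solutions from the stationary branch of the family of Hamiltonian systems $$Ju'(t)+\nabla_u\mathcal{H}_\lambda(t,u(t))=0,\quad t\in\mathbb{R},\qquad\lim_{t\rightarrow\pm\infty}u(t)=0.$$ Then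 the covering dimension of $B$ is at least $k-1$, and $B$ is not contractible to a point (i.e. the topological space $B$ is not contractible).
   Context: $\nabla_u$ is the gradient and $D^2_u$ the Hessian with respect to $u\in\mathbb{R}^2$. That $G$ vanishes up to second order at $u=0$ means $G(\lambda,t,0)=0$, $\nabla_uG(\lambda,t,0)=0$, $D^2_uG(\lambda,t,0)=0$ for all $(\lambda,t)$; in particular $u\equiv 0$ solves the Hamiltonian system for every $\lambda$. $C^1_0(\mathbb{R},\mathbb{R}^{2})$ is the Banach space of all continuously differentiable $u:\mathbb{R}\to\mathbb{R}^{2}$ such that $u$ and $u'$ vanish at infinity, with norm $\|u\|=\sup_{t}|u(t)|+\sup_{t}|u'(t)|$. Bifurcation point: $\lambda^\ast\in T^k$ is a bifurcation point for homoclinic solutions from the stationary branch if every neighbourhood of $(\lambda^\ast,0)$ in $T^k\times C^1_0(\mathbb{R},\mathbb{R}^{2})$ contains some $(\lambda,u)$ with $u\neq 0$ a solution of the Hamiltonian system for the parameter value $\lambda$. Covering dimension: $\dim Y$ is the minimal $n\in\mathbb{N}\cup\{0\}$ such that every finite open cover of $Y$ has a finite open refinement in which no point lies in more than $n+1$ elements ($\dim Y=\infty$ if there is no such $n$). *)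

(* Defs.v *)
From HB Require Import structures.
From mathcomp Require Import all_boot all_order all_algebra.
From mathcomp Require Import all_classical all_reals all_analysis.

Set Implicit Arguments.
Unset Strict Implicit.
Unset Printing Implicit Defensive.

Import Order.TTheory GRing.Theory Num.Theory.
Import numFieldNormedType.Exports.

Local Open Scope classical_set_scope.
Local Open Scope ring_scope.

Section Topology.
Variable R : realType.

Definition finite_open_cover (Y : topologicalType) (U : set (set Y)) : Prop :=
  [/\ finite_set U, (forall V, U V -> open V) & \bigcup_(V in U) V = [set: Y]].

Definition covering_dim_le (Y : topologicalType) (n : nat) : Prop :=
  forall U : set (set Y), finite_open_cover U ->
  exists V : set (set Y),
    [/\ finite_open_cover V,
        (forall W, V W -> exists2 W', U W' & W `<=` W') &
        forall y, ([set W | V W /\ W y] #<= `I_n.+1)%card].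

(* An infimum of a set of naturals in [\bar R]: it is a minimum when the set is
   nonempty, and [+oo] otherwise. *)
Definition covering_dim (Y : topologicalType) : \bar R :=
  ereal_inf [set n%:R%:E | n in covering_dim_le Y].

Definition contractible (Y : topologicalType) : Prop :=
  exists (y0 : Y) (h : Y * R -> Y),
    [/\ {within [set: Y] `*` `[0, 1], continuous h},
        (forall y, h (y, 0) = y) &
        forall y, h (y, 1) = y0].

End Topology.

Section Torus.
Variable R : realType.

Definition unit_circle : set (R * R) := [set z | z.1 ^+ 2 + z.2 ^+ 2 = 1].

Definition S1 : topologicalType := set_type unit_circle.

Lemma unit_circle_cossin (theta : R) : (cos theta, sin theta) \in unit_circle.
Proof. by apply/mem_set; rewrite /unit_circle /= cos2Dsin2. Qed.

Definition expi (theta : R) : S1 :=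
  SigSub (P := fun z => z \in unit_circle) (unit_circle_cossin theta).

Definition torus (k : nat) : topologicalType :=
  prod_topology (fun _ : 'I_k => S1).

(* The argument in [-pi, pi]; at the point -1 the choice between pi and -pi is
   irrelevant for [Amx], see [Amx_expi]. *)
Definition arg (z : S1) : R :=
  let z := set_val z in if 0 <= z.2 then acos z.1 else - acos z.1.

Lemma arg_itv (z : S1) : - pi <= arg z <= pi.
Proof.
case: z => -[x y] xy; rewrite /arg set_valE /=.
have /= h := set_mem xy; rewrite /unit_circle /= in h.
have x1 : -1 <= x <= 1.
  by rewrite -ler_norml -(@expr_le1 _ 2)// real_normK ?num_real// -h lerDl sqr_ge0.
have a0 := acos_ge0 x1; have ap := acos_lepi x1.
case: ifP => _; first by rewrite ap andbT (le_trans _ a0)// oppr_le0 pi_ge0.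
by rewrite lerN2 ap /= (le_trans _ (pi_ge0 _))// oppr_le0.
Qed.

Lemma argK : cancel arg expi.
Proof.
case=> -[x y] xy; apply: val_inj; rewrite /arg set_valE /=.
have /= h := set_mem xy; rewrite /unit_circle /= in h.
have x1 : -1 <= x <= 1.
  by rewrite -ler_norml -(@expr_le1 _ 2)// real_normK ?num_real// -h lerDl sqr_ge0.
have cx : cos (acos x) = x by rewrite acosK// in_itv.
have sx : sin (acos x) = `|y|.
  by rewrite sin_acos // -h addrAC subrr add0r sqrtr_sqr.
case: (leP 0 y) => y0; first by rewrite cx sx ger0_norm.
by rewrite cosN sinN cx sx ltr0_norm ?opprK.
Qed.

End Torus.

Section System.
Variables (R : realType) (k : nat).
Implicit Types (theta t : R) (lambda : torus R k).

Definition Jmx : 'M[R]_2 :=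
  \matrix_(i, j) (if i == j then 0 else if i == 0 then -1 else 1).

Definition Smx theta : 'M[R]_2 :=
  \matrix_(i, j)
    (if i == j then (if i == 0 then cos theta else - cos theta) else sin theta).

Definition Amx lambda t : 'M[R]_2 :=
  if 0 <= t then atan t *: (Jmx *m Smx (\sum_(j < k) arg (lambda j)))
  else atan t *: (Jmx *m Smx 0).

Lemma Amx_expi (theta : 'I_k -> R) t :
  Amx (fun j => expi (theta j)) t =
  if 0 <= t then atan t *: (Jmx *m Smx (\sum_(j < k) theta j))
  else atan t *: (Jmx *m Smx 0).
Proof.
suff e : cos (\sum_(j < k) arg (expi (theta j))) = cos (\sum_(j < k) theta j)
       /\ sin (\sum_(j < k) arg (expi (theta j))) = sin (\sum_(j < k) theta j).
  by rewrite /Amx /Smx; case: e => -> ->.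
apply: (big_rec2 (fun a b : R => cos a = cos b /\ sin a = sin b)) => //.
move=> j a b _ [ca sa].
have /(congr1 val)[c s] := argK (expi (theta j)).
by rewrite !cosD !sinD ca sa c s.
Qed.

Definition inner (u v : 'cV[R]_2) : R := \sum_i u i 0 * v i 0.

Definition gradient (f : 'cV[R]_2 -> R) (u : 'cV[R]_2) : 'cV[R]_2 :=
  \col_i 'D_(delta_mx i 0) f u.

Definition hessian (f : 'cV[R]_2 -> R) (u : 'cV[R]_2) : 'M[R]_2 :=
  \matrix_(i, j) 'D_(delta_mx j 0) ('D_(delta_mx i 0) f) u.

(* A family of C^n functions on V, parametrized by L, whose derivatives up to
   order n are continuous on L x V. *)
Fixpoint Cn_family (L : topologicalType) (V : normedModType R) (n : nat)
    (f : L -> V -> R) : Prop :=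
  continuous (fun p : L * V => f p.1 p.2) /\
  if n is n'.+1 then
    (forall l x, differentiable (f l) x) /\
    forall v, Cn_family n' (fun l => 'D_v (f l))
  else True.

Definition test_function (phi : R -> R) : Prop :=
  (forall n x, derivable (derive1n n phi) x 1) /\
  compact (closure [set x | phi x != 0]).

(* H^1(R, R), via weak derivatives. *)
Definition sobolev_H1 (g : R -> R) : Prop :=
  g \in Lfun (@lebesgue_measure R) 2%:E /\
  exists2 h : R -> R, h \in Lfun (@lebesgue_measure R) 2%:E &
    forall phi, test_function phi ->
      \int[@lebesgue_measure R]_x (g x * derive1 phi x) =
      - \int[@lebesgue_measure R]_x (h x * phi x).

Definition vanishes_at_infinity (u : R -> 'cV[R]_2) : Prop :=
  u t @[t --> +oo] --> (0 : 'cV[R]_2) /\ u t @[t --> -oo] --> (0 : 'cV[R]_2).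

Definition C10 (u : R -> 'cV[R]_2) : Prop :=
  [/\ (forall t, derivable u t 1), continuous (derive1 u),
      vanishes_at_infinity u & vanishes_at_infinity (derive1 u)].

(* Here and in the growth condition on the Hessian, the norms on R^2 and on
   2 x 2 matrices are the maximum norms of the library; as they are equivalent
   to the Euclidean and operator norms, this changes neither the topology of
   C^1_0 nor (g and C being existentially quantified) the growth condition. *)
Definition C1norm (u : R -> 'cV[R]_2) : R :=
  sup (range (fun t => `|u t|)) + sup (range (fun t => `|derive1 u t|)).

Variable G : torus R k -> R -> 'cV[R]_2 -> R.

Definition hamiltonian lambda t (u : 'cV[R]_2) : R :=
  2^-1 * inner (Amx lambda t *m u) u + G lambda t u.

Definition homoclinic_solution lambda (u : R -> 'cV[R]_2) : Prop :=
  (forall t, derivable u t 1 /\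
     Jmx *m derive1 u t + gradient (hamiltonian lambda t) (u t) = 0) /\
  vanishes_at_infinity u.

Definition bifurcation_points : set (torus R k) :=
  [set lambda0 | forall (U : set (torus R k)) (e : R),
     nbhs lambda0 U -> 0 < e ->
     exists (lambda : torus R k) (u : R -> 'cV[R]_2),
       [/\ U lambda, C10 u, C1norm u < e, u <> cst 0 &
           homoclinic_solution lambda u]].

End System.

(* Main.v *)
(* It suffices that [B] contains every [(e^(i psi_j))] with [\sum_j psi_j = 0].

   On each half-line the decaying solutions of the linearised system form a line;
   the values at [t = 0] of these two lines meet at the angle [Theta / 2], where
   [Theta = Theta_1 + ... + Theta_k]. Near a point with [Theta = 0], vary [Theta]
   alone. The Hessian of [G] is uniformly small near [u = 0]: the weak
   differentiability of [g] forces the growth bound to be small for large [|t|],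
   and compactness does the rest. Hence on each half-line the solutions decaying
   at infinity form a graph close to the line of the linear problem. For a fixed
   small [a > 0], the left graph point with first coordinate [a] lies on one side
   of the right graph for [Theta > 0] and on the other for [Theta < 0], so by the
   intermediate value theorem a nonzero homoclinic solution of size [O(a)] exists
   for some small [Theta].

   The points with [\sum_j psi_j = 0] form a [(k - 1)]-torus. It contains a
   [(k - 1)]-cube, to which the Lebesgue covering theorem applies, by way of a
   discrete Poincare-Miranda theorem. If [B] were contractible, the loop
   [(e^(is), e^(-is), 1, ..., 1)] would be null-homotopic in the torus, which
   lifting to angles excludes. *)

(* The coefficient [atan t] vanishes at [t = 0], so no exponential rate holds up to the origin. The
   half-line problems are therefore solved in the weight [xweight]: the square root of the natural
   decay [exp (- K)], with [K] the primitive of [atan], corrected by a factor [exp (atan t)] that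
   gives room near [0]. The angle is a point of a topological space [P] and the fixed point is
   constructed on [P * R], so continuous dependence on the angle, which the intermediate value
   theorem asks for, comes with uniform convergence.

   The sign change of the mismatch needs a Hessian bound [eps] small against [sin (th0 / 2)]. So
   [th0] comes from the neighbourhood of the point, [eps] from [th0], the radius [delta] from [eps],
   and the amplitude [a] from [delta] and the required norm.

   The function [g] is an arbitrary representative of its class, so it need not decay pointwise.
   What survives is that far out [g] cannot stay above some [r > 0] on a whole neighbourhood; as the
   Hessian is continuous, that is enough. *)
Require Import Defs.
From HB Require Import structures.
From mathcomp Require Import all_boot all_order all_algebra.
From mathcomp Require Import all_classical all_reals all_analysis.
From mathcomp Require Import ring lra.
Set Implicit Arguments.
Unset Strict Implicit.
Unset Printing Implicit Defensive.
Import Order.TTheory GRing.Theory Num.Theory.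
Import numFieldNormedType.Exports.
Local Open Scope classical_set_scope.
Local Open Scope ring_scope.

(** * Discrete Poincare-Miranda theorem *)

Section CubicalCup.
Variable n : nat.
Implicit Types (D S : {set 'I_n}) (v : {ffun 'I_n -> nat}).

Definition shift v D : {ffun 'I_n -> nat} := [ffun i => (v i + (i \in D))%N].

(** A cochain assigns a value to the cube with lowest vertex [v] and edge directions [D]. Over
    ['F_2] the two facets in each direction enter without signs. *)
Definition coboundary (U : {set 'I_n} -> {ffun 'I_n -> nat} -> 'F_2) D v : 'F_2 :=
  \sum_(j in D) (U (D :\ j) (shift v [set j]) + U (D :\ j) v).

Lemma addFF (x : 'F_2) : x + x = 0.
Proof. by rewrite addrr_pchar2 ?pchar_Fp. Qed.

Lemma shift_comm v i j :
  shift (shift v [set i]) [set j] = shift (shift v [set j]) [set i].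
Proof. by apply/ffunP => x; rewrite !ffunE addnAC. Qed.

Lemma shift_setU v i D : i \in D -> shift (shift v [set i]) (D :\ i) = shift v D.
Proof.
move=> iD; apply/ffunP => x; rewrite !ffunE !inE -addnA; congr (_ + _)%N.
by case: eqP => [->|//]; rewrite iD.
Qed.

Lemma setD1C D i j : D :\ i :\ j = D :\ j :\ i.
Proof. by apply/setP => x; rewrite !inE andbCA. Qed.

(** Each unordered pair of directions is counted twice, which is why the coboundary squares to zero
    mod 2. *)
Lemma sum_symmetric D (F : 'I_n -> 'I_n -> 'F_2) :
  (forall i j, F i j = F j i) ->
  \sum_(i in D) \sum_(j in D :\ i) F i j = 0.
Proof.
move=> FC; pose s (i j : 'I_n) : 'F_2 := if (i < j)%N then F i j else 0.
have sE i : \sum_(j in D :\ i) F i j = \sum_(j in D) (s i j + s j i).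
  rewrite [RHS]big_mkcond [LHS]big_mkcond; apply: eq_bigr => j _.
  rewrite !inE /s; case: (j \in D); rewrite ?andbF//= andbT.
  case: (ltngtP i j) => [ij|ji|/val_inj ->].
  - by rewrite addr0 -val_eqE /= gtn_eqF.
  - by rewrite add0r FC -val_eqE /= ltn_eqF.
  - by rewrite eqxx addr0.
under eq_bigr do rewrite sE big_split.
by rewrite big_split /= [X in _ + X]exchange_big /= addFF.
Qed.

Lemma coboundaryK U D v : coboundary (coboundary U) D v = 0.
Proof.
rewrite /coboundary -[RHS](@sum_symmetric D (fun i j =>
  U (D :\ i :\ j) (shift (shift v [set i]) [set j]) + U (D :\ i :\ j) (shift v [set i])
  + (U (D :\ i :\ j) (shift v [set j]) + U (D :\ i :\ j) v))).
  by apply: eq_bigr => i _; rewrite -big_split.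
move=> i j; rewrite (setD1C D j i) (shift_comm v j i).
by rewrite -!addrA; congr (_ + _); rewrite addrCA.
Qed.

Variable b : nat -> {ffun 'I_n -> nat} -> 'F_2.

(* The cubical cup product of the 1-cocycles [delta b_0], ..., [delta b_(d-1)],
   evaluated on the cube with lowest vertex [v] and edge directions [D]. *)
Fixpoint cup (d : nat) : {set 'I_n} -> {ffun 'I_n -> nat} -> 'F_2 :=
  if d is d'.+1 then coboundary (fun D v => cup d' D v * b d' (shift v D))
  else fun _ _ => 1.

Lemma coboundary_cup d D v : coboundary (cup d) D v = 0.
Proof.
case: d => [|d]; last exact: coboundaryK.
by rewrite /coboundary big1// => j _; rewrite addFF.
Qed.

(** Leibniz rule: as [cup d] is a cocycle, only the coboundary of [b d] survives. The result is the
    front face times back edge formula of the cup product. *)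
Lemma cupS d D v : cup d.+1 D v =
  \sum_(j in D) cup d (D :\ j) v * (b d (shift v D) + b d (shift v (D :\ j))).
Proof.
rewrite /= /coboundary /=.
under eq_bigr => j jD do rewrite shift_setU//=.
(* The vanishing coboundary of [cup d], multiplied by [b d] at the top vertex, is added so that the
   terms pair up. *)
have := congr1 (fun x => x * b d (shift v D)) (coboundary_cup d D v).
rewrite mul0r /coboundary big_distrl/= => e.
rewrite -[LHS]addr0 -[X in _ + X = _]e -big_split/=; apply: eq_bigr => j _.
rewrite mulrDl mulrDr addrACA addFF add0r addrC; congr (_ + _).
Qed.

(** The factor contributed by [b i] is its difference along an edge of the cube, which is zero when
    [b i] is constant on the vertices. *)
Lemma cup_constant d i D v : (i < d)%N ->
  (forall S, S \subset D -> b i (shift v S) = b i v) -> cup d D v = 0.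
Proof.
elim: d D => // d IHd D; rewrite ltnS leq_eqVlt => /orP[/eqP <-|id] bc;
  rewrite cupS big1// => j _.
  by rewrite bc// bc ?finset.subD1set// addFF mulr0.
by rewrite IHd ?mul0r// => S SD; apply: bc; exact: fintype.subset_trans SD (finset.subD1set _ _).
Qed.

Variable m : nat.
Hypothesis m_gt0 : (0 < m)%N.
Hypothesis b0 : forall (i : 'I_n) v, v i = 0%N -> b i v = 0.
Hypothesis b1 : forall (i : 'I_n) v, v i = m -> b i v = 1.

Local Notation grid := {ffun 'I_n -> 'I_m.+1}.

Definition grid_pt (w : grid) : {ffun 'I_n -> nat} := [ffun i => w i : nat].

(** These are the lowest vertices of the unit cubes that tile the face on which all coordinates
    outside [D] equal [m]. *)
Definition in_face D (w : grid) := [forall i, if i \in D then (w i < m)%N else w i == ord_max].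

Lemma sum_face_step D j (F : {ffun 'I_n -> nat} -> 'F_2) : j \in D ->
  \sum_(w | in_face D w) F (shift (grid_pt w) [set j]) =
  \sum_(w : grid | [forall i, if i == j then (0 < w i)%N else
     if i \in D then (w i < m)%N else w i == ord_max]) F (grid_pt w).
Proof.
move=> jD.
pose up (w : grid) : grid := [ffun i => if i == j then inord (w i).+1 else w i].
pose dn (w : grid) : grid := [ffun i => if i == j then inord (w i).-1 else w i].
rewrite [RHS](reindex_onto up dn) /=; last first.
  move=> w /forallP wj; apply/ffunP => i; rewrite !ffunE; case: eqP => [->|//].
  have := wj j; rewrite eqxx => wj0.
  have wjm : ((w j).-1 < m.+1)%N by rewrite (leq_ltn_trans (leq_pred _)).
  by rewrite (inordK wjm) prednK// inord_val.
(* At [w j = m] the value [inord m.+1] falls back to [0], which the condition [0 < up w j]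
   rejects. *)
have E (w : grid) : ([forall i, if i == j then (0 < up w i)%N else
     if i \in D then (up w i < m)%N else up w i == ord_max] && (dn (up w) == w))
     = in_face D w.
  apply/andP/forallP => [[/forallP h /eqP e] i|h].
    have := h i; rewrite !ffunE; case: eqP => [->|//] _; rewrite jD.
    have := congr1 (fun f : grid => f j) e; rewrite !ffunE eqxx.
    rewrite ltn_neqAle -ltnS ltn_ord andbT; case: (eqVneq (nat_of_ord (w j)) m) => // wm.
    by have := h j; rewrite !ffunE eqxx wm /inord /insubd insubF ?ltnn.
  have wj : (w j < m)%N by have := h j; rewrite jD.
  split.
    apply/forallP => i; rewrite !ffunE; case: eqP => [->|_]; last exact: h.
    by rewrite inordK.
  apply/eqP/ffunP => i; rewrite !ffunE; case: eqP => [->|//].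
  by apply: val_inj; rewrite /= !inordK//= ltnW.
rewrite (eq_bigl _ _ E); apply: eq_bigr => w /forallP h; congr F.
apply/ffunP => i; rewrite !ffunE !inE; case: eqP => [->|_]; rewrite ?addn0//.
by rewrite inordK ?addn1//; have := h j; rewrite jD.
Qed.

(** Stokes' formula in direction [j]: an inner layer occurs once from below and once from above, so
    mod 2 only the layers [w j = m] and [w j = 0] remain. *)
Lemma sum_face_telescope D j (F : {ffun 'I_n -> nat} -> 'F_2) : j \in D ->
  \sum_(w | in_face D w) (F (shift (grid_pt w) [set j]) + F (grid_pt w)) =
  \sum_(w | in_face (D :\ j) w) F (grid_pt w) +
  \sum_(w : grid | [forall i, if i == j then w i == ord0 else
     if i \in D then (w i < m)%N else w i == ord_max]) F (grid_pt w).
Proof.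
move=> jD; rewrite big_split/= sum_face_step//.
rewrite (bigID (fun w : grid => w j == ord_max))/=.
rewrite [X in _ + X](bigID (fun w : grid => w j == ord0))/=.
rewrite addrACA -[RHS]addr0; congr (_ + _).
  congr (_ + _).
    apply: eq_bigl => w; apply/andP/forallP => [[/forallP h /eqP wj] i|h].
      by have := h i; rewrite !inE; case: (i =P j) => [-> _|ij] /=; rewrite ?wj.
    have wj : w j = ord_max by have := h j; rewrite !inE eqxx => /eqP.
    split; last by rewrite wj.
    apply/forallP => i; have := h i; rewrite !inE; case: (i =P j) => //= -> _.
    by rewrite wj.
  apply: eq_bigl => w; apply/andP/forallP => [[/forallP h /eqP wj] i|h].
    have := h i; case: (i =P j) => // -> _; by rewrite wj.
  have wj : w j = ord0 by have := h j; rewrite eqxx => /eqP.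
  split; last by rewrite wj.
  by apply/forallP => i; have := h i; case: (i =P j) => // -> _; rewrite jD wj.
rewrite -[RHS](addFF (\sum_(w | in_face D w && (w j != ord0)) F (grid_pt w))).
congr (_ + _); apply: eq_bigl => w.
apply/andP/andP => -[/forallP h wj]; split.
- apply/forallP => i; have := h i; case: (i =P j) => // -> _; rewrite jD.
  by rewrite ltn_neqAle -ltnS ltn_ord andbT; apply: contra wj => /eqP e; apply/eqP/val_inj.
- have := h j; rewrite eqxx; apply: contraTN => /eqP ->; by rewrite ltnn.
- apply/forallP => i; have := h i; case: (i =P j) => // -> _; rewrite lt0n.
  by apply: contra wj => /eqP e; apply/eqP/val_inj.
- have := h j; rewrite jD; apply: contraTN => /eqP ->; by rewrite /= ltnn.
Qed.

(** Induction on the dimension of the face, by Stokes. For [j < d] the function [b j] is constant on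
    both facets orthogonal to [j], which kills the product. On the facet [w d = 0] the factor [b d]
    is [0]; on [w d = m] it is [1], which leaves the sum over the previous face. *)
Lemma cup_total d : (d <= n)%N ->
  \sum_(w | in_face [set i : 'I_n | (i < d)%N] w) cup d [set i : 'I_n | (i < d)%N] (grid_pt w) = 1.
Proof.
elim: d => [_|d IHd dn] /=.
  rewrite (bigD1 [ffun _ => ord_max])/=; last by apply/forallP => i; rewrite inE ltn0 ffunE.
  rewrite big1 ?addr0// => w /andP[/forallP h /eqP]; case.
  by apply/ffunP => i; have := h i; rewrite inE ltn0 ffunE => /eqP.
set D := [set i : 'I_n | (i < d.+1)%N]%SET.
pose U D v := cup d D v * b d (shift v D).
rewrite /coboundary exchange_big /=.
under eq_bigr => j jD.
  rewrite (sum_face_telescope (fun v => U (D :\ j) v))//; over.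
have dD : Ordinal dn \in D by rewrite inE /=.
rewrite (bigD1 (Ordinal dn)) //= [X in _ + X]big1 ?addr0; last first.
  move=> j /andP[jD jd].
  have {}jd : (j < d)%N.
    by move: jD; rewrite inE ltnS leq_eqVlt => /orP[/eqP e|//]; case/eqP: jd; exact: val_inj.
  rewrite !big1 ?addr0// => w /forallP /(_ j); rewrite ?inE eqxx /= => /eqP wj.
    rewrite /U (@cup_constant _ j) ?mul0r// => S SD.
    have jS : j \notin S by apply/negP => /(fintype.subsetP SD); rewrite !inE eqxx.
    by rewrite !b0 // !ffunE ?(negbTE jS) wj.
  rewrite /U (@cup_constant _ j) ?mul0r// => S SD.
  have jS : j \notin S by apply/negP => /(fintype.subsetP SD); rewrite !inE eqxx.
  by rewrite !b1 // !ffunE ?(negbTE jS) wj ?addn0.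
rewrite [X in _ + X]big1 ?addr0; last first.
  move=> w /forallP /(_ (Ordinal dn)); rewrite eqxx => /eqP wj.
  by rewrite /U (b0 (i := Ordinal dn)) ?mulr0 // !ffunE !inE eqxx wj.
have DE : D :\ Ordinal dn = [set i : 'I_n | (i < d)%N]%SET.
  apply/setP => i; rewrite !inE -val_eqE /= ltnS leq_eqVlt.
  by case: (ltngtP i d).
rewrite DE -[RHS](IHd (ltnW dn)); apply: eq_bigr => w /forallP/(_ (Ordinal dn)).
rewrite inE ltnn => /eqP wj.
by rewrite /U (b1 (i := Ordinal dn)) ?mulr1// !ffunE !inE ltnn wj addn0.
Qed.

End CubicalCup.

(** The total of the top product is [1] mod 2, so some cube carries a nonzero value, and on that
    cube no [b i] can be constant. *)
Lemma discrete_poincare_miranda (n m : nat) (b : 'I_n -> {ffun 'I_n -> nat} -> bool) :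
  (0 < m)%N ->
  (forall i (v : {ffun 'I_n -> nat}), v i = 0%N -> b i v = false) ->
  (forall i (v : {ffun 'I_n -> nat}), v i = m -> b i v = true) ->
  exists v : {ffun 'I_n -> nat}, (forall i, (v i < m)%N) /\
    forall i, exists S, b i (shift v S) != b i v.
Proof.
move=> m0 b0 b1.
pose c (i : nat) v : 'F_2 := if insub i is Some j then (b j v)%:R else 0.
have cE (i : 'I_n) v : c i v = (b i v)%:R by rewrite /c valK.
have c0 (i : 'I_n) (v : {ffun 'I_n -> nat}) : v i = 0%N -> c i v = 0 by move=> vi; rewrite cE b0.
have c1 (i : 'I_n) (v : {ffun 'I_n -> nat}) : v i = m -> c i v = 1 by move=> vi; rewrite cE b1.
have := cup_total m0 c0 c1 (leqnn n).
set D := [set i : 'I_n | (i < n)%N]%SET.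
case: (pickP (fun w : {ffun 'I_n -> 'I_m.+1} =>
    in_face D w && (cup c n D (grid_pt w) != 0))) => [w /andP[wD wc] _|w0].
  exists (grid_pt w); split=> [i|i].
    by move/forallP: wD => /(_ i); rewrite inE ltn_ord ffunE.
  apply/existsP; apply: contraNT wc; rewrite negb_exists => /forallP h.
  apply/eqP; apply: (@cup_constant _ _ _ i) => // S _; rewrite !cE.
  by have := h S; rewrite negbK => /eqP ->.
rewrite big1 => [/eqP|w wD]; first by rewrite eq_sym oner_eq0.
by have := w0 w; rewrite wD => /negbFE/eqP.
Qed.

(** * Lebesgue covering theorem *)

Section TruncatedDistance.
Variables (R : realType) (V : normedModType R).
Implicit Types (W : set V) (x y : V).

(** Distance to the complement of [W]. The value [1] keeps the set nonempty when [W] is the whole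
    space. *)
Definition tdist W x : R := inf [set r | r = 1 \/ exists2 y, ~ W y & r = `|x - y|].

Lemma tdist_lbound W x :
  lbound [set r | r = 1 \/ exists2 y, ~ W y & r = `|x - y|] 0.
Proof. by move=> r [->//|[y _ ->]]. Qed.

Lemma tdist_ge0 W x : 0 <= tdist W x.
Proof. by apply: lb_le_inf; [exists 1; left|exact: tdist_lbound]. Qed.

Lemma tdist_eq0 W x : ~ W x -> tdist W x = 0.
Proof.
move=> Wx; apply/eqP; rewrite eq_le tdist_ge0 andbT.
apply: ge_inf; first by exists 0; exact: tdist_lbound.
by right; exists x => //; rewrite subrr normr0.
Qed.

Lemma tdist_gt0 W x : open W -> W x -> 0 < tdist W x.
Proof.
move=> oW Wx; have /nbhs_ballP[e /= e0 eW] : nbhs x W by exact: open_nbhs_nbhs.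
apply: (@lt_le_trans _ _ (Num.min e 1)); first by rewrite lt_min e0 ltr01.
apply: lb_le_inf; first by exists 1; left.
move=> r [->|[y Wy ->]]; rewrite ge_min ?lexx ?orbT//.
rewrite leNgt; case: ltP => //= xy; exfalso; apply: Wy; apply: eW.
by rewrite -ball_normE.
Qed.

Lemma tdist_lip W x y : tdist W x <= tdist W y + `|x - y|.
Proof.
rewrite -lerBlDr; apply: lb_le_inf; first by exists 1; left.
move=> r rW; rewrite lerBlDr.
have [r' [rr' r'W]] : exists r', r' <= r + `|x - y| /\
    (r' = 1 \/ exists2 z, ~ W z & r' = `|x - z|).
  case: rW => [->|[z Wz ->]]; first by exists 1; split; [rewrite lerDl|left].
  exists `|x - z|; split; last by right; exists z.
  by have := ler_normD (x - y) (y - z); rewrite subrKA [X in _ -> _ <= X]addrC.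
by apply: le_trans rr'; apply: ge_inf => //; exists 0; exact: tdist_lbound.
Qed.

End TruncatedDistance.

Section LebesgueCovering.
Variables (R : realType) (n : nat) (I : finType) (W : I -> set 'rV[R]_n.+1).
Hypothesis W_open : forall i, open (W i).
Hypothesis W_cover : forall x, exists i, W i x.
Hypothesis W_faces : forall i j x y, W i x -> W i y -> x 0 j = 0 -> y 0 j = 1 -> False.
Hypothesis W_order : forall x, (#|[set i | `[<W i x>]]%SET| <= n.+1)%N.

(* For fixed cardinality of [s] these sets are pairwise disjoint, so that a cover
   of order [n.+1] is refined by [n.+1] disjoint families. *)
Let core (s : {set I}) : set 'rV[R]_n.+1 :=
  [set x | (forall i, i \in s -> W i x) /\
           forall i j, i \in s -> j \notin s -> tdist (W j) x < tdist (W i) x].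

(** Two distinct index sets of equal size each contain an element missing from the other, which
    would give opposite strict inequalities. *)
Let core_disjoint (s t : {set I}) x : #|s| = #|t| -> core s x -> core t x -> s = t.
Proof.
move=> st [_ sx] [_ tx].
have [sst|] := boolP (s \subset t).
  by apply/eqP; rewrite eqEcard sst st leqnn.
have [tss _|] := boolP (t \subset s).
  by apply/esym/eqP; rewrite eqEcard tss st leqnn.
case/subsetPn => i it is_ /subsetPn[j js jt].
by have := lt_trans (sx _ _ js is_) (tx _ _ it jt); rewrite ltxx.
Qed.

(** Take for [s] the indices of the sets containing [x]. Since [tdist] is 1-Lipschitz, within half
    of its least positive value it stays above [r / 2] on [s] and below [r / 2] off [s]. *)
Let core_near x : exists2 r, 0 < r & exists s : {set I}, (0 < #|s| <= n.+1)%N /\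
  forall y, `|x - y| < r -> core s y.
Proof.
pose s : {set I} := [set i | `[<W i x>]]%SET.
have ss i : i \in s -> 0 < tdist (W i) x by rewrite inE => /asboolP; exact: tdist_gt0.
have sn i : i \notin s -> tdist (W i) x = 0 by rewrite inE => /asboolP; exact: tdist_eq0.
pose r := \big[Num.min/1]_(i in s) tdist (W i) x.
have r0 : 0 < r by rewrite /r; elim/big_ind: _ => // a b a0 b0; rewrite lt_min a0.
have rs i : i \in s -> r <= tdist (W i) x by move=> si; rewrite /r; exact: bigmin_le_cond.
exists (r / 2); first by rewrite divr_gt0.
exists s; split.
  rewrite W_order andbT; have [i Wi] := W_cover x.
  by rewrite card_gt0; apply/set0Pn; exists i; rewrite inE; apply/asboolP.
move=> y xy.
have lo i : i \in s -> r / 2 < tdist (W i) y.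
  by move=> si; have := rs _ si; have := tdist_lip (W i) x y; lra.
have hi j : j \notin s -> tdist (W j) y < r / 2.
  by move=> sj; have := tdist_lip (W j) y x; rewrite (sn _ sj) distrC; lra.
split=> [i si|i j si sj]; last by apply: lt_trans (hi _ sj) (lo _ si).
apply: contrapT => Wy; have := lo _ si; rewrite tdist_eq0//.
by rewrite ltNge divr_ge0// ltW.
Qed.

Let cube_compact : compact [set x : 'rV[R]_n.+1 | forall i, x ord0 i \in `[0, 1]].
Proof.
by apply: (@rV_compact R _ (fun=> `[0, 1]%classic)) => i; exact: segment_compact.
Qed.

Let core_lebesgue : exists2 e, 0 < e &
  forall x : 'rV[R]_n.+1, (forall i, 0 <= x 0 i <= 1) ->
  exists s : {set I}, (0 < #|s| <= n.+1)%N /\ forall y, `|x - y| < e -> core s y.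
Proof.
have /compact_near_coveringP/near_covering_withinP := cube_compact.
move/(_ R (0 : R)^'+ (fun e x => exists s : {set I}, (0 < #|s| <= n.+1)%N /\
   forall y, `|x - y| < e -> core s y)).
case.
  move=> x _; have [r r0 [s [sn sr]]] := core_near x.
  near=> x' e => _; exists s; split => // y /= x'y; apply: sr.
  have xx' : `|x - x'| < r / 2.
    near: x'; have := @nbhsx_ballx _ _ x (r / 2); rewrite -ball_normE.
    by apply; rewrite divr_gt0.
  have er : e < r / 2 by near: e; apply: nbhs_right_lt; rewrite divr_gt0.
  have := ler_normD (x - x') (x' - y); rewrite subrKA; lra.
move=> e /= e0 eP; exists (e / 2); first by rewrite divr_gt0.
move=> x x01; apply: (eP (e / 2)) => //=.
- by rewrite sub0r normrN ger0_norm; lra.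
- by rewrite divr_gt0.
Unshelve. all: end_near. Qed.

(** A cube of mesh below the Lebesgue number lies in a single [core s]. Discrete Poincare-Miranda
    yields such a cube on which every colour changes, yet the colour with index [#|s| - 1] is
    constant there. *)
Lemma lebesgue_covering_contra : False.
Proof.
have [e e0 eP] := core_lebesgue.
have [m me] : exists m : nat, (m.+1%:R)^-1 < e.
  by exists (Num.truncn e^-1); rewrite invf_plt ?posrE// truncnS_gt.
pose pt (v : {ffun 'I_n.+1 -> nat}) : 'rV[R]_n.+1 := \row_i ((v i)%:R / m.+1%:R).
pose avoids (s : {set I}) (i : 'I_n.+1) := forall x : 'rV[R]_n.+1, core s x -> x 0 i <> 1.
(* Colour [i] watches the index sets of size [i + 1], so the bound [n + 1] on the order matches the
   number of coordinates. It is false on the cores of that size that do not reach the face where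
   coordinate [i] is [1]. *)
pose b (i : 'I_n.+1) (v : {ffun 'I_n.+1 -> nat}) := (v i != 0%N) &&
  ~~ `[< exists s : {set I}, [/\ #|s| = i.+1, core s (pt v) & avoids s i] >].
have [|i v vi|v [vm vb]] := @discrete_poincare_miranda n.+1 m.+1 b erefl.
- by move=> i v vi; rewrite /b vi.
- rewrite /b vi /=; apply/negP => /asboolP[s [_ + sav]] => /sav; apply.
  by rewrite mxE vi divff.
have v01 i : 0 <= (pt v) 0 i <= 1.
  by rewrite mxE divr_ge0//= ler_pdivrMr// mul1r ler_nat ltnW.
have [s [/andP[s0 sn] sv]] := eP _ v01.
have sS S : core s (pt (shift v S)).
  apply: sv; apply: le_lt_trans me.
  rewrite [leLHS]mx_normrE; apply/bigmax_leP; split => [|[i j] _] /=; first by rewrite invr_ge0.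
  rewrite !mxE ffunE -mulrBl natrD opprD addNKr normrM normrN.
  rewrite [X in _ * X]ger0_norm ?invr_ge0// ler_piMl ?invr_ge0//.
  by case: (_ \in _); rewrite ?normr1 ?normr0.
have is_ : (#|s|.-1 < n.+1)%N by rewrite prednK.
have [S] := vb (Ordinal is_); case/eqP.
have ci : #|s| = (Ordinal is_).+1 by rewrite /= prednK.
have shift0 : shift v finset.set0 = v by apply/ffunP => i; rewrite ffunE inE addn0.
have [sav|nsav] := pselect (avoids s (Ordinal is_)).
  have bF T : b (Ordinal is_) (shift v T) = false.
    by rewrite /b; apply/negP => /andP[_ /asboolP]; apply; exists s.
  by rewrite bF -shift0 bF.
(* Here [core s] reaches the face [1], so it cannot touch the face [0], and no other index set of
   the same size has these points in its core. *)
have bT T : b (Ordinal is_) (shift v T) = true.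
  have /existsNP[x /not_implyP[sx /contrapT x1]] := nsav.
  have [k ks] : exists k, k \in s by apply/set0Pn; rewrite -card_gt0.
  apply/andP; split.
    apply/eqP => v0; apply: (@W_faces k (Ordinal is_) (pt (shift v T)) x) => //.
    - exact: (sS T).1.
    - exact: sx.1.
    - by rewrite mxE v0 mul0r.
  apply/negP => /asboolP[t [tc ct tav]].
  suff st : t = s by apply: nsav; rewrite -[X in avoids X]st.
  by apply: (core_disjoint _ ct (sS T)); rewrite tc.
by rewrite bT -shift0 bT.
Qed.

End LebesgueCovering.

Lemma covering_dim_ge (R : realType) (Y : topologicalType) (n : nat)
    (c : 'rV[R]_n.+1 -> Y) (U : set (set Y)) :
  continuous c -> finite_open_cover U ->
  (forall A j x y, U A -> A (c x) -> A (c y) -> x 0 j = 0 -> y 0 j = 1 -> False) ->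
  (n.+1%:R%:E <= covering_dim R Y)%E.
Proof.
move=> cc fU Uf; apply: le_ereal_inf_tmp => _ [p pY <-].
rewrite lee_fin ler_nat leqNgt; apply/negP => pn.
have [V [[/finite_seqP[s0 Vs0] Vo VT] VU Vp]] := pY _ fU.
(* The order is counted on indices below, so distinct indices must stand for distinct members of
   [V]. *)
pose s := undup s0.
have Vs A : V A <-> A \in s by rewrite Vs0 /= mem_undup.
pose W (i : 'I_(size s)) : set 'rV[R]_n.+1 := c @^-1` (nth set0 s i).
have VW (i : 'I_(size s)) : V (nth set0 s i) by apply/Vs/mem_nth.
apply: (@lebesgue_covering_contra R n 'I_(size s) W).
- by move=> i; apply: open_comp => [x _|]; [exact: cc|exact: Vo].
- move=> x; have : [set: Y] (c x) by [].
  rewrite -VT => -[A /Vs As Ax]; have iA : (index A s < size s)%N by rewrite index_mem.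
  by exists (Ordinal iA); rewrite /W /= nth_index.
- move=> i j x y Wx Wy; have [A UA sA] := VU _ (VW i).
  exact: Uf UA (sA _ Wx) (sA _ Wy).
move=> x; have /pcard_leP[f] := Vp (c x).
set S := [set i | _]%SET.
have SP i : i \in S -> [set A | V A /\ A (c x)] (nth set0 s i).
  by rewrite inE => /asboolP Wi; split.
pose g (i : 'I_(size s)) : nat := f (nth set0 s i).
have gi : {in S &, injective g}.
  move=> i j iS jS gij; apply/val_inj/eqP.
  rewrite -(nth_uniq set0 (ltn_ord i) (ltn_ord j) (undup_uniq s0)); apply/eqP.
  by apply: (@inj _ _ _ f) => //; rewrite inE; exact: SP.
rewrite cardE -(size_map g) (leq_trans _ pn)// -(size_iota 0 p.+1).
apply: uniq_leq_size.
  rewrite map_inj_in_uniq ?enum_uniq// => i j; rewrite !mem_enum; exact: gi.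
move=> _ /mapP[i + ->]; rewrite mem_enum => /SP iS.
by rewrite mem_iota /= add0n; exact: (@funS _ _ _ _ f).
Qed.

(** * Continuity on the torus *)

Section Clamp.
Variable R : realType.
Implicit Types a b x y : R.

Definition clamp a b x : R := Num.max a (Num.min b x).

Lemma clamp_id a b x : a <= x <= b -> clamp a b x = x.
Proof. by move=> /andP[ax xb]; rewrite /clamp min_r// max_r. Qed.

Lemma clamp_itv a b x : a <= b -> a <= clamp a b x <= b.
Proof. by move=> ab; rewrite /clamp le_max lexx /= ge_max ab ge_min lexx. Qed.

Lemma clamp_continuous a b : continuous (clamp a b).
Proof.
move=> x; apply: continuous_max; first exact: cst_continuous.
apply: continuous_min; [exact: cst_continuous|exact: cvg_id].
Qed.

Lemma clamp_lip a b x y : `|clamp a b x - clamp a b y| <= `|x - y|.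
Proof.
rewrite /clamp /Num.max /Num.min.
by case: ifP; case: ifP; case: ifP; case: ifP => *; apply/ler_normlP; split;
  have := ler_norm (x - y); have := ler_normr (y - x) (x - y); lra.
Qed.
End Clamp.

Section Torus.
Variable R : realType.

Lemma continuous_pair (X : topologicalType) (U V : topologicalType) (f : X -> U) (g : X -> V) :
  continuous f -> continuous g -> continuous (fun x => (f x, g x)).
Proof. by move=> cf cg x; apply: cvg_pair; [exact: cf|exact: cg]. Qed.

Lemma continuous_set_type (X Y : topologicalType) (A : set Y) (f : X -> set_type A) :
  continuous (fun x => set_val (f x)) -> continuous f.
Proof. by move=> cf; apply: (@continuous_comp_initial _ X Y set_val f). Qed.

Lemma set_val_continuous (Y : topologicalType) (A : set Y) :
  continuous (set_val : set_type A -> Y).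
Proof. exact: (@initial_continuous (set_type A) Y set_val). Qed.

Lemma expi_continuous : continuous (@expi R).
Proof.
apply: continuous_set_type => /=.
apply: continuous_pair; [exact: continuous_cos|exact: continuous_sin].
Qed.

Lemma continuous_torus (X : topologicalType) k (f : X -> torus R k) :
  (forall j, continuous (fun x => f x j)) -> continuous f.
Proof.
move=> cf x; apply/cvg_sup => j.
exact: (@continuous_comp_initial _ X _ (fun g : (forall i : 'I_k, S1 R) => g j) f (cf j) x).
Qed.

Lemma torus_proj_continuous k j : continuous (fun l : torus R k => l j).
Proof. exact: (@proj_continuous _ (fun=> S1 R) j). Qed.

Lemma S1_unit (z : S1 R) : (set_val z).1 ^+ 2 + (set_val z).2 ^+ 2 = 1.
Proof. by have := set_valP z. Qed.

(** The argument of [w / z] on the unit circle, by the half-angle formula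
    [tan (x / 2) = sin x / (1 + cos x)]. It is continuous as long as [w] is not opposite to [z]. *)
Definition angle (z w : R * R) : R :=
  2 * atan ((z.1 * w.2 - z.2 * w.1) / (1 + (z.1 * w.1 + z.2 * w.2))).

Lemma cos_sin_double_atan (x y : R) : x ^+ 2 + y ^+ 2 = 1 -> 0 < 1 + x ->
  cos (2 * atan (y / (1 + x))) = x /\ sin (2 * atan (y / (1 + x))) = y.
Proof.
move=> xy x0; set a := atan _.
have ta : tan a = y / (1 + x) by rewrite /a atanK.
have ca : cos a != 0 by rewrite /a cos_atan invr_eq0 gt_eqF// sqrtr_gt0 ltr_pwDl ?sqr_ge0.
have ca2 : cos a ^+ 2 = (1 + x) / 2.
  rewrite /a cos_atan exprVn sqr_sqrtr ?addr_ge0 ?sqr_ge0//.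
  have -> : 1 + (y / (1 + x)) ^+ 2 = 2 / (1 + x).
    have -> : (y / (1 + x)) ^+ 2 = (1 - x ^+ 2) / (1 + x) ^+ 2 by rewrite expr_div_n; congr (_ / _); move: xy; lra.
    by field; rewrite gt_eqF.
  by rewrite invf_div.
have sa : sin a = y / (1 + x) * cos a by rewrite -ta /tan mulfVK.
rewrite mulr_natl cos_mulr2n sin_mulr2n sa mulrCA -expr2 ca2; split.
  by rewrite -mulr_natr; field.
by rewrite -mulr_natr; field; rewrite gt_eqF.
Qed.

(** One lifting step: a chord shorter than [1] in the maximum norm rules out opposite points, so the
    half-angle formula applies. *)
Lemma angleP (z w : R * R) (t : R) :
  z.1 ^+ 2 + z.2 ^+ 2 = 1 -> w.1 ^+ 2 + w.2 ^+ 2 = 1 -> `|z - w| < 1 ->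
  z = (cos t, sin t) -> w = (cos (t + angle z w), sin (t + angle z w)).
Proof.
case: z w => [a b] [c d] /= ab cd; rewrite prod_normE /= gt_max => /andP[ac bd] [at_ bt].
have x0 : 0 < 1 + (a * c + b * d).
  have : (a - c) ^+ 2 < 1 by rewrite -[X in X < _]real_normK ?num_real// exprn_ilt1.
  have : (b - d) ^+ 2 < 1 by rewrite -[X in X < _]real_normK ?num_real// exprn_ilt1.
  move: ab cd; nra.
have xy : (a * c + b * d) ^+ 2 + (a * d - b * c) ^+ 2 = 1.
  by rewrite -[RHS]mulr1 -[X in _ = X * _]ab -cd; ring.
rewrite cosD sinD /angle /=.
have [-> ->] := cos_sin_double_atan xy x0.
rewrite -at_ -bt; congr (_, _); rewrite -[LHS]mul1r -ab; ring.
Qed.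

Lemma angle_continuous (X : topologicalType) (z w : X -> R * R) :
  (forall x, 0 < 1 + ((z x).1 * (w x).1 + (z x).2 * (w x).2)) ->
  continuous z -> continuous w -> continuous (fun x => angle (z x) (w x)).
Proof.
move=> zw cz cw x.
have z1 : (z y).1 @[y --> x] --> (z x).1 by apply: (@cvg_comp _ _ _ z fst); [exact: cz|exact: cvg_fst].
have z2 : (z y).2 @[y --> x] --> (z x).2 by apply: (@cvg_comp _ _ _ z snd); [exact: cz|exact: cvg_snd].
have w1 : (w y).1 @[y --> x] --> (w x).1 by apply: (@cvg_comp _ _ _ w fst); [exact: cw|exact: cvg_fst].
have w2 : (w y).2 @[y --> x] --> (w x).2 by apply: (@cvg_comp _ _ _ w snd); [exact: cw|exact: cvg_snd].
apply: cvgM; first exact: cvg_cst.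
apply: continuous_cvg; first exact: continuous_atan.
apply: cvgM; first by apply: cvgB; apply: cvgM.
apply: cvgV; first by rewrite gt_eqF.
by apply: cvgD; [exact: cvg_cst|apply: cvgD; apply: cvgM].
Qed.

Lemma chord_lt (z w : R * R) : z.1 ^+ 2 + z.2 ^+ 2 = 1 -> w.1 ^+ 2 + w.2 ^+ 2 = 1 ->
  `|z - w| < 1 -> 0 < 1 + (z.1 * w.1 + z.2 * w.2).
Proof.
case: z w => [a b] [c d] /= ab cd; rewrite prod_normE /= gt_max => /andP[ac bd].
have : (a - c) ^+ 2 < 1 by rewrite -[X in X < _]real_normK ?num_real// exprn_ilt1.
have : (b - d) ^+ 2 < 1 by rewrite -[X in X < _]real_normK ?num_real// exprn_ilt1.
move: ab cd; nra.
Qed.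

End Torus.

(** * Contractibility *)

Section Loops.
Variable R : realType.

(** The homotopy is lifted by correcting the angle over finitely many short steps in [s]. The final
    lift still gains [2 pi] along the loop, so by the intermediate value theorem it takes a value
    [pi] away from its start, where the constant loop would be antipodal to itself. *)
Lemma circle_homotopy_endpoints (H : R * R -> R * R) (c : R * R) :
  continuous H ->
  (forall p, (H p).1 ^+ 2 + (H p).2 ^+ 2 = 1) ->
  (forall t, 0 <= t <= pi *+ 2 -> H (t, 0) = (cos t, sin t)) ->
  (forall t, 0 <= t <= pi *+ 2 -> H (t, 1) = c) ->
  (forall s, H (0, s) = H (pi *+ 2, s)) -> False.
Proof.
move=> cH H1 Hb He Hp.
have pi2 : 0 <= pi *+ 2 :> R by rewrite mulrn_wge0// pi_ge0.
have [n nP] : exists n : nat, forall t s s', 0 <= t <= pi *+ 2 -> 0 <= s <= 1 ->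
    `|s' - s| < n.+1%:R^-1 *+ 2 -> `|H (t, s) - H (t, s')| < 1.
  have : compact (`[(0 : R), pi *+ 2] `*` `[(0 : R), 1]).
    by apply: compact_setX; exact: segment_compact.
  move=> /compact_near_coveringP/near_covering_withinP.
  move=> /(_ R (0 : R)^'+ (fun e p => forall s', `|s' - p.2| < e -> `|H p - H (p.1, s')| < 1)).
  case.
    move=> [t s] _ /=.
    have /nbhs_ballP[r /= r0 rH] : nbhs (t, s) [set q | `|H (t, s) - H q| < 1 / 2].
      by have /cvgrPdist_lt/(_ (1 / 2)) := cH (t, s); apply; rewrite divr_gt0.
    near=> q e => _ s' /= s'e.
    have qb : ball (t, s) (r / 2) q by near: q; apply: nbhsx_ballx; rewrite divr_gt0.
    have er : e < r / 2 by near: e; apply: nbhs_right_lt; rewrite divr_gt0.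
    have h1 : `|H (t, s) - H q| < 1 / 2.
      by apply: rH; apply: le_ball qb; lra.
    have h2 : `|H (t, s) - H (q.1, s')| < 1 / 2.
      apply: rH; case: qb; rewrite /ball /= => b1 b2; split; rewrite /ball /=.
        by apply: lt_le_trans b1 _; lra.
      have := ler_normD (s - q.2) (q.2 - s'); rewrite subrKA (distrC q.2); lra.
    have := ler_normD (H q - H (t, s)) (H (t, s) - H (q.1, s')).
    rewrite subrKA; move: h1; rewrite distrC; lra.
  move=> e /= e0 eP.
  (* With this [n], two steps of length [1 / (n + 1)] are shorter than [e / 2]. *)
  exists (Num.truncn (4 / e)) => t s s' tI sI ss'.
  have := eP (e / 2) _ _ (t, s); apply => //=.
  - by rewrite sub0r normrN ger0_norm; lra.
  - by rewrite divr_gt0.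
  - apply: lt_trans ss' _; set u := _^-1; suff : u < e / 4 by move: u => u; lra.
    rewrite /u invf_plt ?posrE ?divr_gt0// invf_div; exact: truncnS_gt.
(* Clamping the loop parameter makes the estimates hold for all real [t], so that lifts can be
   functions on [R]. *)
pose l t := clamp (0 : R) (pi *+ 2) t.
have lI t : 0 <= l t <= pi *+ 2 by exact: clamp_itv.
have lid t : 0 <= t <= pi *+ 2 -> l t = t by exact: clamp_id.
have cl : continuous l by exact: clamp_continuous.
have [phi [cphi [phi_per phiP]]] : exists phi : R -> R, continuous phi /\
    (phi 0 = phi (pi *+ 2) /\ forall t, H (l t, 1) = (cos (l t + phi t), sin (l t + phi t))).
  have : forall i, (i <= n.+1)%N -> exists phi : R -> R, continuous phi /\
    (phi 0 = phi (pi *+ 2) /\ forall t, H (l t, i%:R / n.+1%:R) = (cos (l t + phi t), sin (l t + phi t))).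
    elim=> [_|i IHi iN].
      exists (cst 0); split; first exact: cst_continuous.
      by split => // t; rewrite mul0r Hb//= addr0.
    have [phi [cphi [phi_per phiP]]] := IHi (ltnW iN).
    pose z t := H (l t, i%:R / n.+1%:R).
    pose w t := H (l t, i.+1%:R / n.+1%:R).
    have iI : 0 <= (i%:R / n.+1%:R : R) <= 1.
      by rewrite divr_ge0//= ler_pdivrMr// mul1r ler_nat ltnW.
    have zw t : `|z t - w t| < 1.
      apply: nP => //; rewrite -mulrBl -natrB// subSnn mul1r gtr0_norm ?invr_gt0//.
      by rewrite mulr2n ltrDl invr_gt0.
    have cont s : continuous (fun t => H (l t, s)).
      move=> t; apply: (@continuous_comp _ _ _ (fun t => (l t, s)) H); last exact: cH.
      by apply: (@continuous_pair R R R l (cst s)) => // x; exact: cvg_cst.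
    exists (fun t => phi t + angle (z t) (w t)); split.
      move=> t; apply: cvgD; first exact: cphi.
      apply: angle_continuous; [|exact: cont|exact: cont].
      by move=> x; apply: chord_lt (H1 _) (H1 _) (zw _).
    split.
      by rewrite phi_per /z /w !lid ?lexx ?pi2// !Hp.
    move=> t; rewrite -/(w t) addrA; apply: angleP (H1 _) (H1 _) (zw t) _.
    exact: phiP.
  by move=> /(_ n.+1 (leqnn _)); rewrite divff.
pose g t := l t + phi t.
have cg : continuous g by move=> t; apply: cvgD; [exact: cl|exact: cphi].
have g2pi : g (pi *+ 2) = g 0 + pi *+ 2.
  by rewrite /g !lid ?lexx ?pi2// phi_per add0r addrC.
have [t tI gt] : exists2 t, t \in `[0, pi *+ 2] & g t = g 0 + pi.
  apply: IVT => //; first exact: continuous_subspaceT.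
  have p0 := pi_ge0 R; rewrite g2pi min_l ?max_r; first by apply/andP; split; lra.
    by lra.
  by lra.
have gc s : (cos (g s), sin (g s)) = c by rewrite -phiP He.
have [] := gc t; rewrite gt -{1}(gc 0) => -[+ +].
rewrite cosDpi sinDpi => h1 h2; have := cos2Dsin2 (g 0).
by have -> : cos (g 0) = 0 by [lra]; have -> : sin (g 0) = 0 by [lra]; rewrite expr0n /= addr0 => /esym/eqP; rewrite oner_eq0.
Unshelve. all: end_near. Qed.

Variable k : nat.
Variable B : set (torus R k).
Hypothesis B_antidiagonal : forall psi : 'I_k -> R, \sum_j psi j = 0 -> B (fun j => expi (psi j)).

Let to_B (psi : 'I_k -> R) (h : \sum_j psi j = 0) : set_type B :=
  SigSub (mem_set (B_antidiagonal h)).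

Lemma not_contractible_antidiagonal : (2 <= k)%N -> ~ contractible R (set_type B).
Proof.
move=> k2 [y0 [h [ch h0 h1]]].
have k1 : (1 < k)%N by []. have k0 : (0 < k)%N by exact: ltnW.
pose i0 := Ordinal k0. pose i1 := Ordinal k1.
pose psi (t : R) (j : 'I_k) : R := if j == i0 then t else if j == i1 then - t else 0.
have psi0 t : \sum_j psi t j = 0.
  rewrite (bigD1 i0)//= (bigD1 i1)//= big1 ?addr0.
    by rewrite /psi !eqxx /= subrr.
  by move=> j /andP[/negbTE j0 /negbTE j1]; rewrite /psi j0 j1.
pose l t := to_B (psi0 t).
have cl : continuous l.
  apply: continuous_set_type; apply: continuous_torus => j /=.
  move=> t; apply: (@continuous_comp _ _ _ (fun t => psi t j) (@expi R)); last exact: expi_continuous.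
  rewrite /psi; case: eqP => _; first exact: cvg_id.
  by case: eqP => _; [exact: oppr_continuous|exact: cvg_cst].
(* The coordinate [i0] alone winds once around the circle. Clamping the time extends the
   contraction, whose continuity is known over [[0, 1]] only. *)
pose H (p : R * R) : R * R := set_val (set_val (h (l p.1, clamp 0 1 p.2)) i0).
apply: (@circle_homotopy_endpoints H (set_val (set_val y0 i0))).
- move=> p; rewrite /H.
  apply: (@continuous_comp _ _ _ (fun p => set_val (h (l p.1, clamp 0 1 p.2)) i0) set_val); last exact: set_val_continuous.
  apply: (@continuous_comp _ _ _ (fun p => set_val (h (l p.1, clamp 0 1 p.2))) (fun m => m i0)); last exact: torus_proj_continuous.
  apply: (@continuous_comp _ _ _ (fun p => h (l p.1, clamp 0 1 p.2)) set_val); last exact: set_val_continuous.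
  pose A : set (set_type B * R) := [set: set_type B] `*` `[0, 1].
  have fA q : A (l q.1, clamp 0 1 q.2).
    by split => //=; rewrite in_itv /=; apply: clamp_itv.
  have cf : {for p, continuous (fun q : R * R => (l q.1, clamp 0 1 q.2))}.
    apply: (@continuous_pair _ _ _ (fun q : R * R => l q.1) (fun q : R * R => clamp 0 1 q.2)) => q.
      by apply: (@continuous_comp _ _ _ fst l); [exact: cvg_fst|exact: cl].
    by apply: (@continuous_comp _ _ _ snd (clamp 0 1)); [exact: cvg_snd|exact: clamp_continuous].
  move/subspace_continuousP: (ch) => /(_ _ (fA p)) hc.
  move=> U hU; apply: (@filterS _ (nbhs p) _ _ _ _ (cf _ (hc _ hU))) => q hq; apply: hq; exact: fA.
- by move=> p; exact: S1_unit.
- by move=> t _; rewrite /H /= clamp_id ?lexx ?ler01// h0.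
- by move=> t _; rewrite /H /= clamp_id ?lexx ?ler01// h1.
- move=> s; rewrite /H /=; congr (set_val (set_val (h (_, _)) i0)).
  apply: val_inj => /=; apply: functional_extensionality_dep => j; apply: val_inj => /=.
  rewrite /psi; case: eqP => _; first by rewrite cos2pi sin2pi cos0 sin0.
  by case: eqP => _ //; rewrite !cosN !sinN cos2pi sin2pi cos0 sin0.
Qed.

End Loops.

(** * Covering dimension *)

Section AntidiagonalDim.
Variables (R : realType) (n : nat).
Variable B : set (torus R n.+2).
Hypothesis B_antidiagonal :
  forall psi : 'I_n.+2 -> R, \sum_j psi j = 0 -> B (fun j => expi (psi j)).

Let psi (x : 'rV[R]_n.+1) (j : 'I_n.+2) : R :=
  if unlift ord_max j is Some j' then x 0 j' else - \sum_i x 0 i.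

Let sum_psi x : \sum_j psi x j = 0.
Proof.
rewrite big_ord_recr /= {2}/psi unlift_none; apply/eqP; rewrite subr_eq0; apply/eqP.
apply: eq_bigr => i _; rewrite /psi; have -> : widen_ord (leqnSn n.+1) i = lift ord_max i.
  by apply: val_inj; rewrite [RHS]lift_max.
by rewrite liftK.
Qed.

Let c (x : 'rV[R]_n.+1) : set_type B := SigSub (mem_set (B_antidiagonal (sum_psi x))).

Let c_continuous : continuous c.
Proof.
apply: continuous_set_type; apply: continuous_torus => j /= x.
apply: (@continuous_comp _ _ _ (psi^~ j) (@expi R)); last exact: expi_continuous.
rewrite /psi; case: unliftP => [j' _|_]; first exact: coord_continuous.
have sum_continuous (r : seq 'I_n.+1) : continuous (fun x : 'rV[R]_n.+1 => \sum_(i <- r) x 0 i).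
  elim: r => [|i r IHr].
    rewrite (_ : (fun x => _) = cst 0); first exact: cst_continuous.
    by apply/funext => y; rewrite big_nil.
  rewrite (_ : (fun x => _) = (fun x : 'rV[R]_n.+1 => x 0 i + \sum_(i <- r) x 0 i)).
    by move=> y; exact: (cvgD (@coord_continuous R 1 n.+1 0 i y) (IHr y)).
  by apply/funext => y; rewrite big_cons.
exact: (cvgN (sum_continuous (index_enum _) x)).
Qed.

(** For every [j] a member avoids one of the angles [0] and [1], hence one of two opposite faces of
    the cube. As [expi 0] and [expi 1] differ, the members cover all of [B], not only the image of
    the cube. *)
Let O (e : {ffun 'I_n.+1 -> bool}) : set (set_type B) :=
  [set y | forall j, set_val y (lift ord_max j) <> expi (if e j then 1 else 0)].

Let O_open e : open (O e).
Proof.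
rewrite openE => y Oy; rewrite /interior.
apply: (@filter_forall _ _ (fun j => [set y : set_type B | set_val y (lift ord_max j) <> expi (if e j then 1 else 0)]) (nbhs y) _) => j.
have cy : continuous (fun y : set_type B => set_val (set_val y (lift ord_max j))).
  move=> z; apply: (@continuous_comp _ _ _ (fun y : set_type B => set_val y (lift ord_max j)) set_val); last exact: set_val_continuous.
  apply: (@continuous_comp _ _ _ set_val (fun l : torus R n.+2 => l (lift ord_max j))).
    exact: set_val_continuous.
  exact: torus_proj_continuous.
have oC (p : R * R) : open (~` [set p]).
  by rewrite openC; apply: accessible_closed_set1; apply: hausdorff_accessible; exact: norm_hausdorff.
have := @open_comp _ _ _ _ (in1W cy) (oC (set_val (expi (if e j then 1 else 0)))).
rewrite openE => /(_ y) h; apply: filterS (h _) => /=.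
  by move=> z /= hz ez; apply: hz; rewrite ez.
by move=> ez; apply: (Oy j); exact: val_inj.
Qed.

Lemma covering_dim_antidiagonal : (n.+1%:R%:E <= covering_dim R (set_type B))%E.
Proof.
have expi10 : expi (1 : R) <> expi 0.
  move=> /(congr1 (fun z => (set_val z).2)) /=; rewrite sin0 => /eqP.
  rewrite gt_eqF// sin_gt0_pi// ltr01 /= (lt_le_trans _ (pi_ge2 R))//.
  by rewrite ltr1n.
apply: (@covering_dim_ge R _ n c (range O)); first exact: c_continuous.
  split.
  - exact: finite_image.
  - by move=> _ [e _ <-]; exact: O_open.
  rewrite eqEsubset; split => // y _.
  exists (O [ffun j => `[< set_val y (lift ord_max j) <> expi 1 >]]); first by exists [ffun j => `[< set_val y (lift ord_max j) <> expi 1 >]].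
  move=> j; rewrite ffunE; case: asboolP => // /contrapT ->; exact: expi10.
move=> _ j x y [e _ <-] /(_ j) + /(_ j) + x0 y1; rewrite /c /=.
by rewrite set_valE /= /psi liftK x0 y1; case: (e j).
Qed.

End AntidiagonalDim.

(** * Primitives and derivative comparison *)

Section Primitive.
Variable R : realType.
Implicit Types (f F w W : R -> R) (a b t : R).

Lemma is_derive_continuous F t (d : R) : is_derive t 1 F d -> {for t, continuous F}.
Proof. by move=> h; apply/differentiable_continuous/derivable1_diffP; exact: ex_derive. Qed.

Lemma derive_ge0_le F f a b : a <= b ->
  (forall s, a <= s <= b -> is_derive s 1 F (f s)) ->
  (forall s, a <= s <= b -> 0 <= f s) -> F a <= F b.
Proof.
move=> ab dF f0.
have [||c cab e] := @MVT_segment R F f a b ab.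
- by move=> x; rewrite in_itv => /andP[/ltW h1 /ltW h2]; apply: dF; rewrite h1.
- by apply: derivable_within_continuous => x; rewrite in_itv => /dF h; exact: ex_derive.
by rewrite -subr_ge0 e mulr_ge0 ?subr_ge0//; apply: f0.
Qed.

(** Both [W - F] and [W + F] are nondecreasing. On the half-lines this comparison stands in for
    estimating an integral by the integral of a bound. *)
Lemma derive_norm_le F W f w a b : a <= b ->
  (forall s, a <= s <= b -> is_derive s 1 F (f s)) ->
  (forall s, a <= s <= b -> is_derive s 1 W (w s)) ->
  (forall s, a <= s <= b -> `|f s| <= w s) -> `|F b - F a| <= W b - W a.
Proof.
move=> ab dF dW fw.
have h1 : W a - F a <= W b - F b.
  apply: (@derive_ge0_le (fun s => W s - F s) (fun s => w s - f s)) => // s sab.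
    by apply: is_deriveB; [exact: dW|exact: dF].
  by have /ler_normlP[] := fw _ sab; rewrite /=; lra.
have h2 : W a + F a <= W b + F b.
  apply: (@derive_ge0_le (fun s => W s + F s) (fun s => w s + f s)) => // s sab.
    by apply: is_deriveD; [exact: dW|exact: dF].
  by have /ler_normlP[] := fw _ sab; rewrite /=; lra.
by apply/ler_normlP; split; lra.
Qed.

Lemma derive_eq F G f a b : a <= b ->
  (forall s, a <= s <= b -> is_derive s 1 F (f s)) ->
  (forall s, a <= s <= b -> is_derive s 1 G (f s)) -> F b - F a = G b - G a.
Proof.
move=> ab dF dG; apply/eqP; rewrite -subr_eq0 -normr_le0.
have := @derive_norm_le (fun s => F s - G s) (cst 0) (fun s => f s - f s) (cst 0) a b ab.
rewrite /= subrr => h.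
have -> : F b - F a - (G b - G a) = F b - G b - (F a - G a) by ring.
apply: h => s sab.
- by apply: is_deriveB; [exact: dF|exact: dG].
- by rewrite subrr normr0 lexx.
Qed.

(** The lower limit [-1] makes [0] an interior point, where the fundamental theorem of calculus
    gives a two-sided derivative. *)
Let half_prim f t := \int[lebesgue_measure]_(x in `[-1, t]) f x - \int[lebesgue_measure]_(x in `[-1, 0]) f x.

Let half_primP f t : continuous f -> -1 < t -> is_derive t 1 (half_prim f) (f t).
Proof.
move=> cf t1.
have tt1 : t < t + 1 by rewrite ltrDl.
have fi : lebesgue_measure.-integrable `[-1, t + 1] (EFin \o f).
  apply: continuous_compact_integrable; first exact: segment_compact.
  exact: continuous_subspaceT.
have [df <-] := continuous_FTC1_closed tt1 fi t1 (cf t).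
rewrite -[X in is_derive _ _ _ X]subr0; apply: is_deriveB.
by apply: (DeriveDef df); rewrite derive1E.
Qed.

Let half_prim0 f : half_prim f 0 = 0. Proof. by rewrite /half_prim subrr. Qed.

(* The primitive vanishing at [0]; the integrals provided by the library run from left to right. *)
Definition prim f t : R :=
  if 0 <= t then half_prim f t else - half_prim (fun s => f (- s)) (- t).

Lemma prim0 f : prim f 0 = 0. Proof. by rewrite /prim lexx half_prim0. Qed.

Lemma prim_derive f t : continuous f -> is_derive t 1 (prim f) (f t).
Proof.
move=> cf; have cfN : continuous (fun s => f (- s)).
  by move=> s; apply: (@continuous_comp _ _ _ -%R f); [exact: opp_continuous|exact: cf].
have dN (s : R) : s < 1 -> is_derive s 1 (fun t => - half_prim (fun s => f (- s)) (- t)) (f s).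
  move=> s1; have h := @half_primP _ (- s) cfN; rewrite opprK in h.
  have := @is_derive1_comp _ (half_prim (fun s => f (- s))) -%R s _ _ (h _).
  rewrite ltrN2 => /(_ (-1) s1 _) h1.
  rewrite -[X in is_derive _ _ _ X]opprK; apply: is_deriveN.
  by rewrite -[X in is_derive _ _ _ X]mulrN1; apply: h1.
(* The two branches of [prim] agree on a neighbourhood of [0], as differentiability there
   requires. *)
have eqN (s : R) : -1 < s -> s < 1 -> - half_prim (fun s => f (- s)) (- s) = half_prim f s.
  move=> s1 s2; have [s0|s0] := leP 0 s.
    have := @derive_eq (fun t => - half_prim (fun s => f (- s)) (- t)) (half_prim f) f 0 s s0.
    rewrite /= !(oppr0, half_prim0, addr0) => h; apply: h => r /andP[r1 r2].
    - by apply: dN; lra.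
    - by apply: half_primP => //; lra.
  have := @derive_eq (fun t => - half_prim (fun s => f (- s)) (- t)) (half_prim f) f s 0 (ltW s0).
  rewrite /= !(oppr0, half_prim0) !sub0r => h; apply: oppr_inj; apply: h => r /andP[r1 r2].
    - by apply: dN; lra.
    - by apply: half_primP => //; lra.
have [t0|t0] := ltP t 0.
  apply: (@near_eq_is_derive _ _ _ (fun t => - half_prim (fun s => f (- s)) (- t))) => //.
    near=> s; rewrite /prim leNgt ifF//; apply/negbF.
    by near: s; exact: lt_nbhsl.
  by apply: dN; lra.
apply: (@near_eq_is_derive _ _ _ (half_prim f)) => //.
  near=> s; rewrite /prim; case: leP => // s0; rewrite eqN//; last lra.
  by near: s; apply: lt_nbhsr; lra.
by apply: half_primP => //; lra.
Unshelve. all: end_near. Qed.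

Lemma prim_continuous f : continuous f -> continuous (prim f).
Proof. by move=> cf t; apply: is_derive_continuous; exact: prim_derive. Qed.

End Primitive.

(** * Uniform limits and primitives depending on a parameter *)

Section Limits.
Variable R : realType.

Lemma uniform_limit (Q : topologicalType) (F : nat -> Q -> R) (e : nat -> R) :
  (forall n, continuous (F n)) ->
  (forall n m q, (n <= m)%N -> `|F n q - F m q| <= e n) ->
  e n @[n --> \oo] --> 0 ->
  exists G : Q -> R, [/\ continuous G, forall n q, `|F n q - G q| <= e n &
    forall q, F n q @[n --> \oo] --> G q].
Proof.
move=> cF eF e0.
have elt (eps : R) : 0 < eps -> exists n, e n < eps.
  move=> eps0; have /cvgrPdist_lt/(_ _ eps0)[n _ nP] := e0.
  by exists n; have := nP n (leqnn n); rewrite sub0r normrN; apply: le_lt_trans; exact: ler_norm.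
have Fcvg q : cvg (F n q @[n --> \oo]).
  apply: cauchy_cvg; apply: cauchy_exP => eps eps0.
  have [n ne] := elt _ eps0; exists (F n q); exists n => // m /= nm.
  by rewrite /ball /=; apply: le_lt_trans ne; exact: eF.
pose G q := lim (F n q @[n --> \oo]).
have FG n q : `|F n q - G q| <= e n.
  have h : `|F n q - F m q| @[m --> \oo] --> `|F n q - G q|.
    by apply: cvg_norm; apply: cvgB; [exact: cvg_cst|exact: Fcvg].
  rewrite -(cvg_lim _ h)//; apply: limr_le; first by apply/cvg_ex; eexists; exact: h.
  by exists n => // m /= nm; exact: eF.
exists G; split => //.
move=> q; apply/cvgrPdist_lt => eps eps0.
have [n ne] := elt _ (divr_gt0 eps0 (ltr0n R 3)).
have /cvgrPdist_lt/(_ _ (divr_gt0 eps0 (ltr0n R 3))) := cF n q.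
apply: filterS => q' q'q; have := FG n q; have := FG n q'.
have := ler_normD (G q - F n q) (F n q - G q').
have := ler_normD (F n q - F n q') (F n q' - G q').
rewrite !subrKA (distrC (G q) (F n q)); lra.
Qed.

Lemma max0_continuous : continuous (fun t : R => Num.max 0 t).
Proof. by move=> t; apply: continuous_max; [exact: cst_continuous|exact: cvg_id]. Qed.

(** Tube lemma: by compactness of [[0, T]], with [T] one unit beyond the upper limit, the integrands
    at [p] and [p0] are uniformly close for [p] near [p0]. *)
Lemma prim_parametric (P : topologicalType) (phi : P * R -> R) : continuous phi ->
  continuous (fun q : P * R => prim (fun s => phi (q.1, s)) (Num.max 0 q.2)).
Proof.
move=> cphi [p0 t0].
have cp p : continuous (fun s => phi (p, s)).
  move=> s; apply: (@continuous_comp _ _ _ (fun s => (p, s)) phi); last exact: cphi.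
  by apply: (@continuous_pair _ _ _ (cst p) id) => ?; [exact: cvg_cst|exact: cvg_id].
apply/cvgrPdist_lt => eps eps0 /=.
pose T := Num.max 0 t0 + 1.
have T0 : 0 < T by rewrite ltr_pwDr// le_max lexx.
pose d := eps / (2 * T).
have d0 : 0 < d by rewrite divr_gt0// mulr_gt0.
have tube : \forall p \near p0, forall s, 0 <= s <= T -> `|phi (p, s) - phi (p0, s)| <= d.
  have : compact `[0, T] by exact: segment_compact.
  move=> /compact_near_coveringP/near_covering_withinP.
  move=> /(_ P (nbhs p0) (fun p s => `|phi (p, s) - phi (p0, s)| <= d)) h.
  apply: filterS (h _ _) => [p hp s sT|s _]; first by apply: hp; rewrite /= in_itv.
  have d2 : 0 < d / 2 by rewrite divr_gt0.
  have /cvgrPdist_lt/(_ _ d2)[[A B] /= [pA sB] AB] := cphi (p0, s).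
  exists (B, A) => //= -[s' p] /= [Bs Ap] _.
  have h1 := AB (p, s') (conj Ap Bs).
  have h2 := AB (p0, s') (conj (nbhs_singleton pA) Bs).
  have := ler_normD (phi (p, s') - phi (p0, s)) (phi (p0, s) - phi (p0, s')).
  by rewrite subrKA; move: h1 h2 => /=; rewrite (distrC (phi (p0, s))); lra.
have near2 : \forall t \near t0, Num.max 0 t <= T /\
    `|prim (fun s => phi (p0, s)) (Num.max 0 t0) - prim (fun s => phi (p0, s)) (Num.max 0 t)| < eps / 2.
  apply: filterI.
    have : Num.max 0 t0 < T by rewrite ltrDl.
    by move=> h; apply: (@filterS _ (nbhs t0) _ _ _ _ (max0_continuous (lt_nbhsl h))) => t /ltW.
  have /cvgrPdist_lt/(_ _ (divr_gt0 eps0 (ltr0n R 2))) := prim_continuous (cp p0) (x := Num.max 0 t0).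
  by move/(max0_continuous (x := t0)).
exists ([set p | forall s, 0 <= s <= T -> `|phi (p, s) - phi (p0, s)| <= d],
  [set t | Num.max 0 t <= T /\
    `|prim (fun s => phi (p0, s)) (Num.max 0 t0) - prim (fun s => phi (p0, s)) (Num.max 0 t)| < eps / 2]) => //=.
move=> [p t] /= [pd [tT tn]].
have t1 : 0 <= Num.max 0 t by rewrite le_max lexx.
have := @derive_norm_le R (fun t => prim (fun s => phi (p, s)) t - prim (fun s => phi (p0, s)) t)
  (fun t => d * t) (fun s => phi (p, s) - phi (p0, s)) (cst d) 0 (Num.max 0 t) t1.
rewrite !prim0 subrr mulr0 !subr0 => hh.
have {}hh : `|prim (fun s => phi (p, s)) (Num.max 0 t) - prim (fun s => phi (p0, s)) (Num.max 0 t)| <= d * Num.max 0 t.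
  apply: hh => s /andP[s0 s1].
  - by apply: is_deriveB; exact: prim_derive.
  - rewrite -[X in is_derive _ _ _ X]mulr1; apply: is_deriveZ.
  - by apply: pd; rewrite s0 (le_trans s1 tT).
have dT : d * Num.max 0 t <= eps / 2.
  by rewrite (le_trans (ler_wpM2l (ltW d0) tT))// /d le_eqVlt; apply/orP; left; apply/eqP; field; rewrite gt_eqF.
have := ler_normD (prim (fun s => phi (p0, s)) (Num.max 0 t0) - prim (fun s => phi (p0, s)) (Num.max 0 t))
  (prim (fun s => phi (p0, s)) (Num.max 0 t) - prim (fun s => phi (p, s)) (Num.max 0 t)).
rewrite subrKA distrC in hh *; move: hh; rewrite distrC; lra.
Qed.

End Limits.

(** * The scalar weight *)

Lemma is_derive_ext (R : realType) (f g : R -> R) (t df dg : R) :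
  is_derive t 1 f df -> (forall s, f s = g s) -> df = dg -> is_derive t 1 g dg.
Proof. by move=> h /funext fg <-; rewrite -fg. Qed.

Section Weights.
Variable R : realType.
Implicit Types s t a b m : R.

(** The primitive of [atan] vanishing at [0]: [exp (- K)] and [exp K] solve [x' = - atan t * x] and
    [y' = atan t * y]. *)
Definition atan_prim t : R := t * atan t - ln (1 + t ^+ 2) / 2.
Local Notation K := atan_prim.

(** Half of the exponent of [exp (- K)] is given up to absorb the integral terms. As [K] has
    derivative [0] at [0], this gains nothing there; the bounded factor [exp (atan t)] supplies the
    missing rate. *)
Definition xweight t : R := expR (atan t - K t / 2).

Lemma derive_atan_prim t : is_derive t 1 K (atan t).
Proof.
have t1 : 0 < 1 + t ^+ 2 by rewrite ltr_pwDl ?sqr_ge0.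
have dl : is_derive t 1 (fun t : R => ln (1 + t ^+ 2)) ((1 + t ^+ 2)^-1 * (2 * t)).
  apply: (@is_derive1_comp _ (@ln R) (fun t => 1 + t ^+ 2)); first exact: is_derive1_ln.
  have dX := is_deriveM (is_derive_id t 1) (is_derive_id t 1).
  apply: is_derive_ext (is_deriveD (is_derive_cst (1 : R) t 1) dX) _ _.
    by move=> s; rewrite fctE.
  by rewrite -![_ *: _]/(_ * _); ring.
apply: is_derive_ext (is_deriveB (is_deriveM (is_derive_id t 1) (is_derive1_atan t)) (is_deriveZ 2^-1 dl)) _ _.
  by move=> s; rewrite /K [ln _ / 2]mulrC.
by rewrite -![_ *: _]/(_ * _); field; rewrite gt_eqF.
Qed.

Lemma atan_prim0 : K 0 = 0.
Proof. by rewrite /K mul0r expr0n /= addr0 ln1 mul0r subrr. Qed.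

Lemma atan_prim_continuous : continuous K.
Proof. by move=> t; apply: is_derive_continuous; exact: derive_atan_prim. Qed.

Lemma atan_ge0 t : 0 <= t -> 0 <= atan t.
Proof. by move=> t0; rewrite -(@atan0 R); exact: le_atan. Qed.

Lemma atan_prim_ge0 t : 0 <= t -> 0 <= K t.
Proof.
move=> t0; rewrite -atan_prim0; apply: (@derive_ge0_le R K atan) => // s; first by move=> _; exact: derive_atan_prim.
by move=> /andP[s0 _]; exact: atan_ge0.
Qed.

(** The logarithmic rate of the supersolutions below: the first term is large near [0], the second
    away from it. This is the origin of the factor [4] in the estimates. *)
Lemma atan_ge_quarter t : 0 <= t -> 4^-1 <= (1 + t ^+ 2)^-1 + atan t / 2.
Proof.
move=> t0; have [t1|t1] := leP t 1.
  have h : 2^-1 <= (1 + t ^+ 2)^-1.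
    by rewrite lef_pV2 ?posrE// ?ltr_pwDl ?sqr_ge0// -[leRHS]/(1 + 1) lerD2l expr_le1.
  have := atan_ge0 t0; lra.
have h : pi / 4 <= atan t by rewrite -atan1; apply: le_atan; exact: ltW.
have h0 : 0 <= (1 + t ^+ 2)^-1 by rewrite invr_ge0 addr_ge0 ?sqr_ge0.
have := pi_ge2 R; lra.
Qed.

(** Beyond [1] the derivative [atan] is at least [pi / 4 >= 1 / 2]. *)
Lemma atan_prim_lower t : 1 <= t -> (t - 1) / 2 <= K t.
Proof.
move=> t1; suff : K 1 - 1 / 2 <= K t - t / 2.
  by have := atan_prim_ge0 (@ler01 R); lra.
apply: (@derive_ge0_le R (fun t => K t - t / 2) (fun t => atan t - 1 / 2)) => //.
  move=> s _; apply: is_deriveB; first exact: derive_atan_prim.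
  apply: is_derive_ext (is_deriveZ (2^-1) (is_derive_id s 1)) _ _.
    by move=> r; rewrite [r / 2]mulrC.
  by rewrite /GRing.scale /=; ring.
move=> s /andP[s1 _].
have h : pi / 4 <= atan s by rewrite -atan1; apply: le_atan.
have := pi_ge2 R; lra.
Qed.

Lemma xweight0 : xweight 0 = 1.
Proof. by rewrite /xweight atan0 atan_prim0 mul0r subrr expR0. Qed.

Lemma xweight_gt0 t : 0 < xweight t. Proof. exact: expR_gt0. Qed.

Lemma xweight_le t : 0 <= t -> xweight t <= expR pi.
Proof.
move=> t0; rewrite ler_expR; have := atan_prim_ge0 t0; have := atan_ltpi2 t.
have := pi_ge0 R; lra.
Qed.

Lemma expRN_atan_prim_le t : 0 <= t -> expR (- K t) <= xweight t.
Proof.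
move=> t0; rewrite ler_expR; have := atan_prim_ge0 t0; have := atan_ge0 t0; lra.
Qed.

Lemma xweight_cvg0 : xweight t @[t --> +oo] --> 0.
Proof.
apply/cvgrPdist_lt => eps eps0.
near=> t; rewrite sub0r normrN gtr0_norm ?xweight_gt0//.
have t1 : 1 <= t by near: t; exact: nbhs_pinfty_ge.
have K2 : (t - 1) / 2 <= K t by exact: atan_prim_lower.
have tbig : 4 * expR pi / eps < t - 1.
  by rewrite ltrBrDr; near: t; apply: nbhs_pinfty_gt; rewrite num_real.
apply: (@le_lt_trans _ _ (expR pi * expR (- ((t - 1) / 4)))).
  rewrite -expRD ler_expR; have := atan_ltpi2 t; have := pi_ge0 R; lra.
have e0 : 0 < expR ((t - 1) / 4) by exact: expR_gt0.
rewrite expRN ltr_pdivrMr//.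
have := expR_ge1Dx ((t - 1) / 4) => h.
apply: (@lt_le_trans _ _ (eps * ((t - 1) / 4))).
  by move: tbig; rewrite ltr_pdivrMr//; lra.
by rewrite ler_pM2l//; lra.
Unshelve. all: end_near. Qed.

(* Supersolution weights: [expR K * xweight] dominates the response of the
   decaying component and [expR (- atan - 3/2 K)] that of the growing one. *)
Lemma decaying_bound (D : R -> R) (psi : R -> R) m t : 0 <= t -> 0 <= m -> D 0 = 0 ->
  (forall s, 0 <= s -> is_derive s 1 D (expR (K s) * psi s)) ->
  (forall s, 0 <= s -> `|psi s| <= m * xweight s) ->
  `|expR (- K t) * D t| <= 4 * m * xweight t.
Proof.
move=> t0 m0 D0 dD psim.
pose EX s := expR (atan s + K s / 2).
have dEX s : is_derive s 1 EX ((1 + s ^+ 2)^-1 * EX s + atan s / 2 * EX s).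
  have dE := is_deriveD (is_derive1_atan s) (is_deriveZ 2^-1 (derive_atan_prim s)).
  apply: is_derive_ext (is_derive1_comp (is_derive_expR _) dE) _ _.
    by move=> r; rewrite /EX [_ / 2]mulrC.
  by rewrite /EX [K s / 2]mulrC /GRing.scale /=; ring.
have := @derive_norm_le R D (fun s => 4 * m * EX s) (fun s => expR (K s) * psi s)
  (fun s => 4 * m * ((1 + s ^+ 2)^-1 * EX s + atan s / 2 * EX s)) 0 t t0.
rewrite D0 subr0 => h.
have {}h : `|D t| <= 4 * m * EX t - 4 * m * EX 0.
  apply: h => s /andP[s0 _]; first exact: dD.
  rewrite normrM gtr0_norm ?expR_gt0//.
  apply: (@le_trans _ _ (expR (K s) * (m * xweight s))).
    by rewrite ler_pM2l ?expR_gt0// psim.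
  rewrite mulrCA -expRD -mulrDl.
  have -> : K s + (atan s - K s / 2) = atan s + K s / 2 by field.
  rewrite -/(EX s) -mulrA mulrCA; apply: ler_wpM2l => //.
  rewrite -[leLHS]mul1r mulrA ler_wpM2r ?expR_ge0//.
  by have := atan_ge_quarter s0; lra.
rewrite normrM gtr0_norm ?expR_gt0//.
have -> : 4 * m * xweight t = expR (- K t) * (4 * m * EX t).
  by rewrite /xweight /EX [RHS]mulrCA -expRD; congr (_ * expR _); field.
rewrite ler_pM2l ?expR_gt0// (le_trans h)// gerBl mulr_ge0 ?expR_ge0// mulr_ge0//.
Qed.

(** The supersolution must decrease, so it carries [exp (- atan)] where the weight carries
    [exp atan]. The factor [expR pi] pays for the difference, as [2 * atan < pi]. *)
Lemma growing_bound (D : R -> R) (psi : R -> R) m a b : 0 <= a -> a <= b -> 0 <= m ->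
  (forall s, 0 <= s -> is_derive s 1 D (expR (- K s) * psi s)) ->
  (forall s, 0 <= s -> `|psi s| <= m * xweight s) ->
  `|D b - D a| <= 4 * expR pi * m * expR (- K a) * xweight a.
Proof.
move=> a0 ab m0 dD psim.
pose EY s := expR (- atan s - K s * (3 / 2)).
have dEY s : is_derive s 1 EY (- ((1 + s ^+ 2)^-1 + 3 / 2 * atan s) * EY s).
  have dE := is_deriveB (is_deriveN (is_derive1_atan s)) (is_deriveZ (3 / 2) (derive_atan_prim s)).
  apply: is_derive_ext (is_derive1_comp (is_derive_expR _) dE) _ _.
    by move=> r; rewrite /EY [_ * (3 / 2)]mulrC.
  by rewrite /EY [K s * (3 / 2)]mulrC /GRing.scale /=; ring.
have EYX s : 0 <= s -> expR (- K s) * xweight s <= expR pi * EY s.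
  move=> s0; rewrite -!expRD ler_expR; have := atan_ltpi2 s; lra.
have EYX' s : 0 <= s -> EY s <= expR (- K s) * xweight s.
  move=> s0; rewrite -!expRD ler_expR; have := atan_ge0 s0; lra.
pose C := 4 * expR pi * m.
have C0 : 0 <= C by rewrite !mulr_ge0 ?expR_ge0.
have := @derive_norm_le R D (fun s => - C * EY s) (fun s => expR (- K s) * psi s)
  (fun s => - C * (- ((1 + s ^+ 2)^-1 + 3 / 2 * atan s) * EY s)) a b ab.
move=> h.
have {}h : `|D b - D a| <= - C * EY b - - C * EY a.
  apply: h => s /andP[sa _]; have s0 := le_trans a0 sa; first exact: dD.
  rewrite normrM gtr0_norm ?expR_gt0//.
  apply: (@le_trans _ _ (expR (- K s) * (m * xweight s))).
    by rewrite ler_pM2l ?expR_gt0// psim.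
  rewrite mulrCA; apply: (@le_trans _ _ (m * (expR pi * EY s))).
    by rewrite ler_wpM2l// EYX.
  rewrite mulNr mulNr mulrN opprK /C.
  rewrite [X in _ <= X]mulrA [leLHS]mulrA; apply: ler_wpM2r; first exact: expR_ge0.
  rewrite mulrC -[leLHS]mulr1 -[4 * _ * _]mulrA [4 * _]mulrC -!mulrA; apply: ler_wpM2l; first exact: expR_ge0.
  apply: ler_wpM2l => //.
  by have := atan_ge_quarter s0; have := atan_ge0 s0; lra.
apply: (le_trans h); rewrite -mulrA -/C.
have := ler_wpM2l C0 (EYX' _ a0); have : 0 <= C * EY b by rewrite mulr_ge0 ?expR_ge0.
rewrite !mulNr; lra.
Qed.

End Weights.

(** * Linear half-line problems *)

Section LinearHalfLine.
Variables (R : realType) (P : topologicalType).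
Implicit Types (phi : P * R -> R) (q : P * R) (p : P) (t s m : R).
Local Notation K := (@atan_prim R).
Local Notation pos := (Num.max (0 : R)).

(** Variation of constants for [x' = - atan t * x + phi] with [x 0 = 0]. Using [max 0 t] for the
    time gives a function on all of [P * R]. *)
Definition decay phi q : R :=
  expR (- K (pos q.2)) * prim (fun s => expR (K s) * phi (q.1, s)) (pos q.2).

Definition grow_limit phi p : R :=
  lim (prim (fun s => expR (- K s) * phi (p, s)) n%:R @[n --> \oo]).

(** For [phi] dominated by the weight this is the decaying solution of [y' = atan t * y + phi],
    namely [- exp K] times the integral of [exp (- K) * phi] from [t] to infinity; subtracting the
    limit cancels the growing mode. *)
Definition grow phi q : R :=
  expR (K (pos q.2)) * (prim (fun s => expR (- K s) * phi (q.1, s)) (pos q.2)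
                        - grow_limit phi q.1).

Let pos_ge0 t : 0 <= pos t. Proof. by rewrite le_max lexx. Qed.

Lemma section_continuous phi p : continuous phi -> continuous (fun s => phi (p, s)).
Proof.
move=> cphi s; apply: (@continuous_comp _ _ _ (fun s => (p, s)) phi); last exact: cphi.
by apply: (@continuous_pair _ _ _ (cst p) id) => ?; [exact: cvg_cst|exact: cvg_id].
Qed.

Let expK_continuous : continuous (fun s => expR (K s)).
Proof.
move=> s; apply: continuous_comp; first exact: atan_prim_continuous.
exact: continuous_expR.
Qed.

Let expNK_continuous : continuous (fun s => expR (- K s)).
Proof.
move=> s; apply: (@continuous_comp _ _ _ (fun s => - K s) expR); last exact: continuous_expR.
by apply: cvgN; exact: atan_prim_continuous.
Qed.

Let pos_snd_continuous : continuous (fun q => pos q.2).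
Proof.
move=> q; apply: (@continuous_comp _ _ _ snd pos); first exact: cvg_snd.
exact: max0_continuous.
Qed.

Let weighted_continuous (e : R -> R) phi : continuous e -> continuous phi ->
  continuous (fun q => e q.2 * phi q).
Proof.
move=> ce cphi q; apply: cvgM; last exact: cphi.
by apply: (@continuous_comp _ _ _ snd e); [exact: cvg_snd|exact: ce].
Qed.

Let weighted_section (e : R -> R) phi p : continuous e -> continuous phi ->
  continuous (fun s => e s * phi (p, s)).
Proof.
by move=> ce cphi s; apply: cvgM; [exact: ce|exact: section_continuous].
Qed.

Lemma decay_continuous phi : continuous phi -> continuous (decay phi).
Proof.
move=> cphi q; apply: cvgM.
  apply: (@continuous_comp _ _ _ (fun q => pos q.2) (fun s => expR (- K s))).
    exact: pos_snd_continuous.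
  exact: expNK_continuous.
apply: (@prim_parametric R P (fun q => expR (K q.2) * phi q)).
exact: (@weighted_continuous (fun s => expR (K s)) phi expK_continuous cphi).
Qed.

Lemma decay_lip phi1 phi2 m : 0 <= m -> continuous phi1 -> continuous phi2 ->
  (forall p s, 0 <= s -> `|phi1 (p, s) - phi2 (p, s)| <= m * xweight s) ->
  forall q, `|decay phi1 q - decay phi2 q| <= 4 * m * xweight (pos q.2).
Proof.
move=> m0 c1 c2 h q; rewrite /decay -mulrBr.
apply: (@decaying_bound R (fun t => prim (fun s => expR (K s) * phi1 (q.1, s)) t -
   prim (fun s => expR (K s) * phi2 (q.1, s)) t) (fun s => phi1 (q.1, s) - phi2 (q.1, s))) => //.
- by rewrite !prim0 subrr.
- move=> s _; rewrite mulrBr; apply: is_deriveB.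
    by apply: (@prim_derive R (fun s => expR (K s) * phi1 (q.1, s))); exact: weighted_section.
  by apply: (@prim_derive R (fun s => expR (K s) * phi2 (q.1, s))); exact: weighted_section.
- by move=> s s0; exact: h.
Qed.

Lemma decay_at0 phi p : decay phi (p, 0) = 0.
Proof. by rewrite /decay /= maxxx prim0 mulr0. Qed.

Let pos_near (f g : R -> R) t d d' : 0 < t -> is_derive t 1 f d ->
  (forall s, 0 < s -> f s = g s) -> d = d' -> is_derive t 1 g d'.
Proof.
move=> t0 df fg <-; apply: near_eq_is_derive df; near=> s; apply: fg.
by near: s; exact: lt_nbhsr.
Unshelve. all: end_near. Qed.

Lemma decay_derive phi p t : continuous phi -> 0 < t ->
  is_derive t 1 (fun t => decay phi (p, t)) (- atan t * decay phi (p, t) + phi (p, t)).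
Proof.
move=> cphi t0.
have post : pos t = t by rewrite max_r// ltW.
have dE : is_derive t 1 (fun t => expR (- K t)) (expR (- K t) * - atan t).
  exact: (is_derive1_comp (is_derive_expR _) (is_deriveN (derive_atan_prim t))).
have dP := prim_derive t (@weighted_section (fun s => expR (K s)) phi p expK_continuous cphi).
apply: (pos_near t0 (is_deriveM dE dP)).
  by move=> s s0; rewrite /decay /= max_r// ltW.
rewrite /decay /= post -![_ *: _]/(_ * _).
rewrite mulrA -expRD addNr expR0 mul1r addrC; congr (_ + _); ring.
Qed.

Section Growing.
Variables (phi : P * R -> R) (m : R).
Hypotheses (m_ge0 : 0 <= m) (phi_cont : continuous phi).
Hypothesis phi_bound : forall p s, 0 <= s -> `|phi (p, s)| <= m * xweight s.

Let F p := prim (fun s => expR (- K s) * phi (p, s)).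

Let F_derive p s : is_derive s 1 (F p) (expR (- K s) * phi (p, s)).
Proof.
by apply: (@prim_derive R (fun s => expR (- K s) * phi (p, s))); exact: weighted_section.
Qed.

Let natr_cvgy : (n%:R : R) @[n --> \oo] --> +oo.
Proof. exact: cvgr_idn. Qed.

(** By [growing_bound] the primitives are Cauchy uniformly in [p], at a rate proportional to
    [xweight n], so the limit is continuous in [p]. *)
Let grow_limit_spec : continuous (grow_limit phi) /\ forall p, F p n%:R @[n --> \oo] --> grow_limit phi p.
Proof.
have [|||G [cG _ FG]] := @uniform_limit R P (fun n p => F p n%:R)
   (fun n => 4 * expR pi * m * xweight n%:R).
- move=> n p; have := @prim_parametric R P (fun q => expR (- K q.2) * phi q).
  move=> /(_ (@weighted_continuous (fun s => expR (- K s)) phi expNK_continuous phi_cont)) h.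
  have -> : (fun p => F p n%:R) =
      (fun q => prim (fun s => expR (- K s) * phi (q.1, s)) (pos q.2)) \o (fun p => (p, n%:R)).
    by apply/funext => p'; rewrite /= max_r.
  apply: continuous_comp; last exact: h.
  by apply: (@continuous_pair _ _ _ id (cst (n%:R : R))) => ?; [exact: cvg_id|exact: cvg_cst].
- move=> n k p nk; rewrite distrC.
  have nkR : n%:R <= k%:R :> R by rewrite ler_nat.
  apply: (le_trans (@growing_bound R (F p) (fun s => phi (p, s)) m n%:R k%:R _ nkR m_ge0 _ _)) => //.
    by move=> s s0; exact: phi_bound.
  rewrite -[leRHS]mulr1 -!mulrA [_ * xweight _]mulrC !mulrA ler_wpM2l//.
    by rewrite !mulr_ge0 ?expR_ge0// ltW// xweight_gt0.
  by rewrite -expR0 ler_expR oppr_le0 atan_prim_ge0.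
- rewrite -[X in _ --> X](mulr0 (4 * expR pi * m)); apply: cvgM; first exact: cvg_cst.
  exact: (@cvg_comp _ _ _ (fun n : nat => n%:R : R) (@xweight R) _ _ _ natr_cvgy (@xweight_cvg0 R)).
have GE p : grow_limit phi p = G p by apply: cvg_lim => //; exact: FG.
by split=> [|p]; [rewrite (_ : grow_limit phi = G)//; apply/funext|rewrite GE].
Qed.

Lemma grow_limit_cvg p : F p n%:R @[n --> \oo] --> grow_limit phi p.
Proof. exact: grow_limit_spec.2. Qed.

Lemma grow_continuous : continuous (grow phi).
Proof.
move=> q; apply: cvgM.
  apply: (@continuous_comp _ _ _ (fun q => pos q.2) (fun s => expR (K s))).
    exact: pos_snd_continuous.
  exact: expK_continuous.
apply: cvgB.
  apply: (@prim_parametric R P (fun q => expR (- K q.2) * phi q)).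
  exact: (@weighted_continuous (fun s => expR (- K s)) phi expNK_continuous phi_cont).
apply: (@continuous_comp _ _ _ fst (grow_limit phi)); first exact: cvg_fst.
exact: grow_limit_spec.1.
Qed.

Lemma grow_derive p t : 0 < t ->
  is_derive t 1 (fun t => grow phi (p, t)) (atan t * grow phi (p, t) + phi (p, t)).
Proof.
move=> t0.
have post : pos t = t by rewrite max_r// ltW.
have dE : is_derive t 1 (fun t => expR (K t)) (expR (K t) * atan t).
  exact: (is_derive1_comp (is_derive_expR _) (derive_atan_prim t)).
have dP := is_deriveB (F_derive p t) (is_derive_cst (grow_limit phi p) t 1).
apply: (pos_near t0 (is_deriveM dE dP)).
  by move=> s s0; rewrite /grow /= max_r// ltW.
rewrite /grow /= post -![_ *: _]/(_ * _) subr0.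
have e1 : expR (K t) * expR (- K t) = 1 by rewrite -expRD subrr expR0.
rewrite ?subr0 [X in X + _]mulrA e1 mul1r addrC; congr (_ + _); rewrite -/(F p) ?fctE; ring.
Qed.

End Growing.

(** The bounds [m1] and [m2] ensure that the two limits exist; the estimate depends on [m] alone, as
    a contraction argument requires. *)
Lemma grow_lip phi1 phi2 m1 m2 m : 0 <= m -> 0 <= m1 -> 0 <= m2 ->
  continuous phi1 -> continuous phi2 ->
  (forall p s, 0 <= s -> `|phi1 (p, s)| <= m1 * xweight s) ->
  (forall p s, 0 <= s -> `|phi2 (p, s)| <= m2 * xweight s) ->
  (forall p s, 0 <= s -> `|phi1 (p, s) - phi2 (p, s)| <= m * xweight s) ->
  forall q, `|grow phi1 q - grow phi2 q| <= 4 * expR pi * m * xweight (pos q.2).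
Proof.
move=> m0 m10 m20 c1 c2 b1 b2 b12 q; rewrite /grow -mulrBr.
set t := pos q.2; have t0 : 0 <= t by exact: pos_ge0.
have l1 := grow_limit_cvg m10 c1 b1 (p := q.1).
have l2 := grow_limit_cvg m20 c2 b2 (p := q.1).
set F1 := prim _ in l1 *; set F2 := prim _ in l2 *.
pose D s := F1 s - F2 s.
have l12 : `|D n%:R - D t| @[n --> \oo] --> `|grow_limit phi1 q.1 - grow_limit phi2 q.1 - D t|.
  exact: (cvg_norm (cvgB (cvgB l1 l2) (cvg_cst _))).
have B : `|grow_limit phi1 q.1 - grow_limit phi2 q.1 - D t| <= 4 * expR pi * m * expR (- K t) * xweight t.
  apply: (cvgr_to_le l12); near=> n.
  have tn : t <= n%:R by near: n; exact: nbhs_infty_ger.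
  apply: (@growing_bound R D (fun s => phi1 (q.1, s) - phi2 (q.1, s)) m t n%:R t0 tn m0).
    move=> s _; rewrite mulrBr; apply: is_deriveB.
      by apply: (@prim_derive R (fun s => expR (- K s) * phi1 (q.1, s))); exact: weighted_section.
    by apply: (@prim_derive R (fun s => expR (- K s) * phi2 (q.1, s))); exact: weighted_section.
  by move=> s s0; exact: b12.
rewrite normrM gtr0_norm ?expR_gt0//.
have -> : `|F1 t - grow_limit phi1 q.1 - (F2 t - grow_limit phi2 q.1)| =
    `|grow_limit phi1 q.1 - grow_limit phi2 q.1 - D t|.
  by rewrite -normrN; congr `| _ |; rewrite /D; ring.
apply: (@le_trans _ _ (expR (K t) * (4 * expR pi * m * expR (- K t) * xweight t))).
  by rewrite ler_wpM2l ?expR_ge0.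
rewrite le_eqVlt; apply/orP; left; apply/eqP.
rewrite [4 * expR pi * m * expR _]mulrC -!mulrA mulrA -expRD subrr expR0 mul1r.
by [].
Unshelve. all: end_near. Qed.

End LinearHalfLine.

(** * Nonlinear half-line problem *)

Section NonlinearHalfLine.
Variables (R : realType) (P : topologicalType).
Variables (a : P -> R) (A eps : R) (f h : P * R -> R * R -> R).
Local Notation K := (@atan_prim R).
Local Notation pos := (Num.max (0 : R)).
Local Notation X := (@xweight R).
Local Notation M := (4 * expR (pi : R)).

Hypothesis a_cont : continuous a.
Hypothesis a_bound : forall p, `|a p| <= A.
Hypotheses (A_ge0 : 0 <= A) (eps_ge0 : 0 <= eps).
Hypothesis eps_small : M * eps <= 4^-1.
Hypothesis f_cont : continuous (fun z : (P * R) * (R * R) => f z.1 z.2).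
Hypothesis h_cont : continuous (fun z : (P * R) * (R * R) => h z.1 z.2).
Hypothesis f0 : forall q, f q (0, 0) = 0.
Hypothesis h0 : forall q, h q (0, 0) = 0.
Hypothesis f_lip : forall q u v, `|f q u - f q v| <= eps * (`|u.1 - v.1| + `|u.2 - v.2|).
Hypothesis h_lip : forall q u v, `|h q u - h q v| <= eps * (`|u.1 - v.1| + `|u.2 - v.2|).

Let state := (P * R -> R * R)%type.

(** Distance in the weighted supremum norm, kept as a relation with an explicit bound instead of a
    supremum. *)
Let close (u v : state) (m : R) := forall q,
  `|(u q).1 - (v q).1| + `|(u q).2 - (v q).2| <= m * X (pos q.2).

(** The Lyapunov-Perron map: its fixed points within the weight are decaying solutions with first
    coordinate [a p] at time [0]. *)
Let step (u : state) : state := fun q =>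
  (expR (- K (pos q.2)) * a q.1 + decay (fun q => f q (u q)) q, grow (fun q => h q (u q)) q).

Let zero : state := fun=> (0, 0).

Let pos_id s : 0 <= s -> pos s = s. Proof. by move=> s0; rewrite max_r. Qed.
Let pos_ge0 t : 0 <= pos t. Proof. by rewrite le_max lexx. Qed.
Let X_ge0 t : 0 <= X t. Proof. exact/ltW/xweight_gt0. Qed.

Let M_ge4 : 4 <= M.
Proof. by rewrite ler_pMr// -expR0 ler_expR pi_ge0. Qed.

Let comp_cont (g : P * R -> R * R -> R) (u : state) :
  continuous (fun z : (P * R) * (R * R) => g z.1 z.2) -> continuous u ->
  continuous (fun q => g q (u q)).
Proof.
move=> cg cu q; apply: (@continuous_comp _ _ _ (fun q => (q, u q)) (fun z => g z.1 z.2)); last exact: cg.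
by apply: (@continuous_pair _ _ _ id u) => // ?; exact: cvg_id.
Qed.

Let comp_lip (g : P * R -> R * R -> R) (u v : state) m :
  (forall q u v, `|g q u - g q v| <= eps * (`|u.1 - v.1| + `|u.2 - v.2|)) ->
  close u v m -> forall p s, 0 <= s ->
  `|g (p, s) (u (p, s)) - g (p, s) (v (p, s))| <= (eps * m) * X s.
Proof.
move=> gl uv p s s0; apply: (le_trans (gl _ _ _)); rewrite -mulrA ler_wpM2l//.
by have := uv (p, s); rewrite /= pos_id.
Qed.

Let comp_bound (g : P * R -> R * R -> R) (u : state) m :
  (forall q u v, `|g q u - g q v| <= eps * (`|u.1 - v.1| + `|u.2 - v.2|)) ->
  (forall q, g q (0, 0) = 0) ->
  close u zero m -> forall p s, 0 <= s ->
  `|g (p, s) (u (p, s))| <= (eps * m) * X s.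
Proof. by move=> gl g0 uz p s s0; have := comp_lip gl uz p s0; rewrite g0 subr0. Qed.

Let step_cont u : continuous u -> close u zero (2 * A) -> continuous (step u).
Proof.
move=> cu uz; apply: continuous_pair => q.
  apply: cvgD; last by apply: decay_continuous; exact: (comp_cont f_cont cu).
  apply: cvgM; last by apply: (@continuous_comp _ _ _ fst a); [exact: cvg_fst|exact: a_cont].
  apply: (@continuous_comp _ _ _ (fun q => - K (pos q.2)) expR); last exact: continuous_expR.
  apply: cvgN; apply: (@continuous_comp _ _ _ (fun q => pos q.2) K); last exact: atan_prim_continuous.
  by apply: (@continuous_comp _ _ _ snd pos); [exact: cvg_snd|exact: max0_continuous].
apply: (@grow_continuous _ _ _ (eps * (2 * A))); first by rewrite !mulr_ge0.
  exact: (comp_cont h_cont cu).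
exact: (comp_bound h_lip h0 uz).
Qed.

(** The two components together contribute [(4 + M) * eps], and [4 <= M], so this is at most
    [2 * M * eps <= 1 / 2]. *)
Let step_lip u v m : 0 <= m -> continuous u -> continuous v ->
  close u zero (2 * A) -> close v zero (2 * A) -> close u v m ->
  close (step u) (step v) (m / 2).
Proof.
move=> m0 cu cv uz vz uv q /=.
have addKA (x y w : R) : x + y - (x + w) = y - w by ring.
rewrite addKA.
have em : 0 <= eps * m by rewrite mulr_ge0.
have h1 := decay_lip em (comp_cont f_cont cu) (comp_cont f_cont cv) (comp_lip f_lip uv) q.
have eA : 0 <= eps * (2 * A) by rewrite !mulr_ge0.
have h2 := grow_lip em eA eA (comp_cont h_cont cu) (comp_cont h_cont cv)
  (comp_bound h_lip h0 uz) (comp_bound h_lip h0 vz) (comp_lip h_lip uv) q.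
apply: (le_trans (lerD h1 h2)); rewrite -mulrDl ler_wpM2r ?X_ge0//.
have : M * eps * m <= 4^-1 * m by rewrite ler_wpM2r.
have : 4 * (eps * m) <= M * (eps * m) by rewrite ler_wpM2r ?M_ge4.
rewrite [M * eps * m]mulrAC -!mulrA [m * eps]mulrC; lra.
Qed.

Let prim_zero t : 0 <= t -> prim (cst (0 : R)) t = 0.
Proof.
move=> t0; have := @derive_eq R (prim (cst 0)) (cst 0) (cst 0) 0 t t0.
rewrite prim0 subr0 /= subrr; apply => s _; apply: prim_derive; exact: cst_continuous.
Qed.

Let grow_zero q : grow (fun q => h q (zero q)) q = 0.
Proof.
have hz : (fun q => h q (zero q)) = cst 0 by apply/funext => q'; rewrite h0.
have pz (e : R -> R) t : 0 <= t -> prim (fun s => e s * cst 0 (q.1, s)) t = 0.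
  move=> t0; have -> : (fun s => e s * cst 0 (q.1, s)) = cst (0 : R) by apply/funext => s; rewrite /= mulr0.
  exact: prim_zero.
rewrite hz /grow pz// sub0r (_ : grow_limit _ _ = 0) ?oppr0 ?mulr0//.
apply: cvg_lim => //.
rewrite (_ : (fun n => _) = cst 0); first exact: cvg_cst.
by apply/funext => n; rewrite pz.
Qed.

Let decay_zero q : decay (fun q => f q (zero q)) q = 0.
Proof.
have -> : (fun q => f q (zero q)) = cst 0 by apply/funext => q'; rewrite f0.
rewrite /decay; have -> : (fun s => expR (K s) * cst 0 (q.1, s)) = cst (0 : R) by apply/funext => s; rewrite /= mulr0.
by rewrite prim_zero ?mulr0.
Qed.

Let step_zero : close (step zero) zero A.
Proof.
move=> q; rewrite /= decay_zero grow_zero addr0 !subr0 normr0 addr0 normrM.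
rewrite gtr0_norm ?expR_gt0// mulrC ler_pM ?expR_ge0 ?normr_ge0//.
exact: expRN_atan_prim_le.
Qed.

Let close_trans u v w m1 m2 : close u v m1 -> close v w m2 -> close u w (m1 + m2).
Proof.
move=> uv vw q; have := uv q; have := vw q; rewrite mulrDl.
have := ler_normD ((u q).1 - (v q).1) ((v q).1 - (w q).1).
have := ler_normD ((u q).2 - (v q).2) ((v q).2 - (w q).2).
rewrite !subrKA; lra.
Qed.

Let close_weaken u v m1 m2 : m1 <= m2 -> close u v m1 -> close u v m2.
Proof. by move=> m12 uv q; apply: (le_trans (uv q)); rewrite ler_wpM2r. Qed.

Let close_sym u v m : close u v m -> close v u m.
Proof. by move=> uv q; rewrite (distrC (v q).1) (distrC (v q).2). Qed.

Let z (n : nat) : state := iter n step zero.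

(** The first increment is at most [A] and each further one is bounded by half the previous bound,
    so the iterates stay in the ball of radius [2 * A] on which [step_lip] applies. *)
Let z_spec n : [/\ continuous (z n), close (z n) zero (2 * A * (1 - 2^-1 ^+ n)) &
  close (z n.+1) (z n) (A * 2^-1 ^+ n)].
Proof.
have le2A k : 2 * A * (1 - 2^-1 ^+ k) <= 2 * A.
  by rewrite ler_piMr ?mulr_ge0// gerBl exprn_ge0// invr_ge0.
have cz : continuous zero by move=> ?; exact: cvg_cst.
elim: n => [|n [cn bn dn]].
  split => //=; first by rewrite expr0 subrr mulr0 => q; rewrite /= subrr normr0 addr0 mul0r.
  by rewrite expr0 mulr1; exact: step_zero.
have bn1 : close (z n.+1) zero (2 * A * (1 - 2^-1 ^+ n.+1)).
  have -> : 2 * A * (1 - 2^-1 ^+ n.+1) = A * 2^-1 ^+ n + 2 * A * (1 - 2^-1 ^+ n) by rewrite exprS; field.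
  exact: close_trans dn bn.
have cn1 : continuous (z n.+1).
  by apply: step_cont => //; exact: close_weaken bn.
split => //.
have -> : A * 2^-1 ^+ n.+1 = A * 2^-1 ^+ n / 2 by rewrite exprSr mulrA.
apply: step_lip => //.
- by rewrite mulr_ge0// exprn_ge0// invr_ge0.
- exact: close_weaken bn1.
- exact: close_weaken bn.
Qed.

Let z_bound n : close (z n) zero (2 * A).
Proof.
have [_ b _] := z_spec n; apply: close_weaken b.
by rewrite ler_piMr ?mulr_ge0// gerBl exprn_ge0// invr_ge0.
Qed.

Let z_cauchy n k : close (z (n + k)%N) (z n) (2 * A * (2^-1 ^+ n - 2^-1 ^+ (n + k))).
Proof.
elim: k => [|k IHk].
  by rewrite addn0 subrr mulr0 => q; rewrite !subrr normr0 addr0 mul0r.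
rewrite addnS; have [_ _ d] := z_spec (n + k).
have -> : 2 * A * (2^-1 ^+ n - 2^-1 ^+ (n + k).+1) =
    A * 2^-1 ^+ (n + k) + 2 * A * (2^-1 ^+ n - 2^-1 ^+ (n + k)) by rewrite exprS; field.
exact: close_trans d IHk.
Qed.

Let e (n : nat) : R := 2 * A * 2^-1 ^+ n.

Let e_cvg : e n @[n --> \oo] --> 0.
Proof. by apply: cvg_geometric; rewrite ger0_norm ?invr_ge0// invf_lt1// ltr1n. Qed.

Let z_cauchy_le n m : (n <= m)%N -> close (z n) (z m) (e n).
Proof.
move=> nm; rewrite -(subnKC nm); apply: close_sym.
apply: close_weaken (z_cauchy _ _).
by rewrite ler_wpM2l ?mulr_ge0// gerBl exprn_ge0// invr_ge0.
Qed.

(** The bound on the second coordinate at time [0] says that the decaying solutions start on a graph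
    within [O(eps)] of the axis of the linear problem. Derivatives are stated for [t > 0], where
    [max 0 t] agrees with [t] nearby. *)
Lemma halfline_solution : exists u : P * R -> R * R, [/\ continuous u,
   (forall q, `|(u q).1| + `|(u q).2| <= 2 * A * X (pos q.2)),
   (forall p, (u (p, 0)).1 = a p /\ `|(u (p, 0)).2| <= 2 * M * eps * A) &
   forall (p : P) (t : R), 0 < t ->
     is_derive t 1 (fun t => (u (p, t)).1) (- atan t * (u (p, t)).1 + f (p, t) (u (p, t))) /\
     is_derive t 1 (fun t => (u (p, t)).2) (atan t * (u (p, t)).2 + h (p, t) (u (p, t)))].
Proof.
have zc n : continuous (z n) by have [] := z_spec n.
have e_unif n m q : (n <= m)%N ->
    `|(z n q).1 - (z m q).1| <= e n * expR pi /\ `|(z n q).2 - (z m q).2| <= e n * expR pi.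
  move=> nm; have := z_cauchy_le nm q.
  have e0 : 0 <= e n by rewrite !mulr_ge0// exprn_ge0// invr_ge0.
  have := ler_wpM2l e0 (xweight_le (pos_ge0 q.2)).
  have := normr_ge0 ((z n q).1 - (z m q).1); have := normr_ge0 ((z n q).2 - (z m q).2).
  by move=> *; split; lra.
have ecv : e n * expR pi @[n --> \oo] --> 0.
  by rewrite -(mul0r (expR pi)); apply: cvgM; [exact: e_cvg|exact: cvg_cst].
have [|n m q nm|//|u1 [cu1 _ zu1]] := @uniform_limit R (P * R)%type (fun n q => (z n q).1) (fun n => e n * expR pi).
- by move=> n q; apply: (@continuous_comp _ _ _ (z n) fst); [exact: zc|exact: cvg_fst].
- by have [] := e_unif n m q nm.
have [|n m q nm|//|u2 [cu2 _ zu2]] := @uniform_limit R (P * R)%type (fun n q => (z n q).2) (fun n => e n * expR pi).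
- by move=> n q; apply: (@continuous_comp _ _ _ (z n) snd); [exact: zc|exact: cvg_snd].
- by have [] := e_unif n m q nm.
pose u : state := fun q => (u1 q, u2 q).
have cu : continuous u by exact: continuous_pair.
have zu n : close (z n) u (e n).
  move=> q; have cv : `|(z n q).1 - (z m q).1| + `|(z n q).2 - (z m q).2| @[m --> \oo]
      --> `|(z n q).1 - u1 q| + `|(z n q).2 - u2 q|.
    apply: cvgD; apply: cvg_norm; apply: cvgB; [exact: cvg_cst|exact: zu1|exact: cvg_cst|exact: zu2].
  apply: (cvgr_to_le cv).
  by exists n => // m /= nm; exact: z_cauchy_le.
have ub : close u zero (2 * A).
  have := zu 0%N; rewrite /e expr0 mulr1; exact: close_sym.
(* The sequence [z n.+1 = step (z n)] converges both to [step u] and to [u]. *)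
have fixu q : step u q = u q.
  have en0 n : 0 <= e n by rewrite !mulr_ge0// exprn_ge0// invr_ge0.
  have s1 n : close (z n.+1) (step u) (e n / 2).
    exact: step_lip.
  have toX : e n / 2 * X (pos q.2) @[n --> \oo] --> 0.
    rewrite [Y in _ --> Y](_ : 0 = 0 * 2^-1 * X (pos q.2)); last by rewrite !mul0r.
    by apply: cvgM; [apply: cvgM; [exact: e_cvg|exact: cvg_cst]|exact: cvg_cst].
  have sq (v : nat -> R) (l : R) : (forall n, `|v n - l| <= e n / 2 * X (pos q.2)) -> v n @[n --> \oo] --> l.
    move=> vl; apply/cvgrPdist_le => d d0.
    move/cvgrPdist_le : toX => /(_ d d0); apply: filterS => n.
    rewrite sub0r normrN distrC => hn; apply: le_trans (vl n) _; apply: le_trans hn; exact: ler_norm.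
  rewrite [LHS]surjective_pairing /u; congr pair.
    apply: (@cvg_unique _ _ ((z n.+1 q).1 @[n --> \oo])) => //.
      apply: sq => n; apply: le_trans (s1 n q); by rewrite lerDl.
    by have := zu1 q; rewrite -(cvg_shiftS (fun n => (z n q).1)).
  apply: (@cvg_unique _ _ ((z n.+1 q).2 @[n --> \oo])) => //.
    by apply: sq => n; apply: le_trans (s1 n q); rewrite lerDr.
  by have := zu2 q; rewrite -(cvg_shiftS (fun n => (z n q).2)).
have cf := comp_cont f_cont cu; have ch := comp_cont h_cont cu.
have eA : 0 <= eps * (2 * A) by rewrite !mulr_ge0.
exists u; split => //.
- by move=> q; have := ub q; rewrite /= !subr0.
- move=> p; have e1 := congr1 fst (fixu (p, 0)); have e2 := congr1 snd (fixu (p, 0)).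
  split; first by rewrite -e1 /= decay_at0 maxxx atan_prim0 oppr0 expR0 mul1r addr0.
  rewrite -e2 /=.
  have cz : continuous zero by move=> ?; exact: cvg_cst.
  have zz : close zero zero 0 by move=> q'; rewrite /= subrr normr0 addr0 mul0r.
  have b0 := comp_bound h_lip h0 zz; rewrite mulr0 in b0.
  have := grow_lip eA eA (lexx 0) ch (comp_cont h_cont cz) (comp_bound h_lip h0 ub) b0 (comp_lip h_lip ub) (p, 0).
  rewrite grow_zero subr0 maxxx xweight0 mulr1; congr (_ <= _); ring.
move=> p t t0; split.
- have dE : is_derive t 1 (fun t => expR (- K t) * a p) (- atan t * (expR (- K t) * a p)).
    apply: is_derive_ext (is_deriveZ (a p) (is_derive1_comp (is_derive_expR _) (is_deriveN (derive_atan_prim t)))) _ _.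
      by move=> s; rewrite mulrC.
    by rewrite -[_ *: _]/(_ * _) /=; ring.
  have dE' : is_derive t 1 (fun t => expR (- K (pos t)) * a p) (- atan t * (expR (- K (pos t)) * a p)).
    rewrite (pos_id (ltW t0)).
    apply: near_eq_is_derive dE; near=> s; rewrite max_r//.
    by near: s; apply: filterS (lt_nbhsr t0) => s /ltW.
  apply: is_derive_ext (is_deriveD dE' (decay_derive p cf t0)) _ _.
    by move=> s; rewrite -(fixu (p, s)).
  have e1 := congr1 fst (fixu (p, t)); rewrite -[(u (p, t)).1]e1 [(step u (p, t)).1]/= mulrDr addrA; congr (_ + _).
- apply: is_derive_ext (grow_derive ch p t0) _ _.
    by move=> s; rewrite -(fixu (p, s)).
  by have e2 := congr1 snd (fixu (p, t)); rewrite -[(u (p, t)).2]e2.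
Unshelve. all: end_near. Qed.

End NonlinearHalfLine.

(** * Smooth bump functions *)

Section Bump.
Variable R : realType.
Implicit Types (f g : R -> R) (P Q : {poly R}) (x y : R).

(** The derivatives are witnesses, which turns closure under sums, products and affine changes of
    variable into plain inductions. *)
Fixpoint smoothn (n : nat) (f : R -> R) : Prop :=
  if n is n'.+1 then exists2 f', (forall x, is_derive x 1 f (f' x)) & smoothn n' f' else True.

Definition smooth (f : R -> R) := forall n, smoothn n f.

Lemma smoothnW n f : smoothn n.+1 f -> smoothn n f.
Proof. by elim: n f => // n IHn f [f' df sf']; exists f' => //; exact: IHn. Qed.

Lemma smooth_derive1n f n x : smooth f -> derivable (derive1n n f) x 1.
Proof.
move=> sf; move: (sf n.+1); elim: n f {sf} => [|n IHn] f [f' df sf'].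
  exact: ex_derive.
have -> : derive1n n.+1 f = derive1n n f'.
  rewrite derive1Sn; congr derive1n; apply/funext => y.
  by rewrite derive1E; apply: derive_val.
exact: IHn.
Qed.

Lemma smoothnD n f g : smoothn n f -> smoothn n g -> smoothn n (fun x => f x + g x).
Proof.
elim: n f g => // n IHn f g [f' df sf'] [g' dg sg'].
exists (fun x => f' x + g' x); last exact: IHn.
by move=> x; apply: is_derive_ext (is_deriveD (df x) (dg x)) _ _.
Qed.

Lemma smoothnM n f g : smoothn n f -> smoothn n g -> smoothn n (fun x => f x * g x).
Proof.
elim: n f g => // n IHn f g sf sg; have [f' df sf'] := sf; have [g' dg sg'] := sg.
exists (fun x => f' x * g x + f x * g' x); last first.
  by apply: smoothnD; apply: IHn => //; exact: smoothnW.
move=> x; apply: is_derive_ext (is_deriveM (df x) (dg x)) _ _ => //.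
by rewrite -![_ *: _]/(_ * _) addrC [g x * _]mulrC.
Qed.

Lemma smoothn_cst n (c : R) : smoothn n (cst c).
Proof. by elim: n c => // n IHn c; exists (cst 0) => // x; exact: is_derive_cst. Qed.

Lemma smoothn_affine n f (c d : R) : smoothn n f -> smoothn n (fun x => f (c * x + d)).
Proof.
elim: n f => // n IHn f [f' df sf'].
exists (fun x => c * f' (c * x + d)); last by apply: smoothnM; [exact: smoothn_cst|exact: IHn].
move=> x.
have dl : is_derive x 1 (fun x => c * x + d) c.
  apply: is_derive_ext (is_deriveD (is_deriveZ c (is_derive_id x 1)) (is_derive_cst d x 1)) _ _ => //.
  by rewrite addr0 -[_ *: _]/(_ * _) mulr1.
by apply: is_derive_ext (is_derive1_comp (df _) dl) _ _ => //; rewrite mulrC.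
Qed.

Lemma poly_le_exp Q : exists2 C, 0 <= C & forall y, 0 <= y -> `|Q.[y]| <= C * expR y.
Proof.
have pow n : exists2 C, 0 <= C & forall y, 0 <= y -> y ^+ n <= C * expR y.
  case: n => [|n].
    by exists 1 => // y y0; rewrite expr0 mul1r -expR0 ler_expR.
  (* From [z <= exp z] at [z = y / (n + 1)], raised to the power [n + 1]. *)
  exists (n.+1%:R ^+ n.+1); first by rewrite exprn_ge0.
  move=> y y0; have -> : y = n.+1%:R * (y / n.+1%:R) by rewrite mulrCA divff ?mulr1.
  rewrite expRM_natl exprMn ler_wpM2l ?exprn_ge0//.
  have z0 : 0 <= y / n.+1%:R by rewrite divr_ge0.
  rewrite lerXn2r ?nnegrE ?expR_ge0//.
  by apply: le_trans (expR_ge1Dx _); rewrite lerDr.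
elim/poly_ind: Q => [|Q c _].
  by exists 0 => // y _; rewrite horner0 normr0 mul0r.
move: (_ + _) => {c}Q.
have cf (i : nat) : exists C, 0 <= C /\ forall y, 0 <= y -> `|Q`_i * y ^+ i| <= C * expR y.
  have [C C0 CP] := pow i; exists (`|Q`_i| * C); split; first by rewrite mulr_ge0.
  by move=> y y0; rewrite normrM -mulrA ler_wpM2l// ger0_norm ?exprn_ge0//; exact: CP.
have [C CP] := choice cf.
exists (\sum_(i < size Q) C i); first by apply: sumr_ge0 => i _; have [] := CP i.
move=> y y0; rewrite horner_coef mulr_suml; apply: (le_trans (ler_norm_sum _ _ _)).
by apply: ler_sum => i _; have [_] := CP i; apply.
Qed.

(* The derivatives of [exp (- 1/x)] on [x > 0] all have this shape. *)
Definition flat P x : R := if 0 < x then P.[x^-1] * expR (- x^-1) else 0.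

(** A quadratic bound makes the difference quotient at the origin tend to [0]. The exponential
    absorbs the extra factor [X^2]. *)
Lemma flat_le_sqr P : exists2 C, 0 <= C & forall x, `|flat P x| <= C * x ^+ 2.
Proof.
have [C C0 CP] := poly_le_exp ('X^2 * P); exists C => // x.
rewrite /flat; case: ltP => x0; last by rewrite normr0 mulr_ge0 ?sqr_ge0.
have y0 : 0 <= x^-1 by rewrite invr_ge0 ltW.
have := CP _ y0; rewrite hornerM hornerXn !normrM => h.
rewrite (gtr0_norm (expR_gt0 _)) expRN ler_pdivrMr ?expR_gt0// mulrAC.
rewrite -ler_pdivrMr ?exprn_gt0//; apply: le_trans h.
by rewrite mulrC -exprVn (ger0_norm y0) -expr2.
Qed.

Lemma flat_derive P x : is_derive x 1 (flat P) (flat ('X^2 * (P - P^`())) x).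
Proof.
have [x0|x0|->] := ltgtP x 0.
- rewrite {2}/flat ltNge (ltW x0) /=.
  apply: near_eq_is_derive (is_derive_cst 0 x 1); near=> y.
  by rewrite /flat ltNge ltW//; near: y; exact: lt_nbhsl.
- have dV : is_derive x 1 (fun x => x^-1) (- x ^- 2).
    apply: is_derive_ext (@is_deriveV R id x 1 1 (lt0r_neq0 x0) (is_derive_id x 1)) _ _ => //.
    by rewrite -[_ *: _]/(_ * _) mulr1.
  have dP := is_derive1_comp (is_derive_poly P x^-1) dV.
  have dE := is_derive1_comp (is_derive_expR _) (is_deriveN dV).
  rewrite {2}/flat x0.
  apply: (@near_eq_is_derive _ _ _ (fun x => P.[x^-1] * expR (- x^-1))).
    near=> y; rewrite /flat ifT//; near: y; exact: lt_nbhsr.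
  apply: is_derive_ext (is_deriveM dP dE) _ _ => //.
  rewrite -![_ *: _]/(_ * _) hornerM hornerXn hornerD hornerN /= exprVn; ring.
have [C C0 CP] := flat_le_sqr P.
rewrite {2}/flat ltxx.
have lim0 : h^-1 *: (flat P (h *: 1 + 0) - flat P 0) @[h --> 0^'] --> 0.
  apply/cvgrPdist_le => eps eps0; near=> h.
  have h0 : h != 0 by near: h; exact: nbhs_dnbhs_neq.
  rewrite sub0r normrN {2}/flat ltxx subr0 addr0 -![_ *: _]/(_ * _) mulr1 normrM normfV.
  rewrite mulrC ler_pdivrMr ?normr_gt0//; apply: (le_trans (CP h)).
  rewrite -[X in C * X]real_normK ?num_real// expr2 mulrA ler_wpM2r//.
  have hC : `|h| < eps / (C + 1).
    near: h; apply: dnbhs0_lt; rewrite divr_gt0//; lra.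
  have C1 : 0 < C + 1 by lra.
  move: hC; rewrite ltr_pdivlMr// => hC; have := normr_ge0 h; nra.
apply: DeriveDef; first by apply/cvg_ex; exists 0.
exact: cvg_lim lim0.
Unshelve. all: end_near. Qed.

Lemma flat_smooth P : smooth (flat P).
Proof.
move=> n; elim: n P => // n IHn P; exists (flat ('X^2 * (P - P^`()))) => // x.
exact: flat_derive.
Qed.

Definition bump (a b x : R) : R := flat 1 (x - a) * flat 1 (b - x).

Lemma bump_smooth a b : smooth (bump a b).
Proof.
move=> n; apply: smoothnM.
  have := @smoothn_affine n (flat 1) 1 (- a) (flat_smooth 1 n).
  by under eq_fun do rewrite mul1r.
have := @smoothn_affine n (flat 1) (- 1) b (flat_smooth 1 n).
by under eq_fun do rewrite mulN1r addrC.
Qed.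

Lemma flat1_ge0 x : 0 <= flat 1 x.
Proof. by rewrite /flat; case: ifP => // _; rewrite hornerC mul1r expR_ge0. Qed.

Lemma flat1_le1 x : flat 1 x <= 1.
Proof.
rewrite /flat; case: ifP => // x0; rewrite hornerC mul1r -expR0 ler_expR oppr_le0.
by rewrite invr_ge0 ltW.
Qed.

Lemma bump_ge0 a b x : 0 <= bump a b x.
Proof. by rewrite mulr_ge0// flat1_ge0. Qed.

Lemma bump_le1 a b x : bump a b x <= 1.
Proof. by rewrite mulr_ile1// ?flat1_ge0// flat1_le1. Qed.

Lemma bump_gt0 a b x : a < x < b -> 0 < bump a b x.
Proof.
move=> /andP[ax xb]; rewrite /bump /flat !subr_gt0 ax xb !hornerC !mul1r.
by rewrite mulr_gt0// expR_gt0.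
Qed.

Lemma bump_eq0 a b x : ~~ (a < x < b) -> bump a b x = 0.
Proof.
rewrite negb_and -!leNgt /bump /flat !subr_gt0 => /orP[xa|bx].
  by rewrite ltNge xa mul0r.
by rewrite (ltNge x b) bx mulr0.
Qed.

End Bump.

(** * Test functions that approximate a point evaluation *)

Section SobolevDecay.
Variable R : realType.
Implicit Types (f g h : R -> R) (a b t : R).
Local Notation mu := (@lebesgue_measure R).

Definition bump_mass a b : R := prim (bump a b) b - prim (bump a b) a.

Definition bump_cdf a b t : R := (prim (bump a b) t - prim (bump a b) a) / bump_mass a b.

Lemma bump_continuous a b : continuous (bump a b).
Proof. by move=> t; have [f' df _] := bump_smooth a b 1; exact: is_derive_continuous. Qed.

Let bump_prim a b t : is_derive t 1 (prim (bump a b)) (bump a b t).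
Proof. exact/prim_derive/bump_continuous. Qed.

Lemma bump_mass_gt0 a b : a < b -> 0 < bump_mass a b.
Proof.
move=> ab; have [||c cab e] := @MVT R (prim (bump a b)) (bump a b) a b ab.
- by move=> x _; exact: bump_prim.
- by apply: derivable_within_continuous => x _; have h := bump_prim a b x; exact: ex_derive.
by rewrite /bump_mass e mulr_gt0 ?subr_gt0// bump_gt0; move: cab; rewrite in_itv.
Qed.

Let prim_bump_le a b s t : s <= t -> prim (bump a b) s <= prim (bump a b) t.
Proof.
by move=> st; apply: (@derive_ge0_le R _ (bump a b)) => // x _; exact: bump_ge0.
Qed.

Let prim_bump_const a b s t : s <= t -> (forall x, s <= x <= t -> bump a b x = 0) ->
  prim (bump a b) s = prim (bump a b) t.
Proof.
move=> st b0; apply/eqP; rewrite eq_sym -subr_eq0 -normr_le0.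
have := @derive_norm_le R (prim (bump a b)) (cst 0) (bump a b) (cst 0) s t st.
rewrite /= subrr; apply => // x xst.
by rewrite b0// normr0.
Qed.

Lemma bump_cdf_le a b t : a < b -> t <= a -> bump_cdf a b t = 0.
Proof.
move=> ab ta; rewrite /bump_cdf (@prim_bump_const a b t a)// ?subrr ?mul0r// => x /andP[_ xa].
by apply: bump_eq0; rewrite negb_and -leNgt xa.
Qed.

Lemma bump_cdf_ge a b t : a < b -> b <= t -> bump_cdf a b t = 1.
Proof.
move=> ab bt; rewrite /bump_cdf -(@prim_bump_const a b b t)// => [|x /andP[bx _]].
  by rewrite divff// gt_eqF// bump_mass_gt0.
by apply: bump_eq0; rewrite negb_and -!leNgt bx orbT.
Qed.

Lemma bump_cdf_itv a b t : a < b -> 0 <= bump_cdf a b t <= 1.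
Proof.
move=> ab; have m0 := bump_mass_gt0 ab.
have [ta|ta] := leP t a; first by rewrite bump_cdf_le// lexx ler01.
have [bt|bt] := leP b t; first by rewrite bump_cdf_ge// lexx ler01.
have h1 := prim_bump_le a b (ltW ta); have h2 := prim_bump_le a b (ltW bt).
rewrite /bump_cdf ler_pdivrMr// mul1r lerD2r h2 andbT.
by apply: divr_ge0; [rewrite subr_ge0|exact: ltW].
Qed.

(** Translation invariance makes the bound on the density [spike_wide] independent of [c]. *)
Lemma bump_mass_shift c : bump_mass (c + 1) (c + 2) = bump_mass 0 1.
Proof.
have h : c + 1 <= c + 2 by lra.
have := @derive_eq R (prim (bump (c + 1) (c + 2))) (fun t => prim (bump 0 1) (t - (c + 1)))
  (bump (c + 1) (c + 2)) _ _ h.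
rewrite /bump_mass subrr; have -> : c + 2 - (c + 1) = 1 by ring.
apply=> s _; first exact: bump_prim.
have ds : is_derive s 1 (fun t => t - (c + 1)) 1.
  by apply: is_derive_ext (is_deriveB (is_derive_id s 1) (is_derive_cst (c + 1) s 1)) _ _ => //; rewrite subr0.
apply: is_derive_ext (is_derive1_comp (bump_prim 0 1 _) ds) _ _ => //.
rewrite mulr1 /bump subr0; congr (_ * flat _ _); ring.
Qed.

Section TestFunction.
Variables (c eta : R).
Hypotheses (eta_gt0 : 0 < eta) (eta_le1 : eta <= 1).

Let narrow : c - eta < c + eta. Proof. by move: eta_gt0; lra. Qed.
Let wide : c + 1 < c + 2. Proof. lra. Qed.

(** It rises from [0] to [1] within [eta] of [c] and falls back on [[c + 1, c + 2]]. Its derivative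
    is an approximate point mass at [c] minus a bounded density, so the weak derivative recovers [g]
    near [c] up to local integrals of [g] and [h]. *)
Definition spike t : R := bump_cdf (c - eta) (c + eta) t - bump_cdf (c + 1) (c + 2) t.

Definition spike_narrow t : R := bump (c - eta) (c + eta) t / bump_mass (c - eta) (c + eta).
Definition spike_wide t : R := bump (c + 1) (c + 2) t / bump_mass 0 1.

Lemma bump_cdf_derive a b t : is_derive t 1 (bump_cdf a b) (bump a b t / bump_mass a b).
Proof.
apply: is_derive_ext (is_deriveZ (bump_mass a b)^-1 (is_deriveB (bump_prim a b t) (is_derive_cst (prim (bump a b) a) t 1))) _ _.
  by move=> s; rewrite /bump_cdf mulrC.
by rewrite subr0 -[_ *: _]/(_ * _) mulrC.
Qed.

Lemma spike_derive t : is_derive t 1 spike (spike_narrow t - spike_wide t).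
Proof. by rewrite /spike_wide -(bump_mass_shift c); apply: is_deriveB; exact: bump_cdf_derive. Qed.

Lemma spike_out t : ~~ (c - 1 <= t <= c + 2) -> spike t = 0.
Proof.
rewrite negb_and -!ltNge /spike => /orP[tc|tc].
  by rewrite !bump_cdf_le ?subrr//; move: eta_gt0 eta_le1; lra.
by rewrite !bump_cdf_ge ?subrr//; move: eta_gt0 eta_le1; lra.
Qed.

Lemma spike_derive_out t : ~~ (c - 1 <= t <= c + 2) -> spike_narrow t = 0 /\ spike_wide t = 0.
Proof.
rewrite negb_and -!ltNge /spike_narrow /spike_wide => tc.
have n0 : bump (c - eta) (c + eta) t = 0.
  apply: bump_eq0; rewrite negb_and -!leNgt; apply/orP.
  by case/orP: tc => tc; [left|right]; move: eta_gt0 eta_le1; lra.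
have w0 : bump (c + 1) (c + 2) t = 0.
  by apply: bump_eq0; rewrite negb_and -!leNgt; apply/orP; case/orP: tc => tc; [left|right]; lra.
by rewrite n0 w0; split; exact: mul0r.
Qed.

Lemma spike_le1 t : `|spike t| <= 1.
Proof.
have := bump_cdf_itv t narrow; have := bump_cdf_itv t wide.
rewrite /spike ler_norml; move: (bump_cdf (c + 1) _ t) (bump_cdf (c - eta) _ t) => x y.
by move=> /andP[? ?] /andP[? ?]; apply/andP; split; lra.
Qed.

Lemma spike_test : test_function spike.
Proof.
split.
  move=> n x; apply: smooth_derive1n => k; apply: smoothnW.
  exists (fun t => spike_narrow t - spike_wide t); first exact: spike_derive.
  have sub f g : smooth f -> smooth g -> forall a b : R, smoothn k (fun t => f t / a - g t / b).
    move=> sf sg a b; have := smoothnD (smoothnM (sf k) (smoothn_cst k a^-1)) (smoothnM (sg k) (smoothn_cst k (- b^-1))).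
    by under eq_fun do rewrite /= mulrN.
  exact: sub (bump_smooth _ _) (bump_smooth _ _) _ _.
apply: (@subclosed_compact _ _ `[c - 1, c + 2]); [exact: closed_closure|exact: segment_compact|].
have /closure_id -> : closed `[c - 1, c + 2] by exact: interval_closed.
apply: closureS => t /= tn0; rewrite in_itv /=.
by apply: contraNT tn0 => /spike_out ->.
Qed.

End TestFunction.

End SobolevDecay.

(** * Decay in a Sobolev space *)

Section SobolevDecay.
Variable R : realType.
Implicit Types (f g h : R -> R) (a b t : R).
Local Notation mu := (@lebesgue_measure R).

Lemma norm_le_young (y kappa : R) : 0 < kappa -> `|y| <= kappa + kappa^-1 * y ^+ 2.
Proof.
move=> k0; rewrite -[X in _ * X]real_normK ?num_real//.
rewrite -(ler_pM2l k0) mulrDr mulrA divff ?gt_eqF// mul1r.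
by have := sqr_ge0 (kappa - `|y|); have := normr_ge0 y; nra.
Qed.

Lemma integrable_tail (N : R -> R) (eta : R) : (forall x, 0 <= N x) ->
  mu.-integrable setT (EFin \o N) -> 0 < eta ->
  exists n : nat, forall E : set (measurableTypeR R), measurable E -> E `&` `[- n%:R, n%:R] = set0 ->
    \int[mu]_(x in E) N x <= eta.
Proof.
move=> N0 iN eta0.
pose A (n : nat) : set (measurableTypeR R) := `[- n%:R, n%:R]%classic.
have mA n : measurable (A n) by exact: measurable_itv.
have iS (E : set (measurableTypeR R)) : measurable E -> mu.-integrable E (EFin \o N) by move=> mE; exact: integrableS iN.
have AT : \bigcup_n A n = setT.
  rewrite -subTset => x _; exists (Num.truncn `|x|).+1 => //=.
  by rewrite /A /= in_itv /= -ler_norml ltW// truncnS_gt.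
have cv : \int[mu]_(x in A n) N x @[n --> \oo] --> \int[mu]_x N x.
  rewrite /Rintegral -[X in integral mu X]AT.
  apply: fine_cvg; rewrite fineK; last by apply: integrable_fin_num; rewrite AT//; exact: iS.
  apply: ge0_nondecreasing_set_cvg_integral => //.
  - apply/nondecreasing_seqP => n; rewrite subsetEset; apply: subset_itvScc; rewrite bnd_simp ?lerN2 ler_nat//.
  - by move=> n; have /integrableP[] := iS _ (mA n).
  - by move=> n x _; rewrite lee_fin.
have /cvgrPdist_lt/(_ eta eta0)[n _ /(_ n (leqnn n)) /= hn] := cv.
exists n => E mE EA; rewrite -/(A n) in EA.
have dis : [disjoint A n & E] by rewrite disj_set2E setIC EA.
have := Rintegral_setU (mA n) mE (iS _ (measurableU _ _ (mA n) mE)) dis.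
have : \int[mu]_(x in A n `|` E) N x <= \int[mu]_x N x.
  rewrite /Rintegral fine_le//; try by apply: integrable_fin_num; [|exact: iS].
    by apply: integrable_fin_num; [exact: measurableU|apply: iS; exact: measurableU].
  apply: ge0_subset_integral => //; first exact: measurableU.
    by have /integrableP[] := iN.
  by move=> x _; rewrite lee_fin.
move: hn; rewrite ltr_norml => /andP[_]; lra.
Qed.

Lemma continuous_integrable f a b : continuous f -> mu.-integrable `[a, b] (EFin \o f).
Proof.
move=> cf; apply: continuous_compact_integrable; first exact: segment_compact.
exact: continuous_subspaceT.
Qed.

Lemma spike_narrow_integral (c eta : R) : 0 < eta -> eta <= 1 ->
  \int[mu]_(x in `[c - 1, c + 2]) spike_narrow c eta x = 1.
Proof.
move=> e0 e1; rewrite /Rintegral.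
have d (x : R) : is_derive x 1 (bump_cdf (c - eta) (c + eta)) (spike_narrow c eta x).
  by exact: bump_cdf_derive.
rewrite (@continuous_FTC2 _ _ (bump_cdf (c - eta) (c + eta))).
- by rewrite /= bump_cdf_ge ?bump_cdf_le ?subr0//; lra.
- lra.
- apply: continuous_subspaceT => x.
  by apply: cvgM; [exact: bump_continuous|exact: cvg_cst].
- have cc : continuous (bump_cdf (c - eta) (c + eta)) by move=> x; exact: is_derive_continuous (d x).
  split.
  + by move=> x _; have h := d x; exact: ex_derive.
  + by apply: cvg_at_right_filter; exact: cc.
  + by apply: cvg_at_left_filter; exact: cc.
- by move=> x _; rewrite derive1E; exact: derive_val.
Qed.

(** Testing with [spike], the average of [g] near [c] equals the integral of
    [g * spike_wide - h * spike]. Young's inequality with weight [kappa] bounds this by local square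
    integrals plus a constant that [kappa] makes small. *)
Lemma sobolev_lower_bound (g h : R -> R) (c r kappa W : R) :
  g \in Lfun mu 2%:E -> h \in Lfun mu 2%:E ->
  (forall phi, test_function phi ->
     \int[mu]_x (g x * derive1 phi x) = - \int[mu]_x (h x * phi x)) ->
  0 < kappa -> (\forall t \near c, r <= g t) ->
  W = (bump_mass 0 1)^-1 ->
  r <= \int[mu]_(x in `[c - 1, c + 2])
         (kappa * (1 + W) + kappa^-1 * (h x ^+ 2 + W * g x ^+ 2)).
Proof.
move=> gL hL weak k0 gr WE; rewrite /reverse_coercion in weak *.
have W0 : 0 <= W by rewrite WE invr_ge0 ltW// bump_mass_gt0.
(* The cap [eta <= 1] keeps the support inside [[c - 1, c + 2]], whatever the size of the
   neighbourhood. *)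
have [eta [eta0 eta1 geta]] : exists eta, [/\ 0 < eta, eta <= 1 & forall t, c - eta < t < c + eta -> r <= g t].
  have /nbhs_ballP[d /= d0 dP] := gr.
  exists (Num.min d 1); split; [by rewrite lt_min d0 ltr01|by rewrite ge_min lexx orbT|].
  move=> t /andP[t1 t2]; apply: dP; rewrite /ball /= ltr_norml.
  have : Num.min d 1 <= d by rewrite ge_min lexx.
  by move=> h0; apply/andP; split; lra.
pose E : set (measurableTypeR R) := `[c - 1, c + 2]%classic.
have mE : measurable E by exact: measurable_itv.
have [mg mh] : measurable_fun setT g /\ measurable_fun setT h.
  by split; [move: gL|move: hL]; rewrite inE => /andP[]; rewrite inE.
have ig2 : mu.-integrable E (EFin \o (fun x => g x ^+ 2)).
  exact: (integrableS measurableT mE (@subsetT _ E) (Lfun2_integrable_sqr gL)).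
have ih2 : mu.-integrable E (EFin \o (fun x => h x ^+ 2)).
  exact: (integrableS measurableT mE (@subsetT _ E) (Lfun2_integrable_sqr hL)).
have icst (k : R) : mu.-integrable E (EFin \o cst k).
  by apply: continuous_integrable => x; exact: cvg_cst.
have iD f1 f2 : mu.-integrable E (EFin \o f1) -> mu.-integrable E (EFin \o f2) ->
    mu.-integrable E (EFin \o (fun x => f1 x + f2 x)).
  by move=> i1 i2; exact: (integrableD mE i1 i2).
have iZ (k : R) f1 : mu.-integrable E (EFin \o f1) -> mu.-integrable E (EFin \o (fun x => k * f1 x)).
  by move=> i1; exact: (integrableZl mE k i1).
have idom f1 (w : R -> R) (C : R) : measurable_fun setT f1 ->
    mu.-integrable E (EFin \o (fun x => f1 x ^+ 2)) -> continuous w -> (forall x, `|w x| <= C) ->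
    mu.-integrable E (EFin \o (fun x => f1 x * w x)).
  move=> mf if2 cw wC.
  have iDom := iZ C _ (iD _ _ (icst 1) if2).
  apply: le_integrable iDom => //.
    apply/measurable_realfun.measurable_EFinP; apply: measurable_funTS; apply: measurable_realfun.measurable_funM => //.
    exact: measurable_realfun.continuous_measurable_fun.
  move=> x _; rewrite /= lee_fin normrM mulrC.
  have C0 : 0 <= C by apply: le_trans (wC x).
  have fx : 0 <= 1 + f1 x ^+ 2 by rewrite addr_ge0 ?sqr_ge0.
  rewrite [leRHS]ger0_norm ?mulr_ge0// ler_pM//.
  rewrite -[X in 1 + X]real_normK ?num_real//; have := sqr_ge0 (`|f1 x| - 1); nra.
have cn : continuous (spike_narrow c eta).
  by move=> x; apply: cvgM; [exact: bump_continuous|exact: cvg_cst].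
have cw : continuous (spike_wide c).
  by move=> x; apply: cvgM; [exact: bump_continuous|exact: cvg_cst].
have cs : continuous (spike c eta) by move=> x; exact: is_derive_continuous (spike_derive c eta x).
have wW x : 0 <= spike_wide c x <= W.
  rewrite /spike_wide -WE mulr_ge0 ?bump_ge0//= -[leRHS]mul1r ler_wpM2r// bump_le1//.
have m0 : 0 < bump_mass (c - eta) (c + eta) by apply: bump_mass_gt0; lra.
have n0 x : 0 <= spike_narrow c eta x by rewrite mulr_ge0 ?bump_ge0// invr_ge0 ltW.
have nC x : `|spike_narrow c eta x| <= (bump_mass (c - eta) (c + eta))^-1.
  by rewrite ger0_norm// -[leRHS]mul1r ler_wpM2r ?bump_le1// invr_ge0 ltW.
have iphi : mu.-integrable E (EFin \o (fun x => h x * spike c eta x)).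
  by apply: (idom h (spike c eta) 1 mh ih2 cs) => x; exact: spike_le1.
have ipsi : mu.-integrable E (EFin \o (fun x => g x * (spike_narrow c eta x - spike_wide c x))).
  apply: (idom g (fun x => spike_narrow c eta x - spike_wide c x) ((bump_mass (c - eta) (c + eta))^-1 + W) mg ig2).
    by move=> x; apply: cvgB; [exact: cn|exact: cw].
  move=> x; apply: (le_trans (ler_normB _ _)); apply: lerD; first exact: nC.
  by have /andP[h1 h2] := wW x; rewrite ger0_norm.
have iQ : mu.-integrable E (EFin \o (fun x => kappa * (1 + W) + kappa^-1 * (h x ^+ 2 + W * g x ^+ 2))).
  by apply: (iD); [exact: icst|apply: (iZ); apply: (iD) => //; exact: iZ].
have restr f1 : (forall x, ~ E x -> f1 x = 0) -> \int[mu]_x f1 x = \int[mu]_(x in E) f1 x.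
  rewrite /reverse_coercion.
  move=> f10; rewrite [RHS]Rintegral_mkcond; apply: eq_Rintegral => x _.
  by rewrite patchE; case: ifPn => // /negP xE; rewrite f10// => Ex; apply: xE; rewrite inE.
have outE x : ~ E x -> ~~ (c - 1 <= x <= c + 2).
  by move=> xE; apply/negP => xc; apply: xE; rewrite /E /= in_itv.
have key := weak _ (spike_test c eta0 eta1).
have dspike : derive1 (spike c eta) = fun x => spike_narrow c eta x - spike_wide c x.
  apply/funext => x; rewrite derive1E; have := spike_derive c eta x => d; exact: derive_val.
rewrite dspike in key.
have psi_out x : ~ E x -> g x * (spike_narrow c eta x - spike_wide c x) = 0.
  by move=> /outE/(spike_derive_out eta0 eta1)[-> ->]; rewrite subrr mulr0.
have phi_out x : ~ E x -> h x * spike c eta x = 0.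
  by move=> /outE/(spike_out eta0 eta1) ->; rewrite mulr0.
have icn : mu.-integrable E (EFin \o spike_narrow c eta) by exact: continuous_integrable.
rewrite /reverse_coercion in restr.
have {}key : \int[mu]_(x in E) (g x * (spike_narrow c eta x - spike_wide c x)) =
    - \int[mu]_(x in E) (h x * spike c eta x).
  exact: (etrans (esym (restr _ psi_out)) (etrans key (congr1 -%R (restr _ phi_out)))).
rewrite /reverse_coercion in key.
have i1 : r = \int[mu]_(x in E) (r * spike_narrow c eta x).
  rewrite /reverse_coercion.
  by rewrite (RintegralZl r mE icn) spike_narrow_integral ?mulr1.
rewrite -/E; rewrite /reverse_coercion in i1.
(* By the weak identity the added summand integrates to [0], so a pointwise inequality of the
   integrands suffices. *)
apply: (@le_trans _ _ (\int[mu]_(x in E) ((g x * (spike_narrow c eta x - spike_wide c x) + h x * spike c eta x)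
   + (kappa * (1 + W) + kappa^-1 * (h x ^+ 2 + W * g x ^+ 2))))); last first.
  rewrite /reverse_coercion (RintegralD mE (iD _ _ ipsi iphi) iQ) (RintegralD mE ipsi iphi).
  have addz (x y z : R) : x = - y -> x + y + z = z by move=> ->; rewrite addNr add0r.
  by rewrite (addz _ _ _ key) lexx.
rewrite {1}i1 /reverse_coercion; apply: (le_Rintegral mE (iZ r _ icn) (iD _ _ (iD _ _ ipsi iphi) iQ)).
move=> x _.
have s1 := spike_le1 c eta0 x.
have AM (y : R) := norm_le_young y k0.
have hx : - (kappa + kappa^-1 * h x ^+ 2) <= h x * spike c eta x.
  rewrite lerNl; apply: le_trans (AM (h x)); apply: le_trans (ler_norm _) _.
  by rewrite normrN normrM ler_piMr.
have gx : - (W * (kappa + kappa^-1 * g x ^+ 2)) <= - (g x * spike_wide c x).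
  rewrite lerN2; apply: (le_trans (ler_norm _)); rewrite normrM mulrC.
  have /andP[w0 w1] := wW x.
  by rewrite ler_pM// ger0_norm.
have nx : r * spike_narrow c eta x <= g x * spike_narrow c eta x.
  have [cx|cx] := boolP (c - eta < x < c + eta); first by rewrite ler_wpM2r// geta.
  by rewrite /spike_narrow bump_eq0// mul0r !mulr0.
rewrite mulrBr; move: hx gx nx; clear; move: kappa^-1 => k' hx gx nx; lra.
Qed.

(** A representative may be large on a null set arbitrarily far out, so only a lower bound on a
    whole neighbourhood is excluded. *)
Lemma sobolev_decay (g : R -> R) (r : R) : sobolev_H1 g -> 0 < r ->
  exists T, forall c, T <= `|c| -> ~ (\forall t \near c, r <= g t).
Proof.
move=> [gL [h hL weak]] r0.
rewrite /reverse_coercion in weak.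
pose W : R := (bump_mass 0 1)^-1.
have W0 : 0 <= W by rewrite invr_ge0 ltW// bump_mass_gt0.
(* Over an interval of length [3] the constant term integrates to [r / 4]. With the tail at most
   [kappa * r / 2], the total is at most [3 * r / 4 < r]. *)
pose kappa := r / (6 * (1 + W)) / 2.
have k0 : 0 < kappa by rewrite !divr_gt0// mulr_gt0//; lra.
pose N x := h x ^+ 2 + W * g x ^+ 2.
have iN : mu.-integrable setT (EFin \o N).
  exact: (integrableD measurableT (Lfun2_integrable_sqr hL)
    (integrableZl measurableT W (Lfun2_integrable_sqr gL))).
have N0 x : 0 <= N x.
  by apply: addr_ge0; [exact: sqr_ge0|apply: mulr_ge0 => //; exact: sqr_ge0].
have eta0 : 0 < kappa * r / 2 by rewrite divr_gt0// mulr_gt0.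
have [n nP] := integrable_tail N0 iN eta0.
exists (n%:R + 3) => c nc near_c.
have := sobolev_lower_bound gL hL weak k0 near_c (erefl W).
pose E : set (measurableTypeR R) := `[c - 1, c + 2]%classic.
have mE : measurable E by exact: measurable_itv.
have EA : E `&` `[- n%:R, n%:R] = set0.
  have far (x : R) : c - 1 <= x <= c + 2 -> - n%:R <= x <= n%:R -> False.
    move=> /andP[x1 x2] /andP[x3 x4].
    by move: nc; rewrite ler_normr => /orP[nc|nc]; lra.
  by rewrite -subset0 => x [] /=; rewrite !in_itv; exact: far.
have := nP E mE EA; rewrite -/E -/W => tail.
have iNE : mu.-integrable E (EFin \o N) by exact: integrableS iN.
have ik : mu.-integrable E (EFin \o cst (kappa * (1 + W))).
  by apply: continuous_integrable => x; exact: cvg_cst.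
rewrite (RintegralD mE ik (integrableZl mE kappa^-1 iNE)) (RintegralZl kappa^-1 mE iNE).
rewrite (Rintegral_cst mu mE).
have -> : fine (mu E) = 3.
  rewrite /E lebesgue_measure_itv /= lte_fin ifT; last by lra.
  by rewrite -EFinB /=; ring.
have : kappa^-1 * \int[mu]_(x in E) N x <= r / 2.
  rewrite -(ler_pM2l k0) mulrA divff ?gt_eqF// mul1r mulrA//.
have -> : kappa * (1 + W) * 3 = r / 4 by rewrite /kappa; field; rewrite gt_eqF//; lra.
rewrite -/N; lra.
Qed.

End SobolevDecay.

(** * Smallness of the Hessian *)

Section Families.
Variables (R : realType) (k : nat).
Variable G : torus R k -> R -> 'cV[R]_2 -> R.
Implicit Types (l : torus R k) (t : R) (u v w : 'cV[R]_2).
Hypothesis G_C2 : Cn_family 2 (fun lambda (x : R * 'cV[R]_2) => G lambda x.1 x.2).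

(** The smoothness of [G] is stated jointly in [(t, u)], so derivatives in [u] are read as
    derivatives along [(0, v)]. *)
Definition dir (v : 'cV[R]_2) : R * 'cV[R]_2 := (0, v).

Definition fam l (x : R * 'cV[R]_2) : R := G l x.1 x.2.

Lemma derive_dir (f : R * 'cV[R]_2 -> R) t u v :
  'D_(dir v) f (t, u) = 'D_v (fun u => f (t, u)) u.
Proof.
have e : (fun h : R => h^-1 *: (f (h *: dir v + (t, u)) - f (t, u))) =
         (fun h : R => h^-1 *: (f (t, h *: v + u) - f (t, u))).
  by apply/funext => h; congr (_ *: (f _ - _)); congr pair; rewrite /= scaler0 add0r.
by rewrite /derive e.
Qed.

Definition grad (i : 'I_2) l (x : R * 'cV[R]_2) : R := 'D_(dir (delta_mx i 0)) (fam l) x.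

Lemma gradE i l t u : gradient (G l t) u i 0 = grad i l (t, u).
Proof. by rewrite mxE /grad (derive_dir (fam l)). Qed.

Definition hess (i j : 'I_2) l (x : R * 'cV[R]_2) : R := 'D_(dir (delta_mx j 0)) (grad i l) x.

Lemma hessE i j l t u : hessian (G l t) u i j = hess i j l (t, u).
Proof.
have e : 'D_(delta_mx i 0) (G l t) = (fun u => grad i l (t, u)).
  by apply/funext => u'; rewrite /grad (derive_dir (fam l)).
by rewrite mxE e /hess (derive_dir (grad i l)).
Qed.

Lemma grad_continuous i : continuous (fun p : torus R k * (R * 'cV[R]_2) => grad i p.1 p.2).
Proof. by case: G_C2 => _ [_ /(_ (dir (delta_mx i 0)))[]]. Qed.

Lemma grad_differentiable i l x : differentiable (grad i l) x.
Proof. by case: G_C2 => _ [_ /(_ (dir (delta_mx i 0)))[_ [h _]]]; exact: h. Qed.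

Lemma hess_continuous i j : continuous (fun p : torus R k * (R * 'cV[R]_2) => hess i j p.1 p.2).
Proof.
by case: G_C2 => _ [_ /(_ (dir (delta_mx i 0)))[_ [_ /(_ (dir (delta_mx j 0)))[h _]]]].
Qed.

Lemma fam_differentiable l x : differentiable (fam l) x.
Proof. by case: G_C2 => _ [h _]; exact: h. Qed.

Lemma derive_line (V : normedModType R) (f : V -> R) (x w : V) (s : R) :
  derivable f (s *: w + x) w -> is_derive s 1 (fun s : R => f (s *: w + x)) ('D_w f (s *: w + x)).
Proof.
have e : (fun h : R => h^-1 *: (f ((h *: 1 + s) *: w + x) - f (s *: w + x))) =
         (fun h : R => h^-1 *: (f (h *: w + (s *: w + x)) - f (s *: w + x))).
  by apply/funext => h; rewrite -[h *: 1]/(h * 1) mulr1 scalerDl addrA.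
move=> df; apply: DeriveDef; last by rewrite /derive e.
by rewrite /derivable e.
Qed.

Lemma cV2_sum (w : 'cV[R]_2) : w = w 0 0 *: delta_mx 0 0 + w 1 0 *: delta_mx 1 0.
Proof.
apply/matrixP => i j; rewrite !mxE !ord1 /=.
have [->|] := eqVneq i 0; first by rewrite eqxx /= mulr1 mulr0 addr0.
case: i => -[|[|//]] //= h _.
have -> : Ordinal h = 1 by exact: val_inj.
by rewrite /= mulr0 add0r mulr1.
Qed.

Lemma le_mx_norm m n (A : 'M[R]_(m.+1, n.+1)) i j : `|A i j| <= `|A|.
Proof.
by rewrite [leRHS]/Num.Def.normr /= mx_normrE; apply/bigmax_geP; right; exists (i, j).
Qed.

(** Mean value argument on the segment from [v] to [u], which stays in the ball by convexity. *)
Lemma grad_lip (eps delta : R) l t i :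
  (forall j u, `|u| <= delta -> `|hess i j l (t, u)| <= eps) ->
  forall u v, `|u| <= delta -> `|v| <= delta ->
  `|grad i l (t, u) - grad i l (t, v)| <= eps * (`|u 0 0 - v 0 0| + `|u 1 0 - v 1 0|).
Proof.
move=> hb u v ud vd; pose w := u - v.
have dd x : derivable (grad i l) x (dir w).
  by apply: diff_derivable; exact: grad_differentiable.
have line (s : R) : is_derive s 1 (fun s : R => grad i l (s *: dir w + (t, v))) ('D_(dir w) (grad i l) (s *: dir w + (t, v))).
  exact: derive_line.
pose C := eps * (`|u 0 0 - v 0 0| + `|u 1 0 - v 1 0|).
have := @derive_norm_le R (fun s : R => grad i l (s *: dir w + (t, v))) (fun s => s * C)
  (fun s => 'D_(dir w) (grad i l) (s *: dir w + (t, v))) (cst C) 0 1 ler01.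
rewrite mul1r mul0r subr0 scale0r add0r scale1r => h.
have e1 : dir w + (t, v) = (t, u).
  by rewrite /dir /w; congr pair; rewrite /= ?add0r// subrK.
rewrite -e1; apply: h => s /andP[s0 s1].
  apply: is_derive_ext (is_deriveZ C (is_derive_id s 1)) _ _.
    by move=> y; rewrite mulrC.
  by rewrite -[_ *: _]/(_ * _) mulr1.
have xE : s *: dir w + (t, v) = (t, s *: w + v) by rewrite /dir; congr pair; rewrite /= scaler0 add0r.
have u'd : `|s *: w + v| <= delta.
  have -> : s *: w + v = s *: u + (1 - s) *: v.
    by rewrite /w scalerBr scalerBl scale1r -addrA [- _ + v]addrC.
  apply: (le_trans (ler_normD _ _)); rewrite !normrZ ger0_norm// ger0_norm ?subr_ge0//.
  have := ler_wpM2l s0 ud; have : (1 - s) * `|v| <= (1 - s) * delta by rewrite ler_wpM2l// subr_ge0.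
  lra.
rewrite xE; set u' := s *: w + v in u'd *.
rewrite deriveE; last exact: grad_differentiable.
have -> : dir w = w 0 0 *: dir (delta_mx 0 0) + w 1 0 *: dir (delta_mx 1 0).
  by rewrite {1}(cV2_sum w) /dir; congr pair; rewrite /= !scaler0 addr0.
rewrite linearD !linearZ /= -!deriveE; try exact: grad_differentiable.
rewrite -/(hess i 0 l (t, u')) -/(hess i 1 l (t, u')).
have := hb 0 u' u'd; have := hb 1 u' u'd.
move: (hess i 0 l (t, u')) (hess i 1 l (t, u')) => p q hq hp.
rewrite -[w 0 0 *: p]/(w 0 0 * p) -[w 1 0 *: q]/(w 1 0 * q).
have w0 : w 0 0 = u 0 0 - v 0 0 by rewrite !mxE.
have w1 : w 1 0 = u 1 0 - v 1 0 by rewrite !mxE.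
rewrite {}w0 {}w1 /= /C; move: (u 0 0 - v 0 0) (u 1 0 - v 1 0) => x y.
apply: (le_trans (ler_normD _ _)); rewrite (normrM x p) (normrM y q) mulrDr.
by rewrite lerD// mulrC ler_wpM2r.
Qed.

Hypothesis G_growth : exists (p C : R) (g : R -> R),
     [/\ 0 < p, 0 <= C, sobolev_H1 g &
         forall lambda t u,
           `|hessian (G lambda t) u| <= g t + C * `|u| `^ p].
Hypothesis G_hess0 : forall l t, hessian (G l t) 0 = 0.

(** For large times, an entry above [eps / 2 + C * |u|^p] would stay above it nearby by continuity
    and force [g >= eps / 2] on a neighbourhood of [t]. For bounded times, the Hessian vanishes at
    [u = 0] and compactness makes this uniform. *)
Lemma hess_small (lam : R -> torus R k) (eps : R) : continuous lam -> 0 < eps ->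
  exists2 delta, 0 < delta & forall th t u i j, -1 <= th <= 1 -> `|u| <= delta ->
    `|hess i j (lam th) (t, u)| <= eps.
Proof.
move=> clam e0; have [p [C [g [p0 C0 gH bound]]]] := G_growth.
have e20 : 0 < eps / 2 by rewrite divr_gt0.
have [T TP] := sobolev_decay gH e20.
have tail l t u i j : T <= `|t| -> `|hess i j l (t, u)| <= eps / 2 + C * `|u| `^ p.
  move=> Tt; rewrite leNgt; apply/negP => lt; apply: (TP t Tt).
  have ct : continuous (fun s => `|hess i j l (s, u)|).
    move=> s; apply: cvg_norm.
    apply: (@continuous_comp _ _ _ (fun s => (l, (s, u))) (fun p : torus R k * (R * 'cV[R]_2) => hess i j p.1 p.2)); last exact: hess_continuous.
    apply: (@continuous_pair _ _ _ (cst l) (fun s => (s, u))) => [?|]; first exact: cvg_cst.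
    by apply: (@continuous_pair _ _ _ id (cst u)) => ?; [exact: cvg_id|exact: cvg_cst].
  have := ct t; move=> /(cvgr_gt _) /(_ _ lt); apply: filterS => s hs.
  have hn : `|hess i j l (s, u)| <= `|hessian (G l s) u| by rewrite -hessE; exact: le_mx_norm.
  have := lt_le_trans hs (le_trans hn (bound l s u)).
  by rewrite ltrD2r => /ltW.
(* Chosen so that [C * d1^p <= eps / 2]; [C + 1] avoids a division by zero when [C = 0]. *)
pose d1 := (eps / (2 * (C + 1))) `^ p^-1.
have C1 : 0 < C + 1 by lra.
have d10 : 0 < d1 by rewrite powR_gt0// divr_gt0// mulr_gt0.
have small u : `|u| <= d1 -> C * `|u| `^ p <= eps / 2.
  move=> ud; have : `|u| `^ p <= eps / (2 * (C + 1)).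
    have := @ge0_ler_powR R p (ltW p0) _ _ (_ : `|u| \in Num.nneg) (_ : d1 \in Num.nneg) ud.
    rewrite !nnegrE normr_ge0 ltW// => /(_ isT isT) h; apply: (le_trans h).
    by rewrite /d1 -powRrM mulVf ?gt_eqF// powRr1// ltW// divr_gt0// mulr_gt0.
  move=> h; apply: (@le_trans _ _ ((C + 1) * (eps / (2 * (C + 1))))).
    by apply: ler_pM => //; rewrite ?powR_ge0 ?lerDl.
  by rewrite le_eqVlt; apply/orP; left; apply/eqP; field; rewrite gt_eqF.
have : compact (`[(-1 : R), 1] `*` `[- T, T]).
  by apply: compact_setX; exact: segment_compact.
move=> /compact_near_coveringP.
move=> /(_ 'cV[R]_2 (nbhs (0 : 'cV[R]_2)) (fun u q => forall i j, `|hess i j (lam q.1) (q.2, u)| <= eps) _) near_cpt.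
have {}near_cpt : \forall u \near (0 : 'cV[R]_2), (`[(-1 : R), 1] `*` `[- T, T]) `<=`
    (fun q => forall i j, `|hess i j (lam q.1) (q.2, u)| <= eps).
  apply: near_cpt => -[th t] _.
  have c i j : continuous (fun z : (R * R) * 'cV[R]_2 => hess i j (lam z.1.1) (z.1.2, z.2)).
    move=> z; apply: (@continuous_comp _ _ _ (fun z : (R * R) * 'cV[R]_2 => (lam z.1.1, (z.1.2, z.2)))
      (fun p : torus R k * (R * 'cV[R]_2) => hess i j p.1 p.2)); last exact: hess_continuous.
    apply: (@continuous_pair _ _ _ (fun z : (R * R) * 'cV[R]_2 => lam z.1.1) (fun z : (R * R) * 'cV[R]_2 => (z.1.2, z.2))).
      move=> y; apply: (@continuous_comp _ _ _ (fun z : (R * R) * 'cV[R]_2 => z.1.1) lam); last exact: clam.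
      by apply: (@continuous_comp _ _ _ fst fst); exact: cvg_fst.
    apply: continuous_pair => y; last exact: cvg_snd.
    by apply: (@continuous_comp _ _ _ fst snd); [exact: cvg_fst|exact: cvg_snd].
  have hz i j : hess i j (lam th) (t, 0) = 0 by rewrite -hessE G_hess0 mxE.
  suff : \forall z \near ((th, t), (0 : 'cV[R]_2)), forall i j, `|hess i j (lam z.1.1) (z.1.2, z.2)| <= eps.
    by apply: filterS => -[].
  pose F := nbhs ((th, t), (0 : 'cV[R]_2)).
  have FF : Filter F by exact: nbhs_filter.
  apply: (@filter_forall _ _ (fun (i : 'I_2) z => forall j, `|hess i j (lam z.1.1) (z.1.2, z.2)| <= eps) F FF) => i.
  apply: (@filter_forall _ _ (fun (j : 'I_2) z => `|hess i j (lam z.1.1) (z.1.2, z.2)| <= eps) F FF) => j.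
  have /cvgrPdist_le/(_ _ e0) := c i j ((th, t), 0).
  by apply: filterS => z /=; rewrite hz sub0r normrN.
have /nbhs_ballP[d2 /= d20 d2P] := near_cpt.
exists (Num.min d1 (d2 / 2)); first by rewrite lt_min d10 divr_gt0.
move=> th t u i j th1; rewrite le_min => /andP[u1 u2].
have [Tt|Tt] := leP T `|t|.
  by have := tail (lam th) t u i j Tt; have := small _ u1; lra.
apply: (d2P u _ (th, t)) => /=.
- by rewrite -ball_normE /= sub0r normrN; lra.
- by split; rewrite /= in_itv//=; rewrite -ler_norml ltW.
Qed.

End Families.

(** * Homoclinic solutions by shooting *)

Section Gluing.
Variable R : realType.
Implicit Types (t th : R).

Local Notation pos := (Num.max (0 : R)).

Section ContinuousOperations.
Variable X : topologicalType.
Implicit Types f g : X -> R.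

Lemma continuous_add f g : continuous f -> continuous g -> continuous (fun x => f x + g x).
Proof. by move=> cf cg x; apply: cvgD; [exact: cf|exact: cg]. Qed.

Lemma continuous_opp f : continuous f -> continuous (fun x => - f x).
Proof. by move=> cf x; apply: cvgN; exact: cf. Qed.

Lemma continuous_sub f g : continuous f -> continuous g -> continuous (fun x => f x - g x).
Proof. by move=> cf cg; apply: continuous_add => //; exact: continuous_opp. Qed.

Lemma continuous_mul f g : continuous f -> continuous g -> continuous (fun x => f x * g x).
Proof. by move=> cf cg x; apply: cvgM; [exact: cf|exact: cg]. Qed.

Lemma continuous_compose (Y Z : topologicalType) (f : Y -> Z) (g : X -> Y) :
  continuous f -> continuous g -> continuous (fun x => f (g x)).
Proof. by move=> cf cg x; apply: continuous_comp; [exact: cg|exact: cf]. Qed.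

End ContinuousOperations.

Lemma continuous_fst (X Y : topologicalType) : continuous (@fst X Y).
Proof. by move=> x; exact: cvg_fst. Qed.

Lemma continuous_snd (X Y : topologicalType) : continuous (@snd X Y).
Proof. by move=> x; exact: cvg_snd. Qed.

Lemma continuous_id (X : topologicalType) : continuous (fun x : X => x).
Proof. by move=> x; exact: cvg_id. Qed.

Lemma continuous_cst (X Y : topologicalType) (y : Y) : continuous (fun _ : X => y).
Proof. by move=> x; exact: cvg_cst. Qed.

(** Time is reversed in [ul]. Derivatives are known only away from [0], so both pieces are
    identified with [ur 0 + prim q] by a limit at [0]; the derivative of the primitive then covers
    [t = 0]. *)
Lemma derive_glue (ul ur q : R -> R) :
  continuous ul -> continuous ur -> continuous q -> ul 0 = ur 0 ->
  (forall t, 0 < t -> is_derive t 1 ur (q t)) ->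
  (forall t, 0 < t -> is_derive t 1 ul (- q (- t))) ->
  forall t, is_derive t 1 (fun t => ur (pos t) + ul (pos (- t)) - ur 0) (q t).
Proof.
move=> cl cr cq l0 dr dl.
have lim0 (v w : R -> R) t : continuous v -> continuous w -> 0 <= t ->
    (forall s, 0 < s -> s <= t -> v t - v s = w t - w s) -> v t - v 0 = w t - w 0.
  move=> cv cw; rewrite le_eqVlt => /predU1P[<- _|t0 h]; first by rewrite !subrr.
  apply/eqP; rewrite -subr_eq0; apply/eqP.
  pose d s := v t - v s - (w t - w s).
  have cd : continuous d.
    by apply: continuous_sub; apply: continuous_sub => //; exact: continuous_cst.
  have c1 : d s @[s --> 0^'+] --> d 0 by apply: cvg_at_right_filter; exact: cd.
  have c2 : d s @[s --> 0^'+] --> 0.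
    apply: cvg_near_cst; near=> s; apply/eqP; rewrite subr_eq0; apply/eqP; apply: h => //.
    by apply/ltW; near: s; exact: nbhs_right_lt.
  exact: (@cvg_unique _ _ _ _ _ _ c1 c2).
have rE t : 0 <= t -> ur t = ur 0 + prim q t.
  move=> t0; have := @lim0 ur (prim q) t cr (prim_continuous cq) t0; rewrite prim0 => h.
  rewrite addrC; apply/eqP; rewrite -subr_eq -[prim q t]subr0; apply/eqP; apply: h => s s0 st.
  apply: derive_eq st _ _ => x /andP[sx xt]; last exact: prim_derive.
  by apply: dr; exact: lt_le_trans sx.
have cpN : continuous (fun t => prim q (- t)).
  by apply: continuous_compose; [exact: prim_continuous|exact: opp_continuous].
have lE t : 0 <= t -> ul t = ur 0 + prim q (- t).
  move=> t0; have := @lim0 ul (fun t => prim q (- t)) t cl cpN t0; rewrite /= oppr0 prim0 => h.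
  rewrite addrC; apply/eqP; rewrite -subr_eq -[prim q (- t)]subr0 -l0; apply/eqP; apply: h => s s0 st.
  apply: (@derive_eq _ ul (fun t => prim q (- t)) (fun t => - q (- t)) s t st) => x /andP[sx xt].
    by apply: dl; exact: lt_le_trans sx.
  have := @is_derive1_comp _ (prim q) -%R x _ _ (prim_derive (- x) cq) (is_deriveN (is_derive_id x 1)).
  by rewrite mulrN1.
move=> t; apply: is_derive_ext (is_deriveD (is_derive_cst (ur 0) t 1) (prim_derive t cq)) _ _; last by rewrite add0r.
move=> s /=; have [s0|s0] := leP 0 s.
  by rewrite max_l ?oppr_le0// l0 (rE s s0) addrK.
by rewrite max_r ?oppr_ge0 ?ltW// lE ?oppr_ge0 ?ltW// opprK addrAC subrr add0r.
Unshelve. all: end_near. Qed.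

End Gluing.

Section Shooting.
Variable R : realType.
Local Notation pos := (Num.max (0 : R)).

Lemma abs_mul_le1 (c x : R) : `|c| <= 1 -> `|c * x| <= `|x|.
Proof. by move=> c1; rewrite normrM ler_piMl. Qed.

Lemma rotation_norm_le (c s x y : R) : `|c| <= 1 -> `|s| <= 1 ->
  `|c * x - s * y| + `|s * x + c * y| <= 2 * (`|x| + `|y|).
Proof.
move=> c1 s1.
have := ler_normB (c * x) (s * y); have := ler_normD (s * x) (c * y).
have := abs_mul_le1 x c1; have := abs_mul_le1 x s1.
have := abs_mul_le1 y c1; have := abs_mul_le1 y s1.
lra.
Qed.

(* On the right half-line, rotating the plane by half the angle [th] turns the
   linear part into [(x, y) |-> (- atan t * x, atan t * y)]. There the decaying
   solution starting at the end point [(a, tau)] of the left decaying solution is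
   sought; its mismatch [F th] in the growing coordinate has opposite signs at
   [th0] and [- th0]. *)
Lemma shooting (g0 g1 : R * R -> R * R -> R) (a eps th0 : R) :
  0 < a -> 0 <= eps -> 0 < th0 -> 72 * expR pi * eps < sin (th0 / 2) ->
  continuous (fun z : (R * R) * (R * R) => g0 z.1 z.2) ->
  continuous (fun z : (R * R) * (R * R) => g1 z.1 z.2) ->
  (forall q, g0 q (0, 0) = 0) -> (forall q, g1 q (0, 0) = 0) ->
  (forall q u v, `|g0 q u - g0 q v| <= eps * (`|u.1 - v.1| + `|u.2 - v.2|)) ->
  (forall q u v, `|g1 q u - g1 q v| <= eps * (`|u.1 - v.1| + `|u.2 - v.2|)) ->
  exists th (u0 u1 : R -> R), [/\ `|th| <= th0, u0 0 = a, continuous u0 /\ continuous u1,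
    (forall t, `|u0 t| + `|u1 t| <= 8 * a * xweight `|t|) &
    forall t, let p := atan (pos t) in let m := - atan (pos (- t)) in
      is_derive t 1 u0 (- (m + p * cos th) * u0 t - p * sin th * u1 t - g1 (th, t) (u0 t, u1 t)) /\
      is_derive t 1 u1 (- p * sin th * u0 t + (m + p * cos th) * u1 t + g0 (th, t) (u0 t, u1 t))].
Proof.
move=> a0 e0 th00 small cg0 cg1 z0 z1 l0 l1.
have pi1 : 1 <= expR (pi : R) by rewrite -expR0 ler_expR pi_ge0.
have sin1 := sin_le1 (th0 / 2).
have eM : 0 <= expR (pi : R) * eps by rewrite mulr_ge0// expR_ge0.
have M8 : 8 * (expR pi * eps) <= 1 / 9 by move: small sin1; rewrite -mulrA; lra.
pose shift (z : (R * R) * (R * R)) := ((z.1.1, - z.1.2), z.2).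
have cshift : continuous shift.
  apply: continuous_pair; last exact: continuous_snd.
  apply: continuous_pair; first exact: (continuous_compose (@continuous_fst _ _) (@continuous_fst _ _)).
  apply: continuous_opp; exact: (continuous_compose (@continuous_snd _ _) (@continuous_fst _ _)).
have epsM : 4 * expR pi * eps <= 4^-1 by rewrite -mulrA; lra.
(* The left half-line in reversed time: there [u0] is the decaying and [u1] the growing coordinate,
   driven by [g1] and [- g0]. *)
have [|||||||||||uL [cuL bL iL dL]] := @halfline_solution R R (cst a) a eps
  (fun q u => g1 (q.1, - q.2) u) (fun q u => - g0 (q.1, - q.2) u).
- exact: continuous_cst.
- by move=> q; rewrite ger0_norm// ltW.
- exact: ltW.
- exact: e0.
- exact: epsM.
- exact: (continuous_compose cg1 cshift).
- apply: continuous_opp; exact: (continuous_compose cg0 cshift).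
- by move=> q; exact: z1.
- by move=> q; rewrite z0 oppr0.
- by move=> q u v; exact: l1.
- by move=> q u v; rewrite -opprD normrN; exact: l0.
pose c th := cos (th / 2) : R; pose s th := sin (th / 2) : R.
have half_cont : continuous (fun th : R => th / 2).
  by apply: continuous_mul; [exact: continuous_id|exact: continuous_cst].
have cc : continuous c by exact: (continuous_compose (@continuous_cos R) half_cont).
have cs : continuous s by exact: (continuous_compose (@continuous_sin R) half_cont).
have c1 th : `|c th| <= 1 by rewrite ler_norml cos_geN1 cos_le1.
have s1 th : `|s th| <= 1 by rewrite ler_norml sin_geN1 sin_le1.
have cs1 th : c th ^+ 2 + s th ^+ 2 = 1 by rewrite cos2Dsin2.
pose tau th := (uL (th, 0)).2.
have ctau : continuous tau.
  apply: (continuous_compose (@continuous_snd _ _)); apply: (continuous_compose cuL).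
  by apply: continuous_pair; [exact: continuous_id|exact: continuous_cst].
have taub th : `|tau th| <= 8 * (expR pi * eps) * a.
  by have [_] := iL th; rewrite /tau; congr (_ <= _); ring.
have tau1 th : `|tau th| <= a.
  apply: (le_trans (taub th)); rewrite -[leRHS]mul1r; apply: ler_wpM2r; [exact: ltW|lra].
pose aR th := a * c th + tau th * s th.
have caR : continuous aR.
  apply: continuous_add; apply: continuous_mul => //; exact: continuous_cst.
have aRb th : `|aR th| <= 2 * a.
  apply: (le_trans (ler_normD _ _)); rewrite [a * _]mulrC [tau th * _]mulrC.
  have := abs_mul_le1 a (c1 th); have := abs_mul_le1 (tau th) (s1 th); have := tau1 th.
  by rewrite (gtr0_norm a0); lra.
pose rot (q u : R * R) := (c q.1 * u.1 - s q.1 * u.2, s q.1 * u.1 + c q.1 * u.2).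
(* The rotation costs a factor [2] in the sum norm, and mixing [g0] with [g1] another [2]. *)
have lipR (al be : R) q u v : `|al| <= 1 -> `|be| <= 1 ->
    `|(al * g1 q (rot q u) + be * g0 q (rot q u)) - (al * g1 q (rot q v) + be * g0 q (rot q v))| <=
    4 * eps * (`|u.1 - v.1| + `|u.2 - v.2|).
  move=> al1 be1; set G1 := g1 q; set G0 := g0 q.
  have -> : (al * G1 (rot q u) + be * G0 (rot q u)) - (al * G1 (rot q v) + be * G0 (rot q v)) =
    al * (G1 (rot q u) - G1 (rot q v)) + be * (G0 (rot q u) - G0 (rot q v)) by ring.
  have := abs_mul_le1 (G1 (rot q u) - G1 (rot q v)) al1.
  have := abs_mul_le1 (G0 (rot q u) - G0 (rot q v)) be1.
  have := l0 q (rot q u) (rot q v); have := l1 q (rot q u) (rot q v).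
  have r : `|(rot q u).1 - (rot q v).1| + `|(rot q u).2 - (rot q v).2| <= 2 * (`|u.1 - v.1| + `|u.2 - v.2|).
    have e1 : (rot q u).1 - (rot q v).1 = c q.1 * (u.1 - v.1) - s q.1 * (u.2 - v.2) by rewrite /=; ring.
    have e2 : (rot q u).2 - (rot q v).2 = s q.1 * (u.1 - v.1) + c q.1 * (u.2 - v.2) by rewrite /=; ring.
    by rewrite e1 e2; exact: rotation_norm_le.
  move: (ler_wpM2l e0 r); rewrite -/G1 -/G0.
  set D := _ + _ => hD h1 h2 h3 h4; apply: (le_trans (ler_normD _ _)); move: h4 h3 h2 h1 hD; clear.
  lra.
have crot : continuous (fun z : (R * R) * (R * R) => rot z.1 z.2).
  have k1 (f : R -> R) : continuous f -> continuous (fun z : (R * R) * (R * R) => f z.1.1).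
    by move=> cf; apply: (continuous_compose cf); exact: (continuous_compose (@continuous_fst _ _) (@continuous_fst _ _)).
  have k2 : continuous (fun z : (R * R) * (R * R) => z.2.1).
    exact: (continuous_compose (@continuous_fst _ _) (@continuous_snd _ _)).
  have k3 : continuous (fun z : (R * R) * (R * R) => z.2.2).
    exact: (continuous_compose (@continuous_snd _ _) (@continuous_snd _ _)).
  apply: continuous_pair; [apply: continuous_sub|apply: continuous_add]; apply: continuous_mul => //; exact: k1.
have cR (g : R * R -> R * R -> R) (al : R -> R) : continuous al ->
    continuous (fun z : (R * R) * (R * R) => g z.1 z.2) ->
    continuous (fun z : (R * R) * (R * R) => al z.1.1 * g z.1 (rot z.1 z.2)).
  move=> cal cg; apply: continuous_mul.
    by apply: (continuous_compose cal); exact: (continuous_compose (@continuous_fst _ _) (@continuous_fst _ _)).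
  apply: (@continuous_compose _ _ _ (fun z : (R * R) * (R * R) => g z.1 z.2) (fun z => (z.1, rot z.1 z.2))) => //.
  by apply: continuous_pair; [exact: continuous_fst|exact: crot].
have rot0 q : rot q (0, 0) = (0, 0) by rewrite /rot /= !mulr0 subr0 addr0.
have N1 (x : R) : `|x| <= 1 -> `|- x| <= 1 by rewrite normrN.
have epsM4 : 4 * expR pi * (4 * eps) <= 4^-1.
  by rewrite (_ : 4 * expR pi * (4 * eps) = 16 * (expR pi * eps)); [lra|ring].
have [|||||||||||uR [cuR bR iR dR]] := @halfline_solution R R aR (2 * a) (4 * eps)
  (fun q u => - c q.1 * g1 q (rot q u) + s q.1 * g0 q (rot q u))
  (fun q u => s q.1 * g1 q (rot q u) + c q.1 * g0 q (rot q u)).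
- exact: caR.
- exact: aRb.
- by rewrite mulr_ge0// ltW.
- by rewrite mulr_ge0.
- exact: epsM4.
- by apply: continuous_add; [apply: (cR _ (fun x => - c x)) => //; exact: continuous_opp|exact: cR].
- by apply: continuous_add; exact: cR.
- by move=> q; rewrite rot0 z0 z1 !mulr0 !addr0.
- by move=> q; rewrite rot0 z0 z1 !mulr0 !addr0.
- by move=> q u v; apply: lipR => //; exact: N1.
- by move=> q u v; exact: lipR.
pose F th := (- (a * s th) + tau th * c th) - (uR (th, 0)).2.
have cF : continuous F.
  apply: continuous_sub.
    apply: continuous_add; last exact: continuous_mul.
    by apply: continuous_opp; apply: continuous_mul => //; exact: continuous_cst.
  apply: (continuous_compose (@continuous_snd _ _)); apply: (continuous_compose cuR).
  by apply: continuous_pair; [exact: continuous_id|exact: continuous_cst].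
(* The left endpoint contributes [8 * expR pi * eps * a]. The right graph, with Lipschitz constant
   [4 * eps] and initial value up to [2 * a], contributes [64 * expR pi * eps * a]. *)
have Fb th : `|F th + a * s th| <= 72 * expR pi * eps * a.
  have -> : F th + a * s th = tau th * c th - (uR (th, 0)).2 by rewrite /F; ring.
  have h1 := abs_mul_le1 (tau th) (c1 th); rewrite mulrC in h1.
  have [_ h2] := iR th; have := le_trans (ler_normB (tau th * c th) (uR (th, 0)).2) (lerD h1 h2).
  move/le_trans; apply; have := taub th.
  rewrite (_ : 2 * (4 * expR pi) * (4 * eps) * (2 * a) = 64 * (expR pi * eps) * a); last ring.
  by rewrite (_ : 72 * expR pi * eps * a = 72 * (expR pi * eps) * a); [lra|ring].
have [th thin Fth] : exists2 th, th \in `[- th0, th0] & F th = 0.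
  apply: IVT; first by lra.
    exact: continuous_subspaceT.
  have h : 72 * expR pi * eps * a < a * s th0 by rewrite mulrC ltr_pM2l.
  have h1 := Fb th0; have h2 := Fb (- th0).
  have sN : s (- th0) = - s th0 by rewrite /s mulNr sinN.
  rewrite sN mulrN in h2.
  rewrite ge_min le_max; apply/andP; split; apply/orP.
    by right; move: h1; rewrite ler_norml; lra.
  by left; move: h2; rewrite ler_norml; lra.
exists th.
pose C := c th; pose S := s th; pose x t := (uR (th, t)).1; pose y t := (uR (th, t)).2.
have cx : continuous x.
  apply: (continuous_compose (@continuous_fst _ _)); apply: (continuous_compose cuR).
  by apply: continuous_pair; [exact: continuous_cst|exact: continuous_id].
have cy : continuous y.
  apply: (continuous_compose (@continuous_snd _ _)); apply: (continuous_compose cuR).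
  by apply: continuous_pair; [exact: continuous_cst|exact: continuous_id].
pose ur0 t := C * x t - S * y t; pose ur1 t := S * x t + C * y t.
pose ul0 t := (uL (th, t)).1; pose ul1 t := (uL (th, t)).2.
have cl0 : continuous ul0.
  apply: (continuous_compose (@continuous_fst _ _)); apply: (continuous_compose cuL).
  by apply: continuous_pair; [exact: continuous_cst|exact: continuous_id].
have cl1 : continuous ul1.
  apply: (continuous_compose (@continuous_snd _ _)); apply: (continuous_compose cuL).
  by apply: continuous_pair; [exact: continuous_cst|exact: continuous_id].
have cr0 : continuous ur0 by apply: continuous_sub; apply: continuous_mul => //; exact: continuous_cst.
have cr1 : continuous ur1 by apply: continuous_add; apply: continuous_mul => //; exact: continuous_cst.
have CS1 : C ^+ 2 + S ^+ 2 = 1 by exact: cs1.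
have C2 : C ^+ 2 = 1 - S ^+ 2 by rewrite -CS1 addrK.
have x0 : x 0 = a * C + tau th * S by have [] := iR th.
have y0 : y 0 = - (a * S) + tau th * C by apply/eqP; rewrite -subr_eq0 -oppr_eq0 opprB; apply/eqP.
have l0a : ul0 0 = a by have [] := iL th.
have r0a : ur0 0 = a.
  rewrite /ur0 x0 y0; have -> : C * (a * C + tau th * S) - S * (- (a * S) + tau th * C) = a * (C ^+ 2 + S ^+ 2) by ring.
  by rewrite CS1 mulr1.
have lr0 : ul0 0 = ur0 0 by rewrite r0a.
have lr1 : ul1 0 = ur1 0.
  rewrite /ur1 x0 y0; have -> : S * (a * C + tau th * S) + C * (- (a * S) + tau th * C) = tau th * (C ^+ 2 + S ^+ 2) by ring.
  by rewrite CS1 mulr1.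
pose u0 t := ur0 (pos t) + ul0 (pos (- t)) - ur0 0.
pose u1 t := ur1 (pos t) + ul1 (pos (- t)) - ur1 0.
have cposN : continuous (fun t : R => pos (- t)).
  by apply: (continuous_compose (@max0_continuous R)); exact: opp_continuous.
have cu0 : continuous u0.
  apply: continuous_sub; last exact: continuous_cst.
  by apply: continuous_add; [apply: (continuous_compose cr0); exact: max0_continuous|exact: continuous_compose].
have cu1 : continuous u1.
  apply: continuous_sub; last exact: continuous_cst.
  by apply: continuous_add; [apply: (continuous_compose cr1); exact: max0_continuous|exact: continuous_compose].
have uR0 t : 0 <= t -> (u0 t = ur0 t) * (u1 t = ur1 t).
  by move=> t0; rewrite /u0 /u1 (max_r t0) max_l ?oppr_le0// lr0 lr1 !addrK.
have uL0 t : 0 <= t -> (u0 (- t) = ul0 t) * (u1 (- t) = ul1 t).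
  by move=> t0; rewrite /u0 /u1 opprK (max_r t0) max_l ?oppr_le0// ![_ + ul0 _]addrC ![_ + ul1 _]addrC !addrK.
have u0a : u0 0 = a by rewrite (uR0 0 (lexx 0)).1.
exists u0, u1; split.
- by move: thin; rewrite in_itv /= ler_norml.
- exact: u0a.
- exact: conj.
- move=> t; have [t0|t0] := leP 0 t.
    rewrite (ger0_norm t0) !uR0//; have := rotation_norm_le (x t) (y t) (c1 th) (s1 th).
    have := bR (th, t); rewrite /= max_r// -/(x t) -/(y t) -/(ur0 t) -/(ur1 t).
    by rewrite (_ : 8 * a * xweight t = 2 * (2 * (2 * a) * xweight t)); [lra|ring].
  have N0 : 0 <= - t by rewrite oppr_ge0 ltW.
  have [e0' e1'] := uL0 _ N0; rewrite opprK in e0' e1'.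
  rewrite (ltr0_norm t0) e0' e1'; have := bL (th, - t); rewrite /= max_r//.
  have : 0 <= a * xweight (- t) by rewrite mulr_ge0 ?ltW// xweight_gt0.
  by rewrite -!mulrA /ul0 /ul1; lra.
move=> t p m.
have cp : continuous (fun t => atan (pos t)).
  by apply: (continuous_compose (@continuous_atan R)); exact: max0_continuous.
have cm : continuous (fun t => - atan (pos (- t))).
  by apply: continuous_opp; apply: (continuous_compose (@continuous_atan R)); exact: cposN.
have cmp : continuous (fun t => - atan (pos (- t)) + atan (pos t) * cos th).
  by apply: continuous_add => //; apply: continuous_mul => //; exact: continuous_cst.
have cps : continuous (fun t => - atan (pos t) * sin th).
  by apply: continuous_mul; [exact: continuous_opp|exact: continuous_cst].
have cgu (g : R * R -> R * R -> R) : continuous (fun z : (R * R) * (R * R) => g z.1 z.2) ->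
    continuous (fun t => g (th, t) (u0 t, u1 t)).
  move=> cg; apply: (@continuous_compose _ _ _ (fun z : (R * R) * (R * R) => g z.1 z.2) (fun t => ((th, t), (u0 t, u1 t)))) => //.
  apply: continuous_pair; last exact: continuous_pair.
  by apply: continuous_pair; [exact: continuous_cst|exact: continuous_id].
have cosE : cos th = C ^+ 2 - S ^+ 2.
  by rewrite {1}(splitr th) cosD -!expr2.
have sinE : sin th = 2 * (S * C).
  by rewrite {1}(splitr th) sinD mulr_natl mulr2n [C * _]mulrC.
pose q0 t := - (- atan (pos (- t)) + atan (pos t) * cos th) * u0 t - atan (pos t) * sin th * u1 t -
  g1 (th, t) (u0 t, u1 t).
pose q1 t := - atan (pos t) * sin th * u0 t + (- atan (pos (- t)) + atan (pos t) * cos th) * u1 t +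
  g0 (th, t) (u0 t, u1 t).
have cq0 : continuous q0.
  apply: continuous_sub; last exact: cgu.
  apply: continuous_sub; apply: continuous_mul => //; first exact: continuous_opp.
  by apply: continuous_mul => //; exact: continuous_cst.
have cq1 : continuous q1.
  apply: continuous_add; last exact: cgu.
  by apply: continuous_add; apply: continuous_mul.
have pR (r : R) : 0 < r -> (pos r = r) * (pos (- r) = 0).
  by move=> r0; split; [rewrite max_r// ltW|rewrite max_l// oppr_le0 ltW].
have rotE r : rot (th, r) (uR (th, r)) = (ur0 r, ur1 r) by [].
have qR0 (r : R) : 0 < r -> is_derive r 1 ur0 (q0 r).
  move=> r0; have [dx dy] := dR th r r0.
  apply: is_derive_ext (is_deriveB (is_deriveZ C dx) (is_deriveZ S dy)) _ _; first by [].
  rewrite rotE /q0 !(pR _ r0) !(uR0 _ (ltW r0)) atan0 -/(x r) -/(y r) cosE sinE.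
  rewrite -[C *: _]/(C * _) -[S *: _]/(S * _) /=.
  rewrite -[c th]/C -[s th]/S.
  move: (g1 _ _) (g0 _ _) => G1 G0; rewrite /ur0 /ur1. ring: C2.
have qR1 (r : R) : 0 < r -> is_derive r 1 ur1 (q1 r).
  move=> r0; have [dx dy] := dR th r r0.
  apply: is_derive_ext (is_deriveD (is_deriveZ S dx) (is_deriveZ C dy)) _ _; first by [].
  rewrite rotE /q1 !(pR _ r0) !(uR0 _ (ltW r0)) atan0 -/(x r) -/(y r) cosE sinE.
  rewrite -[C *: _]/(C * _) -[S *: _]/(S * _) /=.
  rewrite -[c th]/C -[s th]/S.
  move: (g1 _ _) (g0 _ _) => G1 G0; rewrite /ur0 /ur1. ring: C2.
have qL0 (r : R) : 0 < r -> is_derive r 1 ul0 (- q0 (- r)).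
  move=> r0; have [dv _] := dL th r r0.
  apply: is_derive_ext dv _ _; first by [].
  rewrite /q0 opprK !(pR _ r0) !(uL0 _ (ltW r0)) atan0 (surjective_pairing (uL (th, r))) /=; ring.
have qL1 (r : R) : 0 < r -> is_derive r 1 ul1 (- q1 (- r)).
  move=> r0; have [_ dv] := dL th r r0.
  apply: is_derive_ext dv _ _; first by [].
  rewrite /q1 opprK !(pR _ r0) !(uL0 _ (ltW r0)) atan0 (surjective_pairing (uL (th, r))) /=; ring.
split.
- exact: (derive_glue cl0 cr0 cq0 lr0 qR0 qL0).
- exact: (derive_glue cl1 cr1 cq1 lr1 qR1 qL1).
Qed.
End Shooting.

(** * Bifurcation *)

Section Vectors.
Variable R : realType.
Local Notation pos := (Num.max (0 : R)).
Implicit Types (u v w : 'cV[R]_2) (t : R).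

Definition col2 (a b : R) : 'cV[R]_2 := a *: delta_mx 0 0 + b *: delta_mx 1 0.

Lemma col2_0 a b : col2 a b 0 0 = a.
Proof. by rewrite !mxE /= mulr1 mulr0 addr0. Qed.

Lemma col2_1 a b : col2 a b 1 0 = b.
Proof. by rewrite !mxE /= mulr1 mulr0 add0r. Qed.

Lemma col2_norm a b : `|col2 a b| = Num.max `|a| `|b|.
Proof.
apply/eqP; rewrite eq_le; apply/andP; split; last first.
  have := le_mx_norm (col2 a b) 0 0; have := le_mx_norm (col2 a b) 1 0.
  by rewrite ge_max col2_0 col2_1 => -> ->.
rewrite [leLHS]/Num.Def.normr /= mx_normrE; apply/bigmax_leP; split=> [|[i j] _ /=].
  by rewrite le_max normr_ge0.
rewrite (ord1 j); case: i => -[|[|//]] /= h.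
  by rewrite (_ : Ordinal h = 0) ?col2_0 ?le_max ?lexx//; exact: val_inj.
by rewrite (_ : Ordinal h = 1) ?col2_1 ?le_max ?lexx ?orbT//; exact: val_inj.
Qed.

Lemma col2_norm_le a b : `|col2 a b| <= `|a| + `|b|.
Proof. by rewrite col2_norm ge_max lerDl lerDr !normr_ge0. Qed.

Lemma col2_continuous (X : topologicalType) (f g : X -> R) : continuous f -> continuous g ->
  continuous (fun x => col2 (f x) (g x)).
Proof. by move=> cf cg x; apply: cvgD; apply: cvgZr_tmp; [exact: cf|exact: cg]. Qed.

Lemma col2_is_derive (f g : R -> R) t (df dg : R) : is_derive t 1 f df -> is_derive t 1 g dg ->
  is_derive t 1 (fun s : R => col2 (f s) (g s)) (col2 df dg).
Proof.
move=> hf hg; pose q (f : R -> R) := fun h : R => h^-1 *: (f (h *: 1 + t) - f t).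
have cf : q f h @[h --> 0^'] --> df by rewrite -(derive_val (is_derive := hf)); exact: ex_derive.
have cg : q g h @[h --> 0^'] --> dg by rewrite -(derive_val (is_derive := hg)); exact: ex_derive.
have e : (fun h : R => h^-1 *: (col2 (f (h *: 1 + t)) (g (h *: 1 + t)) - col2 (f t) (g t))) =
    (fun h => col2 (q f h) (q g h)).
  by apply/funext => h; rewrite /col2 opprD addrACA -!scalerBl scalerDr !scalerA.
have c : h^-1 *: (col2 (f (h *: 1 + t)) (g (h *: 1 + t)) - col2 (f t) (g t)) @[h --> 0^'] --> col2 df dg.
  by rewrite e; apply: cvgD; apply: cvgZr_tmp.
by apply: DeriveDef; [apply/cvg_ex; exists (col2 df dg)|exact: cvg_lim].
Qed.

Lemma vanishes_xweight (u : R -> 'cV[R]_2) (K : R) :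
  (forall t, `|u t| <= K * xweight `|t|) -> vanishes_at_infinity u.
Proof.
move=> hu.
have tail e : 0 < e -> exists T, forall t, T < `|t| -> `|u t| <= e.
  move=> e0; have : K * xweight t @[t --> +oo] --> 0.
    by rewrite -(mulr0 K); apply: cvgM; [exact: cvg_cst|exact: xweight_cvg0].
  move=> /cvgr0Pnorm_le/(_ e e0)[T [_ hT]]; exists T => t Tt.
  by apply: (le_trans (hu t)); apply: (le_trans (ler_norm _)); exact: hT.
split; apply/cvgr0Pnorm_le => e e0; have [T hT] := tail e e0.
  near=> t; apply: hT; apply: lt_le_trans (ler_norm t).
  by near: t; exact: nbhs_pinfty_gt (num_real T).
near=> t; apply: hT; rewrite -normrN; apply: lt_le_trans (ler_norm (- t)).
by rewrite ltrNr; near: t; apply: nbhs_ninfty_lt; exact: num_real.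
Unshelve. all: end_near. Qed.

Lemma innerC u v : inner u v = inner v u.
Proof. by apply: eq_bigr => i _; rewrite mulrC. Qed.

Lemma innerDl u v w : inner (u + v) w = inner u w + inner v w.
Proof. by rewrite -big_split; apply: eq_bigr => i _; rewrite !mxE mulrDl. Qed.

Lemma innerZl (a : R) u w : inner (a *: u) w = a * inner u w.
Proof. by rewrite mulr_sumr; apply: eq_bigr => i _; rewrite !mxE mulrA. Qed.

Lemma inner_symmetric (A : 'M[R]_2) u v : A^T = A -> inner (A *m u) v = inner (A *m v) u.
Proof.
move=> sA.
have e (x y : 'cV[R]_2) : inner (A *m x) y = \sum_i \sum_j A i j * x j 0 * y i 0.
  by apply: eq_bigr => i _; rewrite mxE mulr_suml.
rewrite !e exchange_big; apply: eq_bigr => i _; apply: eq_bigr => j _.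
by rewrite -{1}sA mxE mulrAC.
Qed.

Lemma inner_delta u (i : 'I_2) : inner u (delta_mx i 0) = u i 0.
Proof.
rewrite /inner (bigD1 i)//= mxE !eqxx mulr1 big1 ?addr0// => j ji.
by rewrite mxE (negbTE ji) mulr0.
Qed.

(** By symmetry the difference quotient is exactly the claimed value plus [h] times the quadratic
    form at [w]. *)
Lemma quadratic_is_derive (A : 'M[R]_2) u w : A^T = A ->
  is_derive u w (fun u => 2^-1 * inner (A *m u) u) (inner (A *m u) w).
Proof.
move=> sA; pose q u := 2^-1 * inner (A *m u) u.
have e : {near 0^', (fun h : R => inner (A *m u) w + h * q w) =1 (fun h : R => h^-1 *: (q (h *: w + u) - q u))}.
  near=> h; have h0 : h != 0 by near: h; exact: nbhs_dnbhs_neq.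
  rewrite -[_ *: _]/(_ * _) /q mulmxDr -scalemxAr !innerDl !innerZl.
  rewrite ![inner _ (h *: w + u)]innerC !innerDl !innerZl.
  rewrite [inner u (A *m w)]innerC (inner_symmetric w u sA) [inner w (A *m u)]innerC.
  rewrite [inner u (A *m u)]innerC [inner w (A *m w)]innerC.
  by field.
have c : h^-1 *: (q (h *: w + u) - q u) @[h --> 0^'] --> inner (A *m u) w.
  apply: cvg_trans (near_eq_cvg e) _.
  have k : inner (A *m u) w + h * q w @[h --> (0 : R)^'] --> inner (A *m u) w + 0 * q w.
    by apply: cvgD; [exact: cvg_cst|apply: cvgM; [exact: cvg_within|exact: cvg_cst]].
  by rewrite mul0r addr0 in k.
by apply: DeriveDef; [apply/cvg_ex; exists (inner (A *m u) w)|exact: cvg_lim].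
Unshelve. all: end_near. Qed.

End Vectors.

Section Bifurcation.
Variables (R : realType) (k : nat).
Variable G : torus R k -> R -> 'cV[R]_2 -> R.
Local Notation pos := (Num.max (0 : R)).
Hypothesis G_C2 : Cn_family 2 (fun lambda (x : R * 'cV[R]_2) => G lambda x.1 x.2).

Lemma ord2_case (P : 'I_2 -> Prop) : P 0 -> P 1 -> forall i, P i.
Proof.
move=> p0 p1 [[|[|//]] h]; first by rewrite (_ : Ordinal h = 0)//; exact: val_inj.
by rewrite (_ : Ordinal h = 1)//; exact: val_inj.
Qed.

(** This is [p * J S_th + m * J S_0]. With [p = atan (max 0 t)] and [m = - atan (max 0 (- t))], one
    of which is zero at each time, it gives [A] for both signs of [t] with coefficients continuous
    across [0]. *)
Definition coefficient (p m th : R) : 'M[R]_2 := \matrix_(i, j)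
  (if i == j then (if i == 0 then - (p * sin th) else p * sin th) else m + p * cos th).

Lemma coefficient_sym p m th : (coefficient p m th)^T = coefficient p m th.
Proof. by apply/matrixP => i j; rewrite !mxE eq_sym; case: eqP => // ->. Qed.

Lemma mul_mx2 n (A : 'M[R]_2) (B : 'M[R]_(2, n)) i j : (A *m B) i j = A i 0 * B 0 j + A i 1 * B 1 j.
Proof. by rewrite mxE !big_ord_recl big_ord0 addr0; congr (_ + A i _ * B _ j); exact: val_inj. Qed.

Lemma Amx_coefficient (phi : 'I_k -> R) t :
  Amx (fun j => expi (phi j)) t =
  coefficient (atan (pos t)) (- atan (pos (- t))) (\sum_j phi j).
Proof.
rewrite Amx_expi; apply/matrixP => i j; have [t0|t0] := leP 0 t.
  rewrite [pos (- t)]max_l ?oppr_le0// atan0 oppr0.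
  by move: i j; apply: ord2_case; apply: ord2_case; rewrite mxE mul_mx2 !mxE /=; ring.
rewrite [pos (- t)]max_r ?oppr_ge0 ?ltW// atan0 atanN opprK.
by move: i j; apply: ord2_case; apply: ord2_case; rewrite mxE mul_mx2 !mxE /= ?cos0 ?sin0; ring.
Qed.

Lemma gradient_hamiltonian (phi : 'I_k -> R) t u (l := (fun j => expi (phi j)) : torus R k) :
  gradient (hamiltonian G l t) u = Amx l t *m u + \col_i grad G i l (t, u).
Proof.
apply/matrixP => i j; rewrite (ord1 j) !mxE /hamiltonian.
have sA : (Amx l t)^T = Amx l t by rewrite Amx_coefficient coefficient_sym.
have dq := quadratic_is_derive u (delta_mx i 0) sA.
have dG : derivable (G l t) u (delta_mx i 0).
  have := @diff_derivable _ _ _ (fam G l) (t, u) (dir (delta_mx i 0)) (fam_differentiable G_C2 l (t, u)).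
  rewrite /derivable.
  have e : (fun h : R => h^-1 *: (fam G l (h *: dir (delta_mx i 0) + (t, u)) - fam G l (t, u))) =
     (fun h : R => h^-1 *: (G l t (h *: delta_mx i 0 + u) - G l t u)).
    apply/funext => h; have -> : h *: dir (delta_mx i 0) + (t, u) = (t, h *: delta_mx i 0 + u); last by [].
    by rewrite /dir; congr pair; rewrite /= scaler0 add0r.
  by rewrite e.
have -> : (fun u => 2^-1 * inner (Amx l t *m u) u + G l t u) =
  (fun u => 2^-1 * inner (Amx l t *m u) u) + G l t by apply/funext.
have d := is_deriveD dq (DeriveDef dG erefl).
rewrite (derive_val (is_derive := d)) inner_delta mxE; congr (_ + _).
by rewrite -gradE mxE.
Qed.

(** As [J^2 = - 1], the system reads [u' = J (A u + grad G)]; the two hypotheses are its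
    coordinates. *)
Lemma solution_of_components (phi : 'I_k -> R) t (u0 u1 : R -> R) (l := (fun j => expi (phi j)) : torus R k)
  (p := atan (pos t)) (m := - atan (pos (- t))) (th := \sum_j phi j) (u := fun t => col2 (u0 t) (u1 t)) :
  is_derive t 1 u0 (- (m + p * cos th) * u0 t - p * sin th * u1 t - grad G 1 l (t, u t)) ->
  is_derive t 1 u1 (- p * sin th * u0 t + (m + p * cos th) * u1 t + grad G 0 l (t, u t)) ->
  Jmx R *m derive1 u t + gradient (hamiltonian G l t) (u t) = 0.
Proof.
move=> d0 d1; rewrite gradient_hamiltonian derive1E.
have du := col2_is_derive d0 d1; rewrite derive_val /l Amx_coefficient -/l -/p -/m -/th.
by apply/matrixP; apply: ord2_case => j; rewrite (ord1 j) !mxE !big_ord_recl !big_ord0 !mxE /=;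
  move: (grad G 0 l _) (grad G 1 l _) => G0 G1; ring.
Qed.

Hypothesis G_growth : exists (p C : R) (g : R -> R),
     [/\ 0 < p, 0 <= C, sobolev_H1 g &
         forall lambda t u,
           `|hessian (G lambda t) u| <= g t + C * `|u| `^ p].
Hypothesis G_grad0 : forall l t, gradient (G l t) 0 = 0.
Hypothesis G_hess0 : forall l t, hessian (G l t) 0 = 0.

Lemma antidiagonal_bifurcation (psi : 'I_k -> R) (i0 : 'I_k) : \sum_j psi j = 0 ->
  bifurcation_points G (fun j => expi (psi j)).
Proof.
move=> psi0 U e nU e0.
pose phi (th : R) (j : 'I_k) := psi j + (if j == i0 then th else 0).
pose lam (th : R) : torus R k := fun j => expi (phi th j).
have phi_sum th : \sum_j phi th j = th.
  by rewrite big_split /= psi0 add0r -big_mkcond big_pred1_eq.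
have clam : continuous lam.
  apply: continuous_torus => j; apply: (continuous_compose (@expi_continuous R)).
  apply: continuous_add; first exact: continuous_cst.
  by case: (j == i0); [exact: continuous_id|exact: continuous_cst].
have lam0 : lam 0 = (fun j => expi (psi j)).
  by apply/funext => j; rewrite /lam /phi if_same addr0.
have [d /= d0 dU] : exists2 d : R, 0 < d & forall th, `|th| < d -> U (lam th).
  have : nbhs (lam 0) U by rewrite lam0.
  move=> /clam/nbhs_ballP[d /= d0 dP]; exists d => // th thd; apply: dP.
  by rewrite -ball_normE /= sub0r normrN.
pose th0 := Num.min (d / 2) 1.
have th00 : 0 < th0 by rewrite lt_min ltr01 divr_gt0.
have th0d : th0 < d by rewrite gt_min; apply/orP; left; lra.
have th01 : th0 <= 1 by rewrite ge_min lexx orbT.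
have s0 : 0 < sin (th0 / 2).
  by apply: sin_gt0_pi; rewrite divr_gt0//=; have := pi_ge2 R; lra.
have E0 : 0 < expR (pi : R) by exact: expR_gt0.
have E1 : 1 <= expR (pi : R) by rewrite -expR0 ler_expR pi_ge0.
have p0 : 0 <= (pi : R) by exact: pi_ge0.
(* Half of what [shooting] tolerates, whose inequality is strict. *)
pose eps := sin (th0 / 2) / (144 * expR pi).
have eps0 : 0 < eps by rewrite divr_gt0// mulr_gt0.
have epsE : 72 * expR pi * eps < sin (th0 / 2).
  rewrite (_ : 72 * expR pi * eps = sin (th0 / 2) / 2); first lra.
  by rewrite /eps; field; rewrite gt_eqF.
have eps1 : eps <= 1.
  rewrite ler_pdivrMr ?mulr_gt0// mul1r; apply: (le_trans (sin_le1 _)); lra.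
have [delta delta0 hb] := hess_small G_C2 G_growth G_hess0 clam eps0.
(* Truncated outside [-1, 1] and the ball of radius [delta], the gradient becomes globally Lipschitz. *)
pose cl := clamp (-1) 1 : R -> R; pose cd := clamp (- delta) delta : R -> R.
have cdI x : - delta <= cd x <= delta by apply: clamp_itv; lra.
have clI x : -1 <= cl x <= 1 by apply: clamp_itv; lra.
pose w (u : R * R) := col2 (cd u.1) (cd u.2).
have wd u : `|w u| <= delta by rewrite col2_norm ge_max !ler_norml !cdI.
pose g i (q u : R * R) := grad G i (lam (cl q.1)) (q.2, w u).
have cg i : continuous (fun z : (R * R) * (R * R) => g i z.1 z.2).
  apply: (@continuous_compose _ _ _ (fun p : torus R k * (R * 'cV[R]_2) => grad G i p.1 p.2)
    (fun z : (R * R) * (R * R) => (lam (cl z.1.1), (z.1.2, w z.2)))); first exact: grad_continuous.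
  apply: continuous_pair.
    apply: (continuous_compose clam); apply: (continuous_compose (@clamp_continuous _ _ _)).
    exact: (continuous_compose (@continuous_fst _ _) (@continuous_fst _ _)).
  apply: continuous_pair; first exact: (continuous_compose (@continuous_snd _ _) (@continuous_fst _ _)).
  apply: col2_continuous; apply: (continuous_compose (@clamp_continuous _ _ _)).
    exact: (continuous_compose (@continuous_fst _ _) (@continuous_snd _ _)).
  exact: (continuous_compose (@continuous_snd _ _) (@continuous_snd _ _)).
have g0 i q : g i q (0, 0) = 0.
  rewrite /g /w /= /cd clamp_id ?oppr_le0 ?(ltW delta0)// /col2 !scale0r addr0.
  by rewrite -gradE G_grad0 mxE.
have gl i q u v : `|g i q u - g i q v| <= eps * (`|u.1 - v.1| + `|u.2 - v.2|).
  have := grad_lip G_C2 (fun j u h => hb (cl q.1) q.2 u i j (clI _) h) (wd u) (wd v).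
  rewrite !col2_0 !col2_1 => /le_trans; apply; rewrite ler_pM2l//.
  by apply: lerD; exact: clamp_lip.
(* Relative to the weight, [u] is bounded by [8 * a] and [u'] by [8 * (pi + 1) * a], where [pi]
   comes from the coefficients and [1] from [eps <= 1]. As the weight is at most [expR pi], each
   supremum is at most a quarter of [min delta e]: the truncation is inactive and the norm stays
   below [e]. *)
pose a := Num.min delta e / (32 * (pi + 1) * expR pi).
have m0 : 0 < Num.min delta e by rewrite lt_min delta0.
have a0 : 0 < a by rewrite divr_gt0// !mulr_gt0// ltr_wpDl.
have [th [u0 [u1 [thb u0a [cu0 cu1] ub ode]]]] :=
  shooting a0 (ltW eps0) th00 epsE (cg 0) (cg 1) (g0 0) (g0 1) (gl 0) (gl 1).
pose K := 8 * (pi + 1) * a.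
have KE : K * expR pi = Num.min delta e / 4.
  rewrite /K /a; field; rewrite !gt_eqF//; lra.
have K8 : 8 * a <= K by have := mulr_ge0 p0 (ltW a0); rewrite /K; lra.
have x0 (t : R) : 0 <= xweight `|t| by exact/ltW/xweight_gt0.
have uK t : `|u0 t| + `|u1 t| <= K * xweight `|t|.
  by apply: (le_trans (ub t)); rewrite ler_wpM2r.
pose u t := col2 (u0 t) (u1 t).
have xE (t : R) : xweight `|t| <= expR pi by exact: xweight_le.
have K0 : 0 <= K by apply: le_trans K8; rewrite mulr_ge0// ltW.
have Kmin : K * expR pi <= delta / 4 /\ K * expR pi <= e / 4.
  by rewrite KE !ler_pM2r ?invr_gt0// !ge_min !lexx orbT.
have ud t : `|u0 t| <= delta /\ `|u1 t| <= delta.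
  have := le_trans (uK t) (ler_wpM2l K0 (xE t)).
  by have [] := Kmin; have := normr_ge0 (u0 t); have := normr_ge0 (u1 t); split; lra.
have wE t : w (u0 t, u1 t) = u t.
  by have [] := ud t; rewrite !ler_norml => h0 h1; rewrite /w /= /cd !clamp_id.
have clth : cl th = th.
  by rewrite /cl clamp_id// -ler_norml (le_trans thb).
have gE i t : g i (th, t) (u0 t, u1 t) = grad G i (lam th) (t, u t) by rewrite /g /= clth wE.
pose p t := atan (pos t); pose m t := - atan (pos (- t)).
pose q0 (t : R) : R := - (m t + p t * cos th) * u0 t - p t * sin th * u1 t - g 1 (th, t) (u0 t, u1 t).
pose q1 (t : R) : R := - p t * sin th * u0 t + (m t + p t * cos th) * u1 t + g 0 (th, t) (u0 t, u1 t).
have d0' (t : R) : is_derive t 1 u0 (q0 t) by have [] := ode t.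
have d1' (t : R) : is_derive t 1 u1 (q1 t) by have [] := ode t.
have du (t : R) : is_derive t 1 u (col2 (q0 t) (q1 t)) by exact: col2_is_derive.
have DE (t : R) : derive1 u t = col2 (q0 t) (q1 t) by rewrite derive1E derive_val.
have atanb (x : R) : `|atan x| <= pi / 2.
  by rewrite ler_norml; apply/andP; split; apply: ltW; [exact: atan_gtNpi2|exact: atan_ltpi2].
have cb : `|cos th| <= 1 by rewrite ler_norml cos_geN1 cos_le1.
have sb : `|sin th| <= 1 by rewrite ler_norml sin_geN1 sin_le1.
have gb i (t : R) : `|g i (th, t) (u0 t, u1 t)| <= `|u0 t| + `|u1 t|.
  have := gl i (th, t) (u0 t, u1 t) (0, 0); rewrite g0 /= !subr0 => /le_trans; apply.
  by rewrite ler_piMl// addr_ge0.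
have pb (t x : R) : `|p t * sin th * x| <= pi / 2 * `|x|.
  by rewrite !normrM ler_wpM2r// -[leRHS]mulr1; apply: ler_pM => //; exact: atanb.
have mb (t x : R) : `|(m t + p t * cos th) * x| <= pi * `|x|.
  rewrite normrM ler_wpM2r//; apply: (le_trans (ler_normD _ _)).
  rewrite normrM normrN [leRHS]splitr; apply: lerD; first exact: atanb.
  by rewrite -[leRHS]mulr1; apply: ler_pM => //; exact: atanb.
have qK (t : R) : `|q0 t| <= K * xweight `|t| /\ `|q1 t| <= K * xweight `|t|.
  have S : (pi + 1) * (`|u0 t| + `|u1 t|) <= K * xweight `|t|.
    have -> : K * xweight `|t| = (pi + 1) * (8 * a * xweight `|t|) by rewrite /K; ring.
    by apply: ler_wpM2l => //; rewrite addr_ge0.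
  have := pb t (u0 t); have := pb t (u1 t); have := mb t (u0 t); have := mb t (u1 t).
  have := gb 0 t; have := gb 1 t.
  have := mulr_ge0 p0 (normr_ge0 (u0 t)); have := mulr_ge0 p0 (normr_ge0 (u1 t)).
  move=> n1 n0 G1 G0 m1 m0' p1 p0'; split; apply: le_trans S.
    apply: (le_trans (ler_normB _ _)); apply: (le_trans (lerD (ler_normB _ _) (lexx _))).
    by rewrite mulNr normrN; move: n1 n0 G1 m0' p1; clear; lra.
  apply: (le_trans (ler_normD _ _)); apply: (le_trans (lerD (ler_normD _ _) (lexx _))).
  by rewrite !mulNr normrN; move: n1 n0 G0 m1 p0'; clear; lra.
have uN (t : R) : `|u t| <= K * xweight `|t| by apply: le_trans (uK t); exact: col2_norm_le.
have duN (t : R) : `|derive1 u t| <= K * xweight `|t|.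
  by rewrite DE col2_norm ge_max; have [-> ->] := qK t.
exists (lam th), u; split.
- by apply: dU; exact: le_lt_trans th0d.
- have cp : continuous p by apply: (continuous_compose (@continuous_atan R)); exact: max0_continuous.
  have cm : continuous m.
    apply: continuous_opp; apply: (continuous_compose (@continuous_atan R)).
    by apply: (continuous_compose (@max0_continuous R)); exact: opp_continuous.
  have cmp : continuous (fun t => m t + p t * cos th).
    by apply: continuous_add => //; apply: continuous_mul => //; exact: continuous_cst.
  have cgu i : continuous (fun t => g i (th, t) (u0 t, u1 t)).
    apply: (@continuous_compose _ _ _ (fun z : (R * R) * (R * R) => g i z.1 z.2) (fun t => ((th, t), (u0 t, u1 t)))) => //.
    apply: continuous_pair; last exact: continuous_pair.
    by apply: continuous_pair; [exact: continuous_cst|exact: continuous_id].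
  have cq0 : continuous q0.
    apply: continuous_sub => //; apply: continuous_sub; apply: continuous_mul => //; first exact: continuous_opp.
    by apply: continuous_mul => //; exact: continuous_cst.
  have cq1 : continuous q1.
    apply: continuous_add => //; apply: continuous_add; apply: continuous_mul => //.
    by apply: continuous_mul; [exact: continuous_opp|exact: continuous_cst].
  split.
  + by move=> t; case: (du t).
  + by rewrite (funext DE); exact: col2_continuous.
  + exact: vanishes_xweight uN.
  + exact: vanishes_xweight duN.
- have supb (v : R -> 'cV[R]_2) : (forall t, `|v t| <= K * xweight `|t|) ->
      sup (range (fun t => `|v t|)) <= K * expR pi.
    move=> hv; apply: ge_sup; first by exists (`|v 0|), 0.
    by move=> _ [t _ <-]; apply: (le_trans (hv t)); exact: ler_wpM2l.
  have := supb _ uN; have := supb _ duN; have [_] := Kmin; rewrite /C1norm; lra.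
- move=> /(congr1 (fun v : R -> 'cV[R]_2 => v 0 0 0)); rewrite /u col2_0 u0a mxE => a00.
  by rewrite a00 ltxx in a0.
- split; last exact: vanishes_xweight uN.
  move=> t; split; first by case: (du t).
  by apply: (@solution_of_components (phi th) t u0 u1); rewrite phi_sum -/(lam th) -/(u t) -gE; [exact: d0'|exact: d1'].
Qed.

End Bifurcation.

Theorem theorem3p3 (R : realType) (k : nat)
    (G : torus R k -> R -> 'cV[R]_2 -> R) :
  (2 <= k)%N ->
  Cn_family 2 (fun lambda (x : R * 'cV[R]_2) => G lambda x.1 x.2) ->
  (forall lambda t,
     [/\ G lambda t 0 = 0, gradient (G lambda t) 0 = 0 &
         hessian (G lambda t) 0 = 0]) ->
  (exists (p C : R) (g : R -> R),
     [/\ 0 < p, 0 <= C, sobolev_H1 g &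
         forall lambda t u,
           `|hessian (G lambda t) u| <= g t + C * `|u| `^ p]) ->
  ((k - 1)%N%:R%:E <= covering_dim R (set_type (bifurcation_points G)))%E /\
  ~ contractible R (set_type (bifurcation_points G)).
Proof.
case: k G => [|[|n]]// G _ G_C2 G_0 G_growth.
have B (psi : 'I_n.+2 -> R) : \sum_j psi j = 0 -> bifurcation_points G (fun j => expi (psi j)).
  apply: (antidiagonal_bifurcation G_C2 G_growth) => // [l t|l t|]; [by case: (G_0 l t)|by case: (G_0 l t)|exact: ord0].
split; last exact: not_contractible_antidiagonal.
by rewrite subn1; exact: covering_dim_antidiagonal.
Qed.
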